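(* Let $g\in L^2(\mathbb{R})$, let $\Lambda\subset\mathbb{R}$ be countable, and let $\vec{d}=R(\theta)\vec{e}_2$ with $\theta\in\mathbb{T}$. The collection of parallel lines $$L_{\vec{d},\Lambda}:=\{t\vec{d}+\lambda\vec{d}_\bot:\ t\in\mathbb{R},\ \lambda\in\Lambda\}$$ is a Gabor sampling trajectory for $L^2(\mathbb{R})$ (with window $g$) with sampling bounds $A,B>0$ if and only if $$A\leq\sum_{\lambda\in\Lambda}|\mu(\theta)g(t-\lambda)|^2\leq B\quad\text{for a.e. }t\in\mathbb{R}.$$
   Context: $\mathbb{T}\cong[0,1)$; $R(\theta)=\begin{pmatrix}\cos(2\pi\theta)&-\sin(2\pi\theta)\\ \sin(2\pi\theta)&\cos(2\pi\theta)\end{pmatrix}$; $\vec{e}_1,\vec{e}_2$ is the standard basis of $\mathbb{R}^2$. For a unit vector $\vec{d}$, $\vec{d}_\bot$ is the vector obtained by rotating $\vec{d}$ by $\pi/2$ clockwise, i.e. $\vec{d}_\bot=R(\theta)\vec{e}_1$ when $\vec{d}=R(\theta)\vec{e}_2$. For $z=(x,\xi)\in\mathbb{R}^2$ and $f,g\in L^2(\mathbb{R})$, $V_gf(z)=\int_{\mathbb{R}}f(t)\overline{g(t-x)}e^{-2\pi i\xi t}dt$. $\mathcal{H}^1$ is 1-dimensional Hausdorff measure, normalized to equal Lebesgue measure on lines. $\Gamma\subset\mathbb{R}^2$ is a Gabor sampling trajectory for $L^2(\mathbb{R})$ with sampling bounds $A,B$ if $A\|f\|_2^2\leq\int_\Gamma|V_gf(z)|^2d\mathcal{H}^1(z)\leq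 B\|f\|_2^2$ for all $f\in L^2(\mathbb{R})$. Metaplectic rotation: $\mu(\theta)f=\sum_{n\geq0}e^{-2\pi in\theta}\langle f,h_n\rangle h_n$ for $f\in L^2(\mathbb{R})$, where $h_n(t)=\frac{2^{1/4}}{\sqrt{n!}}\left(\frac{-1}{2\sqrt{\pi}}\right)^n e^{\pi t^2}\frac{d^n}{dt^n}(e^{-2\pi t^2})$, $n\in\mathbb{N}_0$, are the Hermite functions (an orthonormal basis of $L^2(\mathbb{R})$). *)

(* Defs.v *)
From HB Require Import structures.
From mathcomp Require Import all_boot all_order all_algebra.
From mathcomp Require Import complex.
From mathcomp Require Import all_classical all_reals all_analysis.

Set Implicit Arguments.
Unset Strict Implicit.
Unset Printing Implicit Defensive.
Import Order.TTheory GRing.Theory Num.Theory.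
Import numFieldNormedType.Exports.

Local Open Scope classical_set_scope.
Local Open Scope ring_scope.

Section Plane.
Context {R : realType}.
Implicit Types (z w d : R * R) (theta : R).

Definition e1 : R * R := (1, 0).
Definition e2 : R * R := (0, 1).

(** The linear map with matrix [[cos, - sin], [sin, cos]] at angle
    [2 * pi * theta]: one full turn is [theta = 1]. *)
Definition rotation theta z : R * R :=
  (cos (2 * pi * theta) * z.1 - sin (2 * pi * theta) * z.2,
   sin (2 * pi * theta) * z.1 + cos (2 * pi * theta) * z.2).

(** Quarter turn clockwise. *)
Definition perp d : R * R := (d.2, - d.1).

Lemma perp_rotation theta : perp (rotation theta e2) = rotation theta e1.
Proof.
by rewrite /perp /rotation /= !mulr0 !mulr1 add0r sub0r opprK addr0 subr0.
Qed.

Definition parallel_lines d (Lambda : set R) : set (R * R) :=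
  [set z | exists t, exists2 l, Lambda l & z = t *: d + l *: perp d].

(** The norm carried by the product type is the sup norm, hence an explicit
    Euclidean distance. *)
Definition edist z w : R :=
  Num.sqrt ((z.1 - w.1) ^+ 2 + (z.2 - w.2) ^+ 2).

End Plane.

Section Hausdorff.
Context {R : realType}.
Local Open Scope ereal_scope.
Implicit Types (E U : set (R * R)) (delta : R).

(** Adding [0] only matters for the empty set, whose diameter is [0]. *)
Definition diam U : \bar R :=
  ereal_sup (0 |` [set (edist p.1 p.2)%:E | p in U `*` U]).

Definition fine_cover delta E : set ((set (R * R))^nat) :=
  [set U | (forall k, diam (U k) <= delta%:E) /\ E `<=` \bigcup_k U k].

Definition hausdorff1_delta delta E : \bar R :=
  ereal_inf [set \sum_(k <oo) diam (U k) | U in fine_cover delta E].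

(** No dimensional constant is needed for this to be length on lines. *)
Definition hausdorff1 E : \bar R :=
  ereal_sup [set hausdorff1_delta delta E | delta in [set x : R | (0 < x)%R]].

Lemma diam_ge0 U : 0 <= diam U.
Proof. by apply: ereal_sup_ubound; left. Qed.

Lemma diam0 : diam set0 = 0.
Proof.
apply/eqP; rewrite eq_le diam_ge0 andbT.
by apply: ge_ereal_sup => _ [->//|[p [] []]].
Qed.

Lemma hausdorff1_delta_ge0 delta E : 0 <= hausdorff1_delta delta E.
Proof.
apply: le_ereal_inf_tmp => _ [U _ <-].
by apply: nneseries_ge0 => *; exact: diam_ge0.
Qed.

Lemma hausdorff1_delta0 delta : (0 < delta)%R -> hausdorff1_delta delta set0 = 0.
Proof.
move=> d0; apply/eqP; rewrite eq_le hausdorff1_delta_ge0 andbT.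
apply: ereal_inf_lbound; exists (fun=> set0).
  by split => // k; rewrite diam0 lee_fin ltW.
by rewrite eseries0// => *; rewrite diam0.
Qed.

Lemma le_hausdorff1_delta delta :
  {homo hausdorff1_delta delta : E F / E `<=` F >-> E <= F}.
Proof.
move=> E F EF; apply/ereal_inf_le_tmp => _ [U [dU FU] <-].
by exists U => //; split => //; exact: subset_trans FU.
Qed.

Lemma hausdorff1_delta_sigma_subadditive delta :
  sigma_subadditive (hausdorff1_delta delta).
Proof.
move=> A; have [[i ioo]|] :=
    pselect (exists i, hausdorff1_delta delta (A i) = +oo).
  rewrite (eseries_pinfty _ _ ioo) ?leey// => n _.
  by rewrite -ltNye (lt_le_trans _ (hausdorff1_delta_ge0 _ _)).
rewrite -forallNE => Aoo.
suff add2e (e : {posnum R}) : hausdorff1_delta delta (\bigcup_n A n) <=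
    \sum_(i <oo) hausdorff1_delta delta (A i) + e%:num%:E.
  by apply/lee_addgt0Pr => _/posnumP[].
rewrite (le_trans _ (epsilon_trick _ _ _))//; last first.
  by move=> n; exact: hausdorff1_delta_ge0.
pose P n (B : (set (R * R))^nat) := fine_cover delta (A n) B /\
  \sum_(k <oo) diam (B k) <=
  hausdorff1_delta delta (A n) + (e%:num / (2 ^ n.+1)%:R)%:E.
have [G PG] : {G : ((set (R * R))^nat)^nat & forall n, P n (G n)}.
  apply: (@choice _ _ P) => n; rewrite /P.
  have fA : hausdorff1_delta delta (A n) \is a fin_num.
    by rewrite ge0_fin_numE ?hausdorff1_delta_ge0// ltey; apply/eqP/Aoo.
  have en1 : (0 < e%:num / (2 ^ n.+1)%:R)%R by [].
  have [x [B mB Bx] xS] := lb_ereal_inf_adherent en1 fA.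
  by exists B; split => //; rewrite Bx; exact/ltW.
have muG_ge0 x : 0 <= (diam \o uncurry G) x by exact: diam_ge0.
apply: (@le_trans _ _ (\esum_(i in setT) (diam \o uncurry G) i)).
  apply: ereal_inf_lbound => /=.
  have /card_esym/ppcard_eqP[f] := card_nat2.
  exists (uncurry G \o f).
    split => [i|].
      by rewrite /= /uncurry; case: (f i) => a b; exact: (PG a).1.1.
    apply: (@subset_trans _  (\bigcup_n \bigcup_k G n k)) => [t [i _]|].
      by move=> /(PG i).1.2 -[j _ ?]; exists i => //; exists j.
    move=> t [i _ [j _ Bijt]]; exists (f^-1%FUN (i, j)) => //=.
    by rewrite invK ?inE.
  rewrite -(esum_pred_image (diam \o uncurry G) _ xpredT) ?[fun=> _]set_true//.
  by rewrite image_eq.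
rewrite (_ : esum _ _ = \sum_(i <oo) \sum_(j <oo ) diam (G i j)); last first.
  pose J : nat -> set (nat * nat) := fun i => [set (i, j) | j in setT].
  rewrite (_ : setT = \bigcup_k J k); last first.
    by rewrite predeqE => -[a b]; split => // _; exists a => //; exists b.
  rewrite esum_bigcupT /=; last 2 first.
    - apply/trivIsetP => i j _ _ ij.
      rewrite predeqE => -[n m] /=; split => //= -[] [_] _ [<-{n} _].
      by move=> [m' _] [] /esym/eqP; rewrite (negbTE ij).
    - by move=> /= [n m]; exact: diam_ge0.
  rewrite -(image_id [set: nat]) -fun_true esum_pred_image//; last first.
    by move=> n _; apply: esum_ge0 => ? _; exact: diam_ge0.
  apply: eq_eseriesr => /= j _.
  rewrite -(esum_pred_image (diam \o uncurry G) (pair j) predT)//=; last first.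
  - by move=> ? ? _ _; exact: (@can_inj _ _ _ snd).
  - by move=> *; exact: diam_ge0.
  by congr esum; rewrite predeqE => -[a b]; split; move=> [i _ <-]; exists i.
apply: lee_lim.
- apply: is_cvg_nneseries => n *.
  by apply: nneseries_ge0 => m *; exact: (muG_ge0 (n, m)).
- apply: is_cvg_nneseries => n *.
  by apply: adde_ge0 => //; exact: hausdorff1_delta_ge0.
- by near=> n; apply: lee_sum => i _; exact: (PG i).2.
Unshelve. all: by end_near. Qed.

Lemma hausdorff1_0 : hausdorff1 set0 = 0.
Proof.
apply/eqP; rewrite eq_le; apply/andP; split.
  by apply: ge_ereal_sup => _ [x /= x0 <-]; rewrite hausdorff1_delta0.
apply: ereal_sup_ubound; exists 1%R => //=; exact: hausdorff1_delta0.
Qed.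

Lemma hausdorff1_ge0 E : 0 <= hausdorff1 E.
Proof.
apply: (le_trans (hausdorff1_delta_ge0 1 E)).
by apply: ereal_sup_ubound; exists 1%R => /=.
Qed.

Lemma le_hausdorff1 : {homo hausdorff1 : E F / E `<=` F >-> E <= F}.
Proof.
move=> E F EF; apply: ge_ereal_sup => _ [x /= x0 <-].
apply: (le_trans (le_hausdorff1_delta x EF)).
by apply: ereal_sup_ubound; exists x.
Qed.

Lemma hausdorff1_sigma_subadditive : sigma_subadditive hausdorff1.
Proof.
move=> A; apply: ge_ereal_sup => _ [x /= x0 <-].
apply: (le_trans (hausdorff1_delta_sigma_subadditive x A)).
apply: lee_nneseries => [i _ _|i _]; first exact: hausdorff1_delta_ge0.
by apply: ereal_sup_ubound; exists x.
Qed.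

HB.instance Definition _ := isOuterMeasure.Build R (R * R)%type hausdorff1
  hausdorff1_0 hausdorff1_ge0 le_hausdorff1 hausdorff1_sigma_subadditive.

Definition hausdorff1_outer : {outer_measure set (R * R) -> \bar R} :=
  hausdorff1.

(** 1-dimensional Hausdorff measure on its Caratheodory sigma-algebra, which
    contains the Borel sets because [hausdorff1] is a metric outer measure. *)
Definition hausdorff1_measure :
    {measure set (caratheodory_type hausdorff1_outer) -> \bar R} :=
  (hausdorff1_outer : set (caratheodory_type hausdorff1_outer) -> \bar R).

End Hausdorff.

Section L2.
Context {R : realType}.
Local Open Scope complex_scope.
Implicit Types (f g h : R -> R[i]).

Definition cmod (z : R[i]) : R := ComplexField.Normc.normc z.

Definition expi (x : R) : R[i] := cos x +i* sin x.

Definition L2norm f : \bar R :=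
  ('N[lebesgue_measure]_2%:E [(fun t => (cmod (f t))%:E)])%E.

(** Square-integrable functions, not identified up to a.e. equality. *)
Definition L2 f : Prop :=
  [/\ measurable_fun setT (fun t => complex.Re (f t)),
      measurable_fun setT (fun t => complex.Im (f t)) &
      (L2norm f < +oo)%E].

Definition cintegral f : R[i] :=
  (\int[lebesgue_measure]_t complex.Re (f t))%R +i*
  (\int[lebesgue_measure]_t complex.Im (f t))%R.

Definition inner f h : R[i] := cintegral (fun t => f t * (h t)^*).

Definition stft g f (z : R * R) : R[i] :=
  cintegral (fun t => f t * (g (t - z.1))^* * expi (- 2 * pi * z.2 * t)).

Definition gabor_sampling_trajectory g (Gamma : set (R * R)) (A B : R) : Prop :=
  forall f, L2 f ->
    (A%:E * L2norm f ^+ 2 <=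
       \int[hausdorff1_measure]_(z in Gamma) (cmod (stft g f z) ^+ 2)%:E
     <= B%:E * L2norm f ^+ 2)%E.

Definition hermite (n : nat) (t : R) : R :=
  2 `^ 4^-1 / Num.sqrt (n`!)%:R * (- 1 / (2 * Num.sqrt pi)) ^+ n *
  expR (pi * t ^+ 2) * derive1n n (fun s => expR (- 2 * pi * s ^+ 2)) t.

Definition chermite (n : nat) (t : R) : R[i] := (hermite n t)%:C.

(** [G] represents the L2 sum of the Hermite series defining the metaplectic
    rotation of [f]; it is determined up to a.e. equality. *)
Definition is_metaplectic (theta : R) f (G : R -> R[i]) : Prop :=
  L2 G /\
  (fun N : nat => L2norm (fun t => G t - \sum_(n < N)
     expi (- 2 * pi * n%:R * theta) * inner f (chermite n) * chermite n t))
    @ \oo --> 0%E.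

(** A chosen representative; the default value [0] is irrelevant when [f] is
    square integrable, the series being convergent in L2. *)
Definition metaplectic (theta : R) f : R -> R[i] :=
  xget (fun=> 0) [set G | is_metaplectic theta f G].

End L2.

(* Main.v *)
(* The short-time Fourier transform is covariant under the metaplectic rotation:
   |V_g f (R(theta) z)| = |V_G F (z)| for G = mu(theta) g and F = mu(theta) f.
   It suffices to see this for Hermite functions, where V_{h_n} h_m is a radial
   Gaussian times a phase times a polynomial that R(theta) multiplies by
   e^{-2 pi i (m - n) theta}; the general case follows from the completeness of
   the Hermite functions. The lines are thus rotated to the vertical lines
   {l} x R, on which V_G F (l, .) is the Fourier transform of F conj(G(. - l)).
   As H^1 restricts to Lebesgue measure on each line, Plancherel's theorem turns
   the sampling integral into \int |F|^2 S, where S is the sum over l of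
   |G(. - l)|^2. Since F runs over the whole of L^2, the sampling inequalities
   for all f mean that A <= S <= B almost everywhere. *)
From HB Require Import structures.
Require Import Defs.
From mathcomp Require Import all_boot all_order all_algebra.
From mathcomp Require Import complex ring lra.
From mathcomp Require Import all_classical all_reals all_analysis measurable_realfun.
Import Order.TTheory GRing.Theory Num.Theory.
Import numFieldNormedType.Exports.

Set Implicit Arguments.
Unset Strict Implicit.
Unset Printing Implicit Defensive.

Local Open Scope classical_set_scope.
Local Open Scope ring_scope.
Local Notation "x %:C" := (real_complex _ x) (format "x %:C") : ring_scope.

Local Notation Re := complex.Re.
Local Notation Im := complex.Im.

Arguments cmod {R} : simpl never.

(** The analysis rests on Gaussian moments. A linear functional on polynomials is fixed by its value
    at 1 and by its integration by parts, so orthogonality, contour shifts and the effect of a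
    rotation become identities between polynomials. Completeness comes from a moment problem: sines
    are limits of polynomials with exponential bounds, and powers built from sines approximate
    indicators of half-lines. It is stated for functions that are merely integrable against
    Gaussians with exponential factors. It thus applies to the Fourier transform of an integrable
    function, which is bounded but not yet known to be square integrable, and Plancherel follows
    because Hermite functions are eigenfunctions. Plancherel is used on integrable,
    square-integrable functions, whereas the product of F and a conjugated translate of G is a
    priori only integrable. When bounds on S are to be derived, F is the indicator of a bounded set;
    when they are given, S <= B supplies the missing square integrability. As S may a priori be
    infinite, it is compared with constants through its integrals over bounded sets. *)

(** * Complex-valued functions through their real and imaginary parts *)

Section ComplexAlgebra.
Context {R : realType}.
Implicit Types (z w : R[i]) (x y : R).

Lemma ReD z w : Re (z + w) = Re z + Re w. Proof. by case: z w => ? ? []. Qed.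
Lemma ImD z w : Im (z + w) = Im z + Im w. Proof. by case: z w => ? ? []. Qed.
Lemma ReN z : Re (- z) = - Re z. Proof. by case: z. Qed.
Lemma ImN z : Im (- z) = - Im z. Proof. by case: z. Qed.

Lemma ReM z w : Re (z * w) = Re z * Re w - Im z * Im w.
Proof. by case: z w => ? ? []. Qed.

Lemma ImM z w : Im (z * w) = Re z * Im w + Im z * Re w.
Proof. by case: z w => ? ? []. Qed.

Lemma ReJ z : Re z^* = Re z. Proof. by case: z. Qed.
Lemma ImJ z : Im z^* = - Im z. Proof. by case: z. Qed.

Lemma eq_ReIm z w : Re z = Re w -> Im z = Im w -> z = w.
Proof. by case: z w => a b [c d] /= -> ->. Qed.

Lemma cmodE z : cmod z = Num.sqrt (Re z ^+ 2 + Im z ^+ 2).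
Proof. by case: z. Qed.

Lemma cmod_sqr z : cmod z ^+ 2 = Re z ^+ 2 + Im z ^+ 2.
Proof. by rewrite cmodE sqr_sqrtr// addr_ge0// sqr_ge0. Qed.

Lemma cmod_ge0 z : 0 <= cmod z. Proof. by rewrite cmodE sqrtr_ge0. Qed.

Lemma cmodM z w : cmod (z * w) = cmod z * cmod w.
Proof. exact: ComplexField.Normc.normcM. Qed.

Lemma cmodD z w : cmod (z + w) <= cmod z + cmod w.
Proof. exact: le_normcD. Qed.

Lemma cmodN z : cmod (- z) = cmod z.
Proof. by rewrite !cmodE ReN ImN !sqrrN. Qed.

Lemma cmodJ z : cmod z^* = cmod z.
Proof. by rewrite !cmodE ReJ ImJ sqrrN. Qed.

Lemma cmod0 : cmod (0 : R[i]) = 0.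
Proof. exact: ComplexField.Normc.normc0. Qed.

Lemma cmod_real x : cmod x%:C = `|x|.
Proof. by rewrite cmodE /= expr0n addr0 sqrtr_sqr. Qed.

Lemma cmod_eq0 z : cmod z = 0 -> z = 0.
Proof. exact: ComplexField.Normc.eq0_normc. Qed.

Lemma Re_le_cmod z : `|Re z| <= cmod z.
Proof. by rewrite cmodE -sqrtr_sqr ler_sqrt ?lerDl ?addr_ge0 ?sqr_ge0. Qed.

Lemma Im_le_cmod z : `|Im z| <= cmod z.
Proof. by rewrite cmodE -sqrtr_sqr ler_sqrt ?lerDr ?addr_ge0 ?sqr_ge0. Qed.

Lemma cmod_le z : cmod z <= `|Re z| + `|Im z|.
Proof.
by rewrite [in leLHS](complexE z) (le_trans (cmodD _ _))// cmodM !cmod_real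
  cmodE /= expr0n expr1n add0r sqrtr1 mul1r.
Qed.

Lemma cmod_sqrD z w : cmod (z + w) ^+ 2 <= 2 * (cmod z ^+ 2 + cmod w ^+ 2).
Proof.
rewrite !cmod_sqr ReD ImD.
have := sqr_ge0 (Re z - Re w); have := sqr_ge0 (Im z - Im w).
by rewrite !sqrrB !sqrrD; lra.
Qed.

Lemma mulJ_cmod z : z * z^* = (cmod z ^+ 2)%:C.
Proof.
by apply: eq_ReIm; rewrite ?ReM ?ImM ReJ ImJ /= ?cmod_sqr; ring.
Qed.

Lemma cjM z w : (z * w)^* = z^* * w^*. Proof. exact: rmorphM. Qed.
Lemma cjD z w : (z + w)^* = z^* + w^*. Proof. exact: rmorphD. Qed.
Lemma cjN z : (- z)^* = - z^*. Proof. exact: rmorphN. Qed.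

Lemma expiD x y : expi (x + y) = expi x * expi y.
Proof. by apply: eq_ReIm; rewrite ?ReM ?ImM /= ?cosD ?sinD //; ring. Qed.

Lemma expi0 : expi (0 : R) = 1.
Proof. by rewrite /expi cos0 sin0. Qed.

Lemma expiJ x : (expi x)^* = expi (- x).
Proof. by rewrite /expi /= cosN sinN. Qed.

Lemma cmod_expi x : cmod (expi x) = 1.
Proof. by rewrite cmodE /= cos2Dsin2 sqrtr1. Qed.

Lemma expiMn x n : expi (x * n%:R) = expi x ^+ n.
Proof.
elim: n => [|n IH]; first by rewrite mulr0 expi0.
by rewrite exprS -IH -expiD mulrSr mulrDr mulr1 addrC.
Qed.

Lemma expiVM x : expi x * expi (- x) = 1.
Proof. by rewrite -expiD subrr expi0. Qed.

Lemma ReZ x z : Re (x%:C * z) = x * Re z.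
Proof. by rewrite ReM /= mul0r subr0. Qed.

Lemma ImZ x z : Im (x%:C * z) = x * Im z.
Proof. by rewrite ImM /= mul0r addr0. Qed.

End ComplexAlgebra.

Section ComplexMeasurable.
Context d {T : measurableType d} {R : realType}.
Implicit Types (f g : T -> R[i]).

Definition cmeas f :=
  measurable_fun setT (fun t => Re (f t)) /\
  measurable_fun setT (fun t => Im (f t)).

Lemma cmeasD f g : cmeas f -> cmeas g -> cmeas (fun t => f t + g t).
Proof.
move=> [? ?] [? ?]; split.
  by under eq_fun do rewrite ReD; exact: measurable_funD.
by under eq_fun do rewrite ImD; exact: measurable_funD.
Qed.

Lemma cmeasM f g : cmeas f -> cmeas g -> cmeas (fun t => f t * g t).
Proof.
move=> [? ?] [? ?]; split.
  under eq_fun do rewrite ReM.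
  by apply: measurable_funB; exact: measurable_funM.
under eq_fun do rewrite ImM.
by apply: measurable_funD; exact: measurable_funM.
Qed.

Lemma cmeasN f : cmeas f -> cmeas (fun t => - f t).
Proof.
move=> [? ?]; split.
  by under eq_fun do rewrite ReN; exact: measurableT_comp.
by under eq_fun do rewrite ImN; exact: measurableT_comp.
Qed.

Lemma cmeas_cst (c : R[i]) : cmeas (fun _ : T => c).
Proof. by split; exact: measurable_cst. Qed.

Lemma cmeasJ f : cmeas f -> cmeas (fun t => (f t)^*).
Proof.
move=> [? ?]; split; first by under eq_fun do rewrite ReJ.
by under eq_fun do rewrite ImJ; exact: measurableT_comp.
Qed.

Lemma cmeas_real (h : T -> R) : measurable_fun setT h -> cmeas (fun t => (h t)%:C).
Proof. by move=> mh; split => //; exact: measurable_cst. Qed.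

Lemma cmeas_sum I (r : seq I) (P : pred I) (F : I -> T -> R[i]) :
  (forall i, cmeas (F i)) -> cmeas (fun t => \sum_(i <- r | P i) F i t).
Proof.
move=> mF; elim: r => [|i r IH].
  by under eq_fun do rewrite big_nil; exact: cmeas_cst.
under eq_fun do rewrite big_cons; case: (P i) => //.
exact: cmeasD.
Qed.

Lemma cmeas_expi (h : T -> R) :
  measurable_fun setT h -> cmeas (fun t => expi (h t)).
Proof.
move=> mh; split => /=.
  have mc : measurable_fun setT (@cos R).
    by apply: continuous_measurable_fun; exact: continuous_cos.
  exact: (measurableT_comp mc mh).
have ms : measurable_fun setT (@sin R).
  by apply: continuous_measurable_fun; exact: continuous_sin.
exact: (measurableT_comp ms mh).
Qed.

Lemma measurable_cmod f : cmeas f -> measurable_fun setT (fun t => cmod (f t)).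
Proof.
move=> [mr mi]; under eq_fun do rewrite cmodE.
have ms : measurable_fun setT (@Num.sqrt R).
  by apply: continuous_measurable_fun; exact: sqrt_continuous.
apply: (measurableT_comp ms).
by apply: measurable_funD; exact: measurable_funX.
Qed.

End ComplexMeasurable.

Lemma cmeas_comp d (T : measurableType d) d' (T' : measurableType d')
    (R : realType) (h : T' -> T) (f : T -> R[i]) :
  measurable_fun setT h -> cmeas f -> cmeas (fun t => f (h t)).
Proof.
move=> mh [mr mi]; split.
  exact: (measurableT_comp mr mh).
exact: (measurableT_comp mi mh).
Qed.

Section ComplexIntegral.
Context {R : realType}.
Notation mu := (@lebesgue_measure R).
Notation Rint h := (mu.-integrable setT (EFin \o h)).
Implicit Types (f g h : R -> R[i]).

Definition cint f :=
  Rint (fun t => Re (f t)) /\ Rint (fun t => Im (f t)).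

Lemma RintD (u v : R -> R) : Rint u -> Rint v -> Rint (fun t => u t + v t).
Proof.
move=> iu iv; rewrite (_ : EFin \o _ = (EFin \o u) \+ (EFin \o v))%E//.
exact: integrableD.
Qed.

Lemma RintZ c (u : R -> R) : Rint u -> Rint (fun t => c * u t).
Proof. by move=> iu; apply: (integrableZl _ c iu). Qed.

Lemma RintN (u : R -> R) : Rint u -> Rint (fun t => - u t).
Proof.
by move=> /(RintZ (-1)); under [in X in X -> _]eq_fun do rewrite mulN1r.
Qed.

Lemma RintB (u v : R -> R) : Rint u -> Rint v -> Rint (fun t => u t - v t).
Proof. by move=> iu iv; apply: RintD => //; exact: RintN. Qed.

Lemma Rint_dom (u v : R -> R) : measurable_fun setT u -> Rint v ->
  (forall t, `|u t| <= v t) -> Rint u.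
Proof.
move=> mu_ iv uv; apply: (le_integrable _ _ _ iv) => //.
  exact/measurable_EFinP.
by move=> t _ /=; rewrite lee_fin (le_trans (uv t))// ler_norm.
Qed.

Lemma Rint_norm (u : R -> R) : Rint u -> Rint (fun t => `|u t|).
Proof. exact: integrable_norm. Qed.

Lemma Rint_meas (u : R -> R) : Rint u -> measurable_fun setT u.
Proof. by move=> /integrableP[/measurable_EFinP]. Qed.

Lemma cint_meas f : cint f -> cmeas f.
Proof. by move=> [/Rint_meas ? /Rint_meas ?]; split. Qed.

Lemma cint_dom f (v : R -> R) : cmeas f -> Rint v ->
  (forall t, cmod (f t) <= v t) -> cint f.
Proof.
move=> [mr mi] iv fv; split; apply: (Rint_dom _ iv) => // t.
  exact: le_trans (Re_le_cmod _) (fv t).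
exact: le_trans (Im_le_cmod _) (fv t).
Qed.

Lemma cint_cmod f : cint f -> Rint (fun t => cmod (f t)).
Proof.
move=> [ir ii].
apply: (@Rint_dom _ (fun t => `|Re (f t)| + `|Im (f t)|)).
- by apply: measurable_cmod; split; exact: Rint_meas.
- by apply: RintD; exact: Rint_norm.
- by move=> t; rewrite ger0_norm ?cmod_ge0// cmod_le.
Qed.

Lemma cintD f g : cint f -> cint g -> cint (fun t => f t + g t).
Proof.
move=> [? ?] [? ?]; split.
  by under eq_fun do rewrite ReD; exact: RintD.
by under eq_fun do rewrite ImD; exact: RintD.
Qed.

Lemma cintZ (c : R[i]) f : cint f -> cint (fun t => c * f t).
Proof.
move=> [? ?]; split.
  under [in X in Rint X]eq_fun do rewrite ReM.
  by apply: RintB; exact: RintZ.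
under [in X in Rint X]eq_fun do rewrite ImM.
by apply: RintD; exact: RintZ.
Qed.

Lemma cint0 : cint (fun=> 0).
Proof. by split; exact: integrable0. Qed.

Lemma cint_sum I (r : seq I) (P : pred I) (F : I -> R -> R[i]) :
  (forall i, cint (F i)) -> cint (fun t => \sum_(i <- r | P i) F i t).
Proof.
move=> mF; elim: r => [|i r IH].
  by under eq_fun do rewrite big_nil; exact: cint0.
under eq_fun do rewrite big_cons; case: (P i) => //.
exact: cintD.
Qed.

Lemma cintegralD f g : cint f -> cint g ->
  cintegral (fun t => f t + g t) = cintegral f + cintegral g.
Proof.
move=> [? ?] [? ?]; rewrite /cintegral.
under eq_Rintegral do rewrite ReD.
under [X in Complex _ X]eq_Rintegral do rewrite ImD.
by rewrite !RintegralD.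
Qed.

Lemma cintegralZ (c : R[i]) f : cint f ->
  cintegral (fun t => c * f t) = c * cintegral f.
Proof.
move=> [? ?]; rewrite /cintegral.
under eq_Rintegral do rewrite ReM.
under [X in Complex _ X]eq_Rintegral do rewrite ImM.
rewrite RintegralB ?RintegralD ?RintegralZl//; try exact: RintZ.
by apply: eq_ReIm; rewrite ?ReM ?ImM.
Qed.

Lemma cintegral0 : cintegral (fun=> 0 : R[i]) = 0.
Proof.
rewrite /cintegral /= !(@Rintegral_cst _ _ _ lebesgue_measure setT) //.
by rewrite !mul0r.
Qed.

Lemma cintegral_sum I (r : seq I) (P : pred I) (F : I -> R -> R[i]) :
  (forall i, cint (F i)) ->
  cintegral (fun t => \sum_(i <- r | P i) F i t) =
  \sum_(i <- r | P i) cintegral (F i).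
Proof.
move=> mF; elim: r => [|i r IH].
  rewrite big_nil; under eq_fun do rewrite big_nil; exact: cintegral0.
under eq_fun do rewrite big_cons.
rewrite big_cons; case: (P i) => //.
by rewrite cintegralD ?IH//; exact: cint_sum.
Qed.

Lemma cintegralJ f : cint f -> cintegral (fun t => (f t)^*) = (cintegral f)^*.
Proof.
move=> [ir ii]; rewrite /cintegral; apply: eq_ReIm; rewrite ?ReJ ?ImJ /=.
  by under eq_Rintegral do rewrite ReJ.
under eq_Rintegral do rewrite ImJ -mulN1r.
by rewrite RintegralZl// mulN1r.
Qed.

(** Estimating the two parts separately costs the factor 2, harmless in the limits and integrability
    arguments that use the bound. *)
Lemma cmod_cintegral_le f : cint f ->
  cmod (cintegral f) <= 2 * \int[mu]_t (cmod (f t)).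
Proof.
move=> cf; have [ir ii] := cf; have im := cint_cmod cf.
apply: (le_trans (cmod_le _)); rewrite mulr_natl mulr2n /cintegral /=.
by apply: lerD; apply: (le_trans (le_normr_Rintegral _ _)) => //;
  apply: le_Rintegral => //; try exact: Rint_norm; move=> t _;
  [exact: Re_le_cmod | exact: Im_le_cmod].
Qed.

End ComplexIntegral.

(** * Inner product and norm of square-integrable functions *)

Section L2theory.
Context {R : realType}.
Notation mu := (@lebesgue_measure R).
Notation Rint h := (mu.-integrable setT (EFin \o h)).
Implicit Types (f g h : R -> R[i]).

(** The squared norm as a real number. An infinite integral is read as 0, so the value is meaningful
    for [L2] functions only. *)
Definition nrm2 f : R := \int[mu]_t (cmod (f t) ^+ 2).

Lemma L2norm_sqrte f :
  L2norm f = sqrte (\int[mu]_t (cmod (f t) ^+ 2)%:E)%E.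
Proof.
rewrite /L2norm unlock /= -poweR12_sqrt; last first.
  by apply: integral_ge0 => t _; rewrite lee_fin sqr_ge0.
congr (poweR _ _); apply: eq_integral => t _ /=.
by rewrite ger0_norm ?cmod_ge0// powR_mulrn ?cmod_ge0.
Qed.

Lemma L2norm_sqr f : (L2norm f ^+ 2 = \int[mu]_t (cmod (f t) ^+ 2)%:E)%E.
Proof.
rewrite L2norm_sqrte sqr_sqrte//.
by apply: integral_ge0 => t _; rewrite lee_fin sqr_ge0.
Qed.

Lemma L2P f : L2 f <-> cmeas f /\ Rint (fun t => cmod (f t) ^+ 2).
Proof.
have eq_abs : (\int[mu]_t `|(cmod (f t) ^+ 2)%:E| =
    \int[mu]_t (cmod (f t) ^+ 2)%:E)%E.
  by apply: eq_integral => t _; rewrite /= ger0_norm// sqr_ge0.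
have I0 : (0 <= \int[mu]_t (cmod (f t) ^+ 2)%:E)%E.
  by apply: integral_ge0 => t _; rewrite lee_fin sqr_ge0.
split=> [[mr mi fi]|[[mr mi] /integrableP[_ fi]]].
  split => //; apply/integrableP; split.
    by apply/measurable_EFinP/measurable_funX/measurable_cmod.
  move: fi; rewrite L2norm_sqrte /= eq_abs.
  by case: (\int[mu]_t _)%E I0 => [r|//|//] _ _; exact: ltry.
split => //; move: fi; rewrite L2norm_sqrte /= eq_abs.
by case: (\int[mu]_t _)%E I0 => [r|//|//] _ _; exact: ltry.
Qed.

Lemma L2_meas f : L2 f -> cmeas f.
Proof. by move=> /L2P[]. Qed.

Lemma L2_int f : L2 f -> Rint (fun t => cmod (f t) ^+ 2).
Proof. by move=> /L2P[]. Qed.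

Lemma L2norm_nrm2 f : L2 f -> L2norm f = (Num.sqrt (nrm2 f))%:E.
Proof.
move=> /L2_int fi; rewrite L2norm_sqrte /nrm2 /Rintegral.
by rewrite -[X in sqrte X]fineK//; exact: integrable_fin_num.
Qed.

Lemma nrm2E f : L2 f -> (L2norm f ^+ 2)%E = (nrm2 f)%:E.
Proof.
move=> /L2_int fi; rewrite L2norm_sqr /nrm2 /Rintegral fineK//.
exact: integrable_fin_num.
Qed.

Lemma nrm2_ge0 f : 0 <= nrm2 f.
Proof. by apply: Rintegral_ge0 => t _; rewrite sqr_ge0. Qed.

Lemma L2D f g : L2 f -> L2 g -> L2 (fun t => f t + g t).
Proof.
move=> /L2P[mf fi] /L2P[mg gi]; apply/L2P; split; first exact: cmeasD.
apply: (Rint_dom _ (RintZ 2 (RintD fi gi))).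
  by apply/measurable_funX/measurable_cmod/cmeasD.
by move=> t; rewrite ger0_norm ?sqr_ge0// cmod_sqrD.
Qed.

Lemma L2Z (c : R[i]) f : L2 f -> L2 (fun t => c * f t).
Proof.
move=> /L2P[mf fi]; apply/L2P; split.
  by apply: cmeasM => //; exact: cmeas_cst.
under [in X in Rint X]eq_fun do rewrite cmodM exprMn.
exact: RintZ.
Qed.

Lemma L2N f : L2 f -> L2 (fun t => - f t).
Proof.
by move=> /(L2Z (-1)); under [in X in X -> _]eq_fun do rewrite mulN1r.
Qed.

Lemma L2B f g : L2 f -> L2 g -> L2 (fun t => f t - g t).
Proof. by move=> fi gi; apply: L2D => //; exact: L2N. Qed.

Lemma L20 : L2 (fun _ : R => 0 : R[i]).
Proof.
apply/L2P; split; first exact: cmeas_cst.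
under [in X in Rint X]eq_fun do rewrite cmod0 expr0n.
exact: integrable0.
Qed.

Lemma L2_sum I (r : seq I) (P : pred I) (F : I -> R -> R[i]) :
  (forall i, L2 (F i)) -> L2 (fun t => \sum_(i <- r | P i) F i t).
Proof.
move=> mF; elim: r => [|i r IH].
  by under eq_fun do rewrite big_nil; exact: L20.
under eq_fun do rewrite big_cons; case: (P i) => //.
exact: L2D.
Qed.

Lemma L2J f : L2 f -> L2 (fun t => (f t)^*).
Proof.
move=> /L2P[mf fi]; apply/L2P; split; first exact: cmeasJ.
by under [in X in Rint X]eq_fun do rewrite cmodJ.
Qed.

Lemma cint_L2M f h : L2 f -> L2 h -> cint (fun t => f t * h t).
Proof.
move=> /L2P[mf fi] /L2P[mh hi].
apply: (cint_dom _ (RintD fi hi)); first exact: cmeasM.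
move=> t; rewrite cmodM.
have := sqr_ge0 (cmod (f t) - cmod (h t)); rewrite sqrrB.
have := mulr_ge0 (cmod_ge0 (f t)) (cmod_ge0 (h t)); lra.
Qed.

Lemma cint_inner f h : L2 f -> L2 h -> cint (fun t => f t * (h t)^*).
Proof. by move=> fi hi; apply: cint_L2M => //; exact: L2J. Qed.

Lemma innerDl f g h : L2 f -> L2 g -> L2 h ->
  inner (fun t => f t + g t) h = inner f h + inner g h.
Proof.
move=> fi gi hi; rewrite /inner -cintegralD; try exact: cint_inner.
by under eq_fun do rewrite mulrDl.
Qed.

Lemma innerZl (c : R[i]) f h : L2 f -> L2 h ->
  inner (fun t => c * f t) h = c * inner f h.
Proof.
move=> fi hi; rewrite /inner -cintegralZ; last exact: cint_inner.
by under eq_fun do rewrite -mulrA.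
Qed.

Lemma innerC f h : L2 f -> L2 h -> inner h f = (inner f h)^*.
Proof.
move=> fi hi; rewrite /inner -cintegralJ; last exact: cint_inner.
by congr cintegral; apply: funext => t; rewrite cjM mulrC; congr (_ * _); exact: (esym (conjCK _)).
Qed.

Lemma innerBl f g h : L2 f -> L2 g -> L2 h ->
  inner (fun t => f t - g t) h = inner f h - inner g h.
Proof.
move=> fi gi hi; rewrite innerDl//; last exact: L2N.
have -> : (fun t => - g t) = (fun t => (-1) * g t).
  by apply/funext => t; rewrite mulN1r.
by rewrite innerZl// mulN1r.
Qed.

Lemma innerBr f g h : L2 f -> L2 g -> L2 h ->
  inner h (fun t => f t - g t) = inner h f - inner h g.
Proof.
move=> fi gi hi; rewrite innerC ?innerBl//; last exact: L2B.
by rewrite cjD cjN -!innerC.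
Qed.

Lemma innerZr (c : R[i]) f h : L2 f -> L2 h ->
  inner h (fun t => c * f t) = c^* * inner h f.
Proof.
move=> fi hi; rewrite innerC ?innerZl//; last exact: L2Z.
by rewrite cjM -innerC.
Qed.

Lemma inner_suml I (r : seq I) (P : pred I) (F : I -> R -> R[i]) h :
  (forall i, L2 (F i)) -> L2 h ->
  inner (fun t => \sum_(i <- r | P i) F i t) h =
  \sum_(i <- r | P i) inner (F i) h.
Proof.
move=> Fi hi; rewrite /inner -cintegral_sum; last first.
  by move=> i; exact: cint_inner.
by under eq_fun do rewrite mulr_suml.
Qed.

Lemma inner_sumr I (r : seq I) (P : pred I) (F : I -> R -> R[i]) h :
  (forall i, L2 (F i)) -> L2 h ->
  inner h (fun t => \sum_(i <- r | P i) F i t) =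
  \sum_(i <- r | P i) inner h (F i).
Proof.
move=> Fi hi; rewrite innerC// ?inner_suml//; last exact: L2_sum.
rewrite rmorph_sum; apply: eq_bigr => i _.
by rewrite [RHS]innerC.
Qed.

Lemma inner_nrm2 f : L2 f -> inner f f = (nrm2 f)%:C.
Proof.
move=> fi; rewrite /inner /cintegral /nrm2; apply: eq_ReIm => /=.
  by apply: eq_Rintegral => t _; rewrite mulJ_cmod.
under eq_Rintegral do rewrite mulJ_cmod /=.
by rewrite (@Rintegral_cst _ _ _ lebesgue_measure setT)// mul0r.
Qed.

Lemma Cauchy_Schwarz f h : L2 f -> L2 h ->
  \int[mu]_t (cmod (f t) * cmod (h t)) <=
  Num.sqrt (nrm2 f) * Num.sqrt (nrm2 h).
Proof.
move=> fi hi; have mf := L2_meas fi; have mh := L2_meas hi.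
have i12 : Rint (fun t => cmod (f t) * cmod (h t)).
  by have := cint_cmod (cint_L2M fi hi);
    under [in X in X -> _]eq_fun do rewrite cmodM.
rewrite -lee_fin EFinM -!L2norm_nrm2// /Rintegral fineK; last first.
  exact: integrable_fin_num.
have h2 : (2^-1 + 2^-1 = 1 :> R) by lra.
have := @hoelder _ _ _ mu (fun t => cmod (f t)) (fun t => cmod (h t)) 2 2
  (measurable_cmod mf) (measurable_cmod mh) (ltr0Sn _ _) (ltr0Sn _ _) h2.
rewrite Lnorm1 /=; apply: le_trans.
rewrite le_eqVlt; apply/orP; left; apply/eqP; apply: eq_integral => t _ /=.
by rewrite ger0_norm// mulr_ge0 ?cmod_ge0.
Qed.

Lemma cmod_inner_le f h : L2 f -> L2 h ->
  cmod (inner f h) <= 2 * (Num.sqrt (nrm2 f) * Num.sqrt (nrm2 h)).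
Proof.
move=> fi hi; apply: (le_trans (cmod_cintegral_le (cint_inner fi hi))).
rewrite ler_pM2l//; apply: le_trans (Cauchy_Schwarz fi hi).
by rewrite le_eqVlt; apply/orP; left; apply/eqP; apply: eq_Rintegral => t _;
  rewrite cmodM cmodJ.
Qed.

End L2theory.

(** * Gaussian integrals *)

Section GaussianIntegrals.
Context {R : realType}.
Notation mu := (@lebesgue_measure R).
Notation Rint h := (mu.-integrable setT (EFin \o h)).
Implicit Types (a b c : R).

Lemma RintegralN (u : R -> R) :
  Rint u -> \int[mu]_t (- u t) = - \int[mu]_t u t.
Proof.
move=> iu; under eq_Rintegral do rewrite -mulN1r.
by rewrite RintegralZl// mulN1r.
Qed.

Lemma ae_imp (P Q : R -> Prop) : {ae mu, forall t, P t} ->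
  (forall t, P t -> Q t) -> {ae mu, forall t, Q t}.
Proof. by move=> HP PQ; exact: (@filterS _ _ (ae_filter_ringOfSetsType mu) _ _ PQ HP). Qed.

Lemma Rint_dominated_convergence (u_ : (R -> R)^nat) (u v : R -> R) :
  (forall n, measurable_fun setT (u_ n)) -> measurable_fun setT u ->
  {ae mu, forall t, u_ ^~ t @ \oo --> u t} -> Rint v ->
  (forall n t, `|u_ n t| <= v t) ->
  Rint u /\ (\int[mu]_t u_ n t) @[n --> \oo] --> \int[mu]_t u t.
Proof.
move=> mu_ mu1 cu iv uv.
have [] := @dominated_convergence _ _ _ mu setT measurableT
  (fun n => EFin \o u_ n) (EFin \o u) (EFin \o v).
- by move=> n; apply/measurable_EFinP; exact: mu_.
- exact/measurable_EFinP.
- apply: (ae_imp cu) => t {}cu _.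
  by apply/fine_cvgP; split; [exact: nearW | exact: cu].
- by [].
- by apply: aeW => t n _; rewrite lee_fin.
move=> iu _ cvi; split => //.
apply: fine_cvg; rewrite fineK //; exact: integrable_fin_num.
Qed.

(** The normal density of variance [1 / (2 a)], from which integrability and total mass are
    inherited. *)
Lemma gauss_normal a : 0 < a -> (fun t => expR (- a * t ^+ 2)) =
  (fun t => Num.sqrt (pi / a) * normal_pdf 0 (Num.sqrt (2 * a))^-1 t).
Proof.
move=> a0; set s := (Num.sqrt (2 * a))^-1; have a20 : 0 < 2 * a by lra.
have s0 : s != 0 by rewrite invr_neq0// gt_eqF// sqrtr_gt0.
have s2 : s ^+ 2 = (2 * a)^-1 by rewrite exprVn sqr_sqrtr ?(ltW a20).
have an0 : a != 0 by rewrite gt_eqF.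
apply/funext => t; rewrite normal_pdfE// /normal_peak /normal_fun s2.
have -> : (2 * a)^-1 * pi *+ 2 = pi / a by rewrite -mulr_natr; field.
have -> : - (t - 0) ^+ 2 / ((2 * a)^-1 *+ 2) = - a * t ^+ 2.
  by rewrite -mulr_natr; field.
by rewrite mulVKf// gt_eqF// sqrtr_gt0 divr_gt0// pi_gt0.
Qed.

Lemma Rint_gauss a : 0 < a -> Rint (fun t => expR (- a * t ^+ 2)).
Proof.
move=> a0; rewrite gauss_normal//; apply: RintZ.
exact: integrable_normal_pdf.
Qed.

Lemma Rintegral_gauss a : 0 < a ->
  \int[mu]_t expR (- a * t ^+ 2) = Num.sqrt (pi / a).
Proof.
move=> a0; rewrite gauss_normal// RintegralZl//; last first.
  exact: integrable_normal_pdf.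
by rewrite /Rintegral integral_normal_pdf mulr1.
Qed.

Lemma measurable_gauss a : measurable_fun setT (fun t : R => expR (- a * t ^+ 2)).
Proof.
apply: measurableT_comp => //.
by apply: measurable_funM => //; exact: measurable_funX.
Qed.

(** Half of the Gaussian absorbs the exponential: completing the square gives [c |t| - a t^2 <= c^2
    / (2 a) - (a / 2) t^2]. *)
Lemma Rint_exp_gauss a c : 0 < a ->
  Rint (fun t => expR (c * `|t|) * expR (- a * t ^+ 2)).
Proof.
move=> a0; have a20 : 0 < a / 2 by lra.
apply: (Rint_dom _ (RintZ (expR (c ^+ 2 / (2 * a))) (Rint_gauss a20))).
  apply: measurable_funM; last exact: measurable_gauss.
  by apply: measurableT_comp => //; apply: measurable_funM => //;
    exact: measurableT_comp.
move=> t; rewrite ger0_norm ?mulr_ge0 ?expR_ge0// -!expRD ler_expR.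
have t2 : t ^+ 2 = `|t| ^+ 2 by rewrite real_normK ?num_real.
rewrite -subr_ge0 t2.
have -> : c ^+ 2 / (2 * a) + - (a / 2) * `|t| ^+ 2 -
    (c * `|t| + - a * `|t| ^+ 2) = (c - a * `|t|) ^+ 2 / (2 * a).
  by field; rewrite gt_eqF.
by rewrite divr_ge0 ?sqr_ge0//; lra.
Qed.

Lemma normX_le_exp n (t : R) : `|t ^+ n| <= n`!%:R * expR `|t|.
Proof.
rewrite normrX; case: n => [|n]; first by rewrite expr0 mul1r -expR0 ler_expR.
rewrite mulrC -ler_pdivrMr; last by rewrite ltr0n fact_gt0.
apply: le_trans (expR_ge1Dxn n (normr_ge0 t)).
by rewrite lerDr.
Qed.

Lemma Rint_mono_gauss a n : 0 < a ->
  Rint (fun t => t ^+ n * expR (- a * t ^+ 2)).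
Proof.
move=> a0; apply: (Rint_dom _ (RintZ n`!%:R (Rint_exp_gauss 1 a0))).
  by apply: measurable_funM; [exact: measurable_funX | exact: measurable_gauss].
move=> t; rewrite normrM [`|expR _|]ger0_norm ?expR_ge0// mulrA.
by rewrite ler_wpM2r ?expR_ge0// mul1r normX_le_exp.
Qed.

(** Again a completed square. It provides the decay of boundary terms that [Rintegral_derivative0]
    asks for. *)
Lemma exp_gauss_le a (t : R) : 0 < a ->
  expR `|t| * expR (- a * t ^+ 2) <= expR a^-1 * expR (- `|t|).
Proof.
move=> a0; have t2 : t ^+ 2 = `|t| ^+ 2 by rewrite real_normK ?num_real.
rewrite -!expRD ler_expR -subr_ge0 t2.
have -> : a^-1 + - `|t| - (`|t| + - a * `|t| ^+ 2) = (1 - a * `|t|) ^+ 2 / a.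
  by field; rewrite gt_eqF.
by rewrite divr_ge0 ?sqr_ge0//; lra.
Qed.

Lemma expRNn_cvg0 : (expR (- n%:R) : R) @[n --> \oo] --> (0 : R).
Proof.
apply: (@squeeze_cvgr _ _ _ _ (fun=> 0) harmonic) => //.
- apply: nearW => n; rewrite expR_ge0 /= expRN lef_pV2 ?posrE ?expR_gt0//.
  by rewrite -natr1 addrC expR_ge1Dx.
- exact: cvg_cst.
- exact: cvg_harmonic.
Qed.

(** The fundamental theorem on [[-(n+1), n+1]] leaves boundary terms that vanish exponentially, and
    domination by [|f|] passes to the whole line. Integration by parts for Gaussian moments rests on
    this. *)
Lemma Rintegral_derivative0 (F f : R -> R) C :
  (forall t, is_derive t (1 : R) F (f t)) -> continuous f -> Rint f ->
  (forall t, `|F t| <= C * expR (- `|t|)) -> \int[mu]_t f t = 0.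
Proof.
move=> dF cf intf FC.
pose I n : set R := `[- n.+1%:R, n.+1%:R]%classic.
have cF : continuous F.
  by move=> t; apply: differentiable_continuous; apply/derivable1_diffP.
have FTC n : \int[mu]_t (f \_ (I n)) t = F n.+1%:R - F (- n.+1%:R).
  have lt0 : - n.+1%:R < n.+1%:R :> R by rewrite gtrN// ltr0n.
  rewrite -Rintegral_mkcond /Rintegral (@continuous_FTC2 _ f F)//.
  - exact: continuous_subspaceT.
  - split.
    + by move=> t _; exact: ex_derive.
    + by apply: cvg_at_right_filter; exact: cF.
    + by apply: cvg_at_left_filter; exact: cF.
  - by move=> t _; rewrite derive1E; exact: derive_val.
have [|||||_ cv] := @Rint_dominated_convergence (fun n => f \_ (I n)) f
    (fun t => `|f t|).
- move=> n; apply/(measurable_restrictT _ _).1 .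
    exact: measurable_itv.
  by apply: measurable_funTS; exact: Rint_meas.
- exact: Rint_meas.
- apply: aeW => t; apply: cvg_near_cst; near=> n.
  rewrite patchE mem_set// /I /= in_itv /= -ler_norml.
  near: n; exists (Num.truncn `|t|) => // n /= tn.
  by rewrite (le_trans (ltW (truncnS_gt _)))// ler_nat.
- exact: Rint_norm.
- by move=> n t; rewrite patchE; case: ifP => // _; rewrite normr0.
have cF0 : (F n.+1%:R - F (- n.+1%:R)) @[n --> \oo] --> (0 : R).
  have e0 : (C * 2 * expR (- n.+1%:R)) @[n --> \oo] --> (0 : R).
    rewrite -[X in _ --> X](mulr0 (C * 2)); apply: cvgMr.
    by rewrite (cvg_shiftS (fun n => expR (- n%:R) : R)); exact: expRNn_cvg0.
  apply: norm_cvg0; apply: (squeeze_cvgr _ (cvg_cst 0) e0).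
  apply: nearW => n; rewrite normr_ge0 /= (le_trans (ler_normB _ _))//.
  rewrite -mulrA mulrCA mulr_natl mulr2n lerD// (le_trans (FC _))//.
    by rewrite ger0_norm.
  by rewrite normrN ger0_norm.
have e : (fun n => \int[mu]_t (f \_ (I n)) t) =
    (fun n => F n.+1%:R - F (- n.+1%:R)) by apply/funext => n; exact: FTC.
by rewrite e in cv; exact: (cvg_unique _ cv cF0).
Unshelve. all: by end_near. Qed.

End GaussianIntegrals.

(** * Moments of modulated Gaussians *)

Section GaussianMoments.
Context {R : realType}.
Notation mu := (@lebesgue_measure R).
Notation Rint h := (mu.-integrable setT (EFin \o h)).
Implicit Types (a b c : R).

(** The phase [c] lets one family carry both parts of a complex moment: the sine version is the
    cosine version with phase [c - pi / 2]. *)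
Definition gcos a b c n (t : R) : R :=
  t ^+ n * expR (- a * t ^+ 2) * cos (b * t + c).

Definition gsin a b c n (t : R) : R :=
  t ^+ n * expR (- a * t ^+ 2) * sin (b * t + c).

Lemma is_derive_gauss a (t : R) : is_derive t (1 : R)
  (fun t : R => expR (- a * t ^+ 2)) (expR (- a * t ^+ 2) * (- a * (2 * t))).
Proof.
have h1 : is_derive t (1 : R) (fun t : R => - a * t ^+ 2) (- a * (2 * t)).
  apply: is_derive_eq; rewrite /GRing.scale /=; ring.
have := @is_derive1_comp _ expR (fun t : R => - a * t ^+ 2) t _ _ _ h1.
exact.
Qed.

Lemma is_derive_affine b c (t : R) : is_derive t (1 : R)
  (fun t : R => b * t + c) b.
Proof. by apply: is_derive_eq; rewrite /GRing.scale /=; ring. Qed.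

Lemma is_derive_gcos a b c n (t : R) : is_derive t (1 : R) (gcos a b c n)
  (n%:R * gcos a b c n.-1 t - 2 * a * gcos a b c n.+1 t - b * gsin a b c n t).
Proof.
have h1 := is_derive_gauss a t.
have h2 : is_derive t (1 : R) (fun t : R => cos (b * t + c))
    (- sin (b * t + c) * b).
  exact: (@is_derive1_comp _ cos _ t _ _ _ (is_derive_affine b c t)).
have h3 : is_derive t (1 : R) (fun t : R => t ^+ n) (n%:R * t ^+ n.-1).
  rewrite (_ : (fun t => t ^+ n) = (id : R -> R) ^+ n); last first.
    by apply/funext => x; rewrite exprfctE.
  apply: is_derive_eq (is_deriveX n (is_derive_id t (1 : R))) _.
  by rewrite /GRing.scale /= mulr1.
have D := is_deriveM (is_deriveM h3 h1) h2.
have {}D : is_derive t (1 : R) (gcos a b c n) _ := D.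
apply: (is_derive_eq D); rewrite /GRing.scale /= /gcos /gsin fctE (exprS t n); ring.
Qed.

Lemma gcos_le a b c n t : `|gcos a b c n t| <= `|t ^+ n * expR (- a * t ^+ 2)|.
Proof.
rewrite normrM ler_piMr// ler_norml.
by rewrite cos_geN1 cos_le1.
Qed.

Lemma gsin_le a b c n t : `|gsin a b c n t| <= `|t ^+ n * expR (- a * t ^+ 2)|.
Proof.
rewrite normrM ler_piMr// ler_norml.
by rewrite sin_geN1 sin_le1.
Qed.

Lemma continuous_gcos a b c n : continuous (gcos a b c n).
Proof.
move=> t; apply: differentiable_continuous; apply/derivable1_diffP.
by have D := is_derive_gcos a b c n t; exact: ex_derive.
Qed.

Lemma gsinE a b c n : gsin a b c n = gcos a b (c - pi / 2) n.
Proof. by apply/funext => t; rewrite /gcos addrA cosBpihalf. Qed.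

Lemma continuous_gsin a b c n : continuous (gsin a b c n).
Proof. by rewrite gsinE; exact: continuous_gcos. Qed.

Lemma Rint_gcos a b c n : 0 < a -> Rint (gcos a b c n).
Proof.
move=> a0; apply: (Rint_dom _ (Rint_norm (Rint_mono_gauss n a0))).
  by apply: continuous_measurable_fun; exact: continuous_gcos.
by move=> t; exact: gcos_le.
Qed.

Lemma Rint_gsin a b c n : 0 < a -> Rint (gsin a b c n).
Proof. by rewrite gsinE; exact: Rint_gcos. Qed.

(** The integrand is the derivative of [gcos a b c n]. At [n = 0] the truncated index [n.-1] comes
    with the coefficient 0. *)
Lemma gcos_ibp a b c n : 0 < a ->
  n%:R * \int[mu]_t gcos a b c n.-1 t - 2 * a * \int[mu]_t gcos a b c n.+1 t
    - b * \int[mu]_t gsin a b c n t = 0.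
Proof.
move=> a0.
rewrite -!RintegralZl//; try exact: Rint_gcos; last exact: Rint_gsin.
rewrite -!RintegralB//; try by [do ?apply: RintB; apply: RintZ;
  (exact: Rint_gcos || exact: Rint_gsin)].
apply: (@Rintegral_derivative0 _ (gcos a b c n) _ (n`!%:R * expR a^-1)).
- by move=> t; exact: is_derive_gcos.
- move=> t; apply: cvgB; first apply: cvgB; apply: cvgMr;
  (exact: continuous_gcos || exact: continuous_gsin).
- by do ?apply: RintB; apply: RintZ; (exact: Rint_gcos || exact: Rint_gsin).
- move=> t; apply: (le_trans (gcos_le _ _ _ _ _)).
  rewrite normrM [`|expR _|]ger0_norm ?expR_ge0// -mulrA.
  apply: le_trans (ler_wpM2l _ (exp_gauss_le t a0)); last exact: ler0n.
by rewrite [leRHS]mulrA ler_wpM2r ?expR_ge0// normX_le_exp.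
Qed.

Lemma gsin_shift a b c n :
  gsin a b (c - pi / 2) n = (fun t => - gcos a b c n t).
Proof.
by apply/funext => t; rewrite /gsin /gcos addrA sinBpihalf mulrN.
Qed.

(** Differentiation under the integral, dominated by [|t| e^{-a t^2}] uniformly in [b], produces a
    sine moment of order 1; integration by parts brings it back to the original integral. The
    outcome is a first-order differential equation in [b]. *)
Lemma is_derive_Rintegral_gcos a b c : 0 < a ->
  is_derive b (1 : R) (fun b => \int[mu]_t gcos a b c 0 t)
    (- (b / (2 * a)) * \int[mu]_t gcos a b c 0 t).
Proof.
move=> a0.
have dF x (t : R) : is_derive x (1 : R) (fun b => gcos a b c 0 t) (- gsin a x c 1 t).
  have h : is_derive x (1 : R) (fun b : R => b * t + c) t.
    by apply: is_derive_eq; rewrite /GRing.scale /=; ring.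
  have h2 : is_derive x (1 : R) (fun b : R => cos (b * t + c))
      (- sin (x * t + c) * t).
    exact: (@is_derive1_comp _ cos _ x _ _ _ h).
  have D := is_deriveM (is_derive_cst (t ^+ 0 * expR (- a * t ^+ 2)) x (1 : R)) h2.
  have {}D : is_derive x (1 : R) (fun b => gcos a b c 0 t) _ := D.
  apply: (is_derive_eq D); rewrite /GRing.scale /= /gsin expr0 expr1; ring.
have b_in : [set` `]b - 1, b + 1[] b by rewrite /= in_itv /=; lra.
have intf x : [set` `]b - 1, b + 1[] x -> Rint (gcos a x c 0).
  by move=> _; exact: Rint_gcos.
have derf x t : [set` `]b - 1, b + 1[] x -> setT t ->
    derivable (fun b => gcos a b c 0 t) x 1.
  by move=> _ _; have D := dF x t; exact: ex_derive.
have G0 (t : R) : 0 <= `|t ^+ 1 * expR (- a * t ^+ 2)| by exact: normr_ge0.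
have iG := Rint_norm (Rint_mono_gauss 1 a0).
have d1E x t : partial1of2 (fun b => gcos a b c 0) x t = - gsin a x c 1 t.
  by rewrite partial1of2E; have D := dF x t; exact: derive_val.
have Gub x t : [set` `]b - 1, b + 1[] x -> setT t ->
    `|partial1of2 (fun b => gcos a b c 0) x t| <= `|t ^+ 1 * expR (- a * t ^+ 2)|.
  by move=> _ _; rewrite d1E normrN; exact: gsin_le.
have db := derivable_under_integral measurableT b_in intf derf G0 iG Gub.
have vb := differentiation_under_integral measurableT b_in intf derf G0 iG Gub.
apply: DeriveDef => //.
rewrite -derive1E vb.
under eq_Rintegral do rewrite d1E -mulN1r.
rewrite RintegralZl//; last exact: Rint_gsin.
(* The quarter-period shift turns cosine into sine and sine into minus cosine, so order 0 links the
   sine moment of order 1 to the cosine moment of order 0. *)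
have := gcos_ibp b (c - pi / 2) 0 a0.
rewrite mul0r sub0r -gsinE gsin_shift.
under [X in - _ - b * X]eq_Rintegral do rewrite -mulN1r.
rewrite RintegralZl//; last exact: Rint_gcos.
have an0 : a != 0 by rewrite gt_eqF.
set X := Rintegral _ _ _; set Y := Rintegral _ _ _ => h.
have {}h : b * Y = 2 * a * X by lra.
have -> : - (b / (2 * a)) * Y = - (b * Y) / (2 * a) by field.
by rewrite h; field.
Qed.

(** Solves the differential equation in [b]: with the integrating factor [e^{b^2 / (4 a)}] the
    integral is constant, and at [b = 0] it is the plain Gaussian integral times [cos c]. *)
Lemma Rintegral_gcos0 a b c : 0 < a ->
  \int[mu]_t gcos a b c 0 t =
  cos c * Num.sqrt (pi / a) * expR (- (b ^+ 2 / (4 * a))).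
Proof.
move=> a0; have an0 : a != 0 by rewrite gt_eqF.
pose F b := (\int[mu]_t gcos a b c 0 t) * expR (b ^+ 2 / (4 * a)).
have dF x : is_derive x (1 : R) F 0.
  have h1 := is_derive_Rintegral_gcos x c a0.
  have h2 : is_derive x (1 : R) (fun x : R => x ^+ 2 / (4 * a)) (x / (2 * a)).
    by apply: is_derive_eq; rewrite /GRing.scale /=; field.
  have h3 : is_derive x (1 : R) (fun x : R => expR (x ^+ 2 / (4 * a)))
      (expR (x ^+ 2 / (4 * a)) * (x / (2 * a))).
    exact: (@is_derive1_comp _ expR _ x _ _ _ h2).
  have D := is_deriveM h1 h3.
  have {}D : is_derive x (1 : R) F _ := D.
  by apply: (is_derive_eq D); rewrite /GRing.scale /=; field.
have : F b = F 0 by exact: is_derive_0_is_cst.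
rewrite /F expr0n mul0r expR0 mulr1.
have -> : \int[mu]_t gcos a 0 c 0 t = cos c * Num.sqrt (pi / a).
  rewrite -Rintegral_gauss// -RintegralZl//; last exact: Rint_gauss.
  by apply: eq_Rintegral => t _; rewrite /gcos mul0r add0r expr0 mul1r mulrC.
by move=> <-; rewrite expRN mulfK// gt_eqF// expR_gt0.
Qed.

Definition gmoment a (xi : R) n : R[i] := cintegral (fun t =>
  (t ^+ n * expR (- a * t ^+ 2))%:C * expi (- 2 * pi * xi * t)).

Lemma gmomentE a xi n : gmoment a xi n =
  Complex (\int[mu]_t gcos a (- 2 * pi * xi) 0 n t)
          (\int[mu]_t gsin a (- 2 * pi * xi) 0 n t).
Proof.
rewrite /gmoment /cintegral; congr Complex; apply: eq_Rintegral => t _.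
  by rewrite ReZ /= /gcos addr0.
by rewrite ImZ /= /gsin addr0.
Qed.

Lemma cint_gmoment a xi n : 0 < a -> cint (fun t =>
  (t ^+ n * expR (- a * t ^+ 2))%:C * expi (- 2 * pi * xi * t)).
Proof.
move=> a0; apply: (cint_dom _ (Rint_norm (Rint_mono_gauss n a0))).
  apply: cmeasM; first by apply: cmeas_real; apply: Rint_meas; exact: Rint_mono_gauss.
  by apply: cmeas_expi; exact: measurable_funM.
by move=> t; rewrite cmodM cmod_expi mulr1 cmod_real.
Qed.

(** Real and imaginary parts are the instances of [gcos_ibp] with phases [0] and [- pi / 2]. *)
Lemma gmoment_rec a xi n : 0 < a ->
  (2 * a)%:C * gmoment a xi n.+1 =
  n%:R * gmoment a xi n.-1 - Complex 0 (2 * pi * xi) * gmoment a xi n.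
Proof.
move=> a0; have h1 := gcos_ibp (- 2 * pi * xi) 0 n a0.
have := gcos_ibp (- 2 * pi * xi) (0 - pi / 2) n a0.
rewrite -!gsinE gsin_shift.
rewrite RintegralN; last exact: Rint_gcos.
move=> h2; have -> : n%:R = (n%:R : R)%:C :> R[i] by rewrite rmorph_nat.
rewrite !gmomentE; apply: eq_ReIm; rewrite ?ReD ?ImD ?ReN ?ImN ?ReM ?ImM /=; lra.
Qed.

Lemma gmoment0 a xi : 0 < a ->
  gmoment a xi 0 = (Num.sqrt (pi / a) * expR (- (pi ^+ 2 * xi ^+ 2 / a)))%:C.
Proof.
move=> a0; rewrite gmomentE gsinE !Rintegral_gcos0//.
rewrite cos0 sub0r cosN cos_pihalf !mul0r mul1r; congr (Complex (_ * expR (- _)) _).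
by field; rewrite gt_eqF.
Qed.

End GaussianMoments.

(** * Hermite polynomials and Hermite functions *)

Section HermitePolynomials.

(* Normalized by [(e^{-ct^2/2})^(n) = hpoly c n e^{-ct^2/2}]. *)
Fixpoint hpoly (K : comNzRingType) (c : K) (n : nat) : {poly K} :=
  if n is m.+1 then (hpoly c m)^`() - c *: ('X * hpoly c m) else 1.

Lemma hpolyS (K : comNzRingType) (c : K) n :
  hpoly c n.+1 = (hpoly c n)^`() - c *: ('X * hpoly c n).
Proof. by []. Qed.

(** Up to scaling, an Appell sequence. Differentiating the recursion and inserting the induction
    hypothesis leaves a derivative one index lower, which the recursion itself eliminates. *)
Lemma deriv_hpoly (K : comNzRingType) (c : K) n :
  (hpoly c n)^`() = - (c * n%:R) *: hpoly c n.-1.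
Proof.
elim: n => [|n IH]; first by rewrite /= derivC mulr0 oppr0 scale0r.
have e : (c * n%:R) *: (hpoly c n.-1)^`() =
    (c * n%:R * c) *: ('X * hpoly c n.-1) + (c * n%:R) *: hpoly c n.
  case: n {IH} => [|n]; first by rewrite mulr0 mul0r !scale0r addr0.
  by rewrite /= scalerBr scalerA addrC subrK.
rewrite hpolyS derivB derivZ derivM derivX mul1r IH /= derivZ scaleNr e.
rewrite -!mul_polyC !(rmorphM, rmorphN, rmorph1, rmorph_nat) /= -natr1.
ring.
Qed.

Lemma hpoly_3term (K : comNzRingType) (c : K) n :
  hpoly c n.+1 = - c *: ('X * hpoly c n) - (c * n%:R) *: hpoly c n.-1.
Proof. by rewrite hpolyS deriv_hpoly !scaleNr addrC. Qed.

Lemma map_hpoly (K L : comNzRingType) (f : {rmorphism K -> L}) (c : K) n :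
  map_poly f (hpoly c n) = hpoly (f c) n.
Proof.
elim: n => [|n IH]; first by rewrite /= rmorph1.
by rewrite /= rmorphB /= -deriv_map IH map_polyZ rmorphM /= map_polyX IH.
Qed.

Section Functional.
Variables (K : fieldType) (alpha beta : K).

Definition plinear (L : {poly K} -> K) :=
  forall c p q, L (c *: p + q) = c * L p + L q.

(* Integration by parts, for the weight e^{-at^2-2 pi i xi t}, [alpha = 2a]
   and [beta = 2 pi i xi]. *)
Definition ibp_functional (L : {poly K} -> K) :=
  plinear L /\ forall p, alpha * L ('X * p) = L p^`() - beta * L p.

Variables (L : {poly K} -> K).
Hypothesis linL : plinear L.

Lemma plinear0 : L 0 = 0.
Proof. by have := linL (-1) 0 0; rewrite scaler0 addr0 mulN1r addNr. Qed.

Lemma plinearD p q : L (p + q) = L p + L q.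
Proof. by have := linL 1 p q; rewrite scale1r mul1r. Qed.

Lemma plinearZ c p : L (c *: p) = c * L p.
Proof. by have := linL c p 0; rewrite !addr0 plinear0 addr0. Qed.

Lemma plinearN p : L (- p) = - L p.
Proof. by rewrite -scaleN1r plinearZ mulN1r. Qed.

Lemma plinearB p q : L (p - q) = L p - L q.
Proof. by rewrite plinearD plinearN. Qed.

Lemma plinearMn p n : L (p *+ n) = L p *+ n.
Proof. by rewrite -scaler_nat plinearZ mulr_natl. Qed.

End Functional.

(** Since [alpha] is invertible, the value at ['X * p] is determined by those at [p] and at its
    derivative. The induction treats all derivatives of [p] at once, because the derivative is not a
    subterm of [p]. *)
Lemma ibp_functional_unique (K : fieldType) (alpha beta : K) L1 L2 :
  alpha != 0 -> ibp_functional alpha beta L1 -> ibp_functional alpha beta L2 ->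
  L1 1 = L2 1 -> L1 =1 L2.
Proof.
move=> a0 [l1 i1] [l2 i2] e1 p.
suff: forall k, L1 p^`(k) = L2 p^`(k) by move=> /(_ 0%N).
elim/poly_ind: p => [k|p c IH [|k]].
- by rewrite linear0 !plinear0.
- rewrite !plinearD// -[c%:P]alg_polyC !plinearZ// e1 mulrC; congr (_ + _).
  apply: (mulfI a0); rewrite i1 i2 (IH 0%N); congr (_ - _).
  exact: (IH 1%N).
- rewrite derivnMXaddC !plinearD// !plinearMn// IH mulrC; congr (_ + _).
  apply: (mulfI a0); rewrite i1 i2 IH -derivnS IH //.
Qed.

Section GaussianPairing.
Variables (K : fieldType) (c : K) (L : {poly K} -> K).
Hypothesis Lc : ibp_functional c 0 L.

Let ibp p : c * L ('X * p) = L p^`().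
Proof. by case: Lc => _ ->; rewrite mul0r subr0. Qed.

Let linL : plinear L. Proof. by case: Lc. Qed.

(** Rodrigues' formula in functional form: each unit of the index is a derivative that can be moved
    to the other factor. *)
Lemma hermite_pairingS n p : L (hpoly c n.+1 * p) = - L (hpoly c n * p^`()).
Proof.
rewrite hpolyS mulrBl plinearB// -scalerAl plinearZ// -mulrA ibp derivM.
by rewrite plinearD// opprD addrA subrr add0r.
Qed.

(** Moving derivatives across lowers both indices together until one factor is constant. If the
    other factor is not, one more move differentiates the constant. *)
Lemma hermite_pairing m n : L (hpoly c m * hpoly c n) =
  (m == n)%:R * n`!%:R * c ^+ n * L 1.
Proof.
elim: m n => [|m IH] [|n].
- by rewrite mulr1 fact0 expr0 !mul1r.
- rewrite mulrC hermite_pairingS derivC mulr0 plinear0// oppr0.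
  by rewrite !mul0r.
- by rewrite hermite_pairingS derivC mulr0 plinear0// oppr0 !mul0r.
- rewrite hermite_pairingS deriv_hpoly -scalerAr plinearZ// IH /= eqSS.
  by rewrite factS natrM exprS; ring.
Qed.

(** The displacement ranges over the whole field: over the complex numbers its real part encodes a
    translation and its imaginary part a modulation. *)
Definition hshift a n : {poly K} := hpoly c n \Po ('X + a%:P).

Lemma deriv_hshift a n : (hshift a n)^`() = - (c * n%:R) *: hshift a n.-1.
Proof.
by rewrite deriv_comp derivD derivX derivC addr0 mulr1 deriv_hpoly comp_polyZ.
Qed.

Lemma hshift0 a : hshift a 0 = 1.
Proof. by rewrite /hshift /= rmorph1. Qed.

Lemma hshiftS a n :
  hshift a n.+1 = (hshift a n)^`() - c *: (('X + a%:P) * hshift a n).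
Proof.
rewrite /hshift hpolyS comp_polyB comp_polyZ comp_polyM comp_polyX deriv_comp.
by rewrite derivD derivX derivC addr0 mulr1.
Qed.

Definition hpairing a b m n := L (hshift a m * hshift b n).

Lemma hpairingC a b m n : hpairing a b m n = hpairing b a n m.
Proof. by rewrite /hpairing mulrC. Qed.

Lemma hpairing00 a b : hpairing a b 0 0 = L 1.
Proof. by rewrite /hpairing !hshift0 mulr1. Qed.

(** One term lowers both indices, the other lowers the first alone and gains a factor [a]. This
    homogeneity is what makes a rotation act by a phase. *)
Lemma hpairingS a b m n : hpairing a b m.+1 n =
  c * n%:R * hpairing a b m n.-1 - c * a * hpairing a b m n.
Proof.
rewrite /hpairing hshiftS.
set u := hshift a m; set v := hshift b n.
have -> : (u^`() - c *: (('X + a%:P) * u)) * v =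
    u^`() * v - c *: ('X * (u * v)) - (c * a) *: (u * v).
  by rewrite -!mul_polyC rmorphM /=; ring.
rewrite !plinearB// plinearZ// ibp derivM plinearD// plinearZ//.
rewrite /v deriv_hshift -scalerAr plinearZ//; ring.
Qed.

(* Every monomial [a ^+ i * b ^+ j] of [hpairing a b m n] has [i - j = m - n]. *)
Lemma hpairing_rotation w a b m n : w != 0 ->
  w ^+ n * hpairing (w * a) (w^-1 * b) m n = w ^+ m * hpairing a b m n.
Proof.
move=> w0; elim: m n => [|m IH] n.
  rewrite expr0 mul1r; elim: n => [|n IH].
    by rewrite expr0 mul1r !hpairing00.
  rewrite hpairingC [RHS]hpairingC !hpairingS !mulr0 !mul0r !sub0r.
  rewrite hpairingC [in RHS]hpairingC -IH exprSr; field.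
  exact: w0.
rewrite !hpairingS mulrBr.
have -> : w ^+ n * (c * (w * a) * hpairing (w * a) (w^-1 * b) m n) =
    c * (w * a) * (w ^+ n * hpairing (w * a) (w^-1 * b) m n) by ring.
rewrite IH.
have -> : w ^+ n * (c * n%:R * hpairing (w * a) (w^-1 * b) m n.-1) =
    c * n%:R * (w * (w ^+ n.-1 * hpairing (w * a) (w^-1 * b) m n.-1)).
  by case: n => [|n]; rewrite ?mulr0 ?mul0r ?mulr0// [in LHS]exprS /=; ring.
by rewrite IH exprS; ring.
Qed.

End GaussianPairing.

End HermitePolynomials.

(** * Gaussian Fourier integrals as functionals on polynomials *)

Section GaussianFunctional.
Context {R : realType}.
Notation mu := (@lebesgue_measure R).
Notation Rint h := (mu.-integrable setT (EFin \o h)).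
Implicit Types (a xi : R) (p q : {poly R[i]}).

Lemma plinear_eq (K : fieldType) (L1 L2 : {poly K} -> K) :
  plinear L1 -> plinear L2 -> (forall n, L1 'X^n = L2 'X^n) -> L1 =1 L2.
Proof.
move=> l1 l2 e p; rewrite -[p]coefK poly_def.
elim/big_rec: _ => [|i q _ IH]; first by rewrite !plinear0.
by rewrite l1 l2 IH e.
Qed.

Lemma cmeas_horner p : cmeas (fun t : R => p.[t%:C]).
Proof.
elim/poly_ind: p => [|p c IH].
  by under eq_fun do rewrite horner0; exact: cmeas_cst.
under eq_fun do rewrite hornerMXaddC.
apply: cmeasD; last exact: cmeas_cst.
by apply: cmeasM => //; apply: cmeas_real; exact: measurable_id.
Qed.

Definition gfun a xi p : R[i] := cintegral (fun t =>
  p.[t%:C] * ((expR (- a * t ^+ 2))%:C * expi (- 2 * pi * xi * t))).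

Lemma cint_gfun a xi p : 0 < a -> cint (fun t =>
  p.[t%:C] * ((expR (- a * t ^+ 2))%:C * expi (- 2 * pi * xi * t))).
Proof.
move=> a0.
(* The extra factor [t ^+ k] absorbs the ['X] split off at each step of the Horner induction. *)
suff H k : cint (fun t => p.[t%:C] * ((t ^+ k * expR (- a * t ^+ 2))%:C
    * expi (- 2 * pi * xi * t))).
  by have := H 0%N; under [in X in X -> _]eq_fun do rewrite expr0 mul1r.
elim/poly_ind: p k => [|p c IH] k.
  by under eq_fun do rewrite horner0 mul0r; exact: cint0.
have -> : (fun t => (p * 'X + c%:P).[t%:C] * ((t ^+ k * expR (- a * t ^+ 2))%:C
    * expi (- 2 * pi * xi * t))) =
  (fun t => p.[t%:C] * ((t ^+ k.+1 * expR (- a * t ^+ 2))%:C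
    * expi (- 2 * pi * xi * t)) + c * ((t ^+ k * expR (- a * t ^+ 2))%:C
    * expi (- 2 * pi * xi * t))).
  apply/funext => t; rewrite hornerMXaddC mulrDl; congr (_ + _).
  by rewrite (exprS t k) !(rmorphM (real_complex R)) /=; ring.
by apply: cintD => //; apply: cintZ; exact: cint_gmoment.
Qed.

Lemma gfun_linear a xi : 0 < a -> plinear (gfun a xi).
Proof.
move=> a0 c p q; rewrite /gfun -cintegralZ; last exact: cint_gfun.
rewrite -cintegralD; [|by apply: cintZ; exact: cint_gfun|exact: cint_gfun].
by congr cintegral; apply/funext => t; rewrite hornerD hornerZ; ring.
Qed.

Lemma gfunXn a xi n : gfun a xi 'X^n = gmoment a xi n.
Proof.
congr cintegral; apply/funext => t.
by rewrite hornerXn !rmorphM rmorphXn mulrA.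
Qed.

(** Both sides are linear in the polynomial, and on monomials the relation is [gmoment_rec]. *)
Lemma gfun_ibp a xi : 0 < a ->
  ibp_functional (2 * a)%:C (Complex 0 (2 * pi * xi)) (gfun a xi).
Proof.
move=> a0; have lin := gfun_linear xi a0; split => //.
apply: plinear_eq => [c p q|c p q|n].
- by rewrite mulrDr -scalerAr lin; ring.
- by rewrite derivD derivZ !lin; ring.
- rewrite derivXn -exprS plinearMn// !gfunXn gmoment_rec// mulr_natl.
  by congr (_ - _).
Qed.

Lemma gfun1 a xi : 0 < a ->
  gfun a xi 1 = (Num.sqrt (pi / a) * expR (- (pi ^+ 2 * xi ^+ 2 / a)))%:C.
Proof. by move=> a0; rewrite -(expr0 'X) gfunXn gmoment0. Qed.

(* Shift of the contour of integration by [i pi xi / a]. *)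
Lemma gfun_contour a xi p : 0 < a ->
  gfun a xi p = (expR (- (pi ^+ 2 * xi ^+ 2 / a)))%:C *
    gfun a 0 (p \Po ('X - (Complex 0 (pi * xi / a))%:P)).
Proof.
move=> a0; have an0 : a != 0 by rewrite gt_eqF.
have lin := gfun_linear 0 a0.
have [_ ibp0] := gfun_ibp 0 a0.
(* The contour shift becomes algebra: translating ['X] by a constant commutes with derivation and
   contributes exactly the [beta] term, and the value at 1 is the Fourier transform of the
   Gaussian. *)
apply: (@ibp_functional_unique _ _ _ _
  (fun p => _ * gfun a 0 (p \Po _)) _ (gfun_ibp xi a0)).
- by apply/eqP => -[] /eqP; rewrite mulf_eq0 pnatr_eq0 /= (negbTE an0).
- split=> [c q r|q].
    by rewrite comp_polyD comp_polyZ lin mulrDr mulrCA.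
  rewrite comp_polyM comp_polyX mulrBl plinearB// mul_polyC plinearZ//.
  set r := q \Po _.
  have -> : q^`() \Po ('X - (Complex 0 (pi * xi / a))%:P) = r^`().
    by rewrite /r deriv_comp derivB derivX derivC subr0 mulr1.
  have := ibp0 r; rewrite mulr0 => h.
  have {}h : gfun a 0 r^`() = (2 * a)%:C * gfun a 0 ('X * r).
    rewrite h (_ : Complex 0 0 = 0 :> R[i])// mul0r subr0 //.
  rewrite h.
  have -> : Complex 0 (2 * pi * xi) = (2 * a)%:C * Complex 0 (pi * xi / a).
    by apply: eq_ReIm; rewrite ?ReM ?ImM /=; field.
  by ring.
- rewrite !gfun1//= rmorph1 gfun1// expr0n !mulr0 mul0r oppr0 expR0 mulr1.
  by rewrite rmorphM mulrC.
Qed.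

End GaussianFunctional.

Section HermiteFunctions.
Context {R : realType}.
Notation mu := (@lebesgue_measure R).
Notation Rint h := (mu.-integrable setT (EFin \o h)).
Notation q n := (hpoly (4 * pi : R) n).
Notation cq n := (hpoly ((4 * pi)%:C : R[i]) n).

Lemma is_derive_horner (p : {poly R}) (t : R) :
  is_derive t (1 : R) (fun t => p.[t]) p^`().[t].
Proof.
apply: DeriveDef; first exact: derivable_horner.
by rewrite -derive1E -derivE.
Qed.

(** The weight [e^{-2 pi t^2}] is [e^{-c t^2 / 2}] for [c = 4 pi], whence the parameter of [hpoly]
    used for Hermite functions. *)
Lemma derive1n_gauss n :
  derive1n n (fun s : R => expR (- 2 * pi * s ^+ 2)) =
  (fun t => (q n).[t] * expR (- (2 * pi) * t ^+ 2)).
Proof.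
elim: n => [|n IH].
  by apply/funext => t; rewrite derive1n0 /= hornerC mul1r mulNr.
rewrite derive1nS IH; apply/funext => t; rewrite derive1E.
have h1 := is_derive_horner (q n) t.
have h2 := is_derive_gauss (2 * pi) t.
have D := is_deriveM h1 h2.
have {}D : is_derive t (1 : R)
  (fun t => (q n).[t] * expR (- (2 * pi) * t ^+ 2)) _ := D.
rewrite derive_val /GRing.scale /= !(hornerD, hornerN, hornerZ, hornerM, hornerX); ring.
Qed.

Definition hnorm n : R :=
  2 `^ 4^-1 / Num.sqrt (n`!)%:R * (- 1 / (2 * Num.sqrt pi)) ^+ n.

Lemma hermiteE n t : hermite n t = hnorm n * ((q n).[t] * expR (- pi * t ^+ 2)).
Proof.
rewrite /hermite derive1n_gauss /hnorm -!mulrA; do 3 congr (_ * _).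
rewrite mulrCA -expRD; congr (_ * expR _); ring.
Qed.

Lemma chermiteE n t : chermite n t =
  (hnorm n)%:C * ((cq n).[t%:C] * (expR (- pi * t ^+ 2))%:C).
Proof.
by rewrite /chermite hermiteE -(map_hpoly (real_complex R)) horner_map
  !(rmorphM (real_complex R)).
Qed.

Lemma chermiteJ n t : (chermite n t : R[i])^* = chermite n t.
Proof. by apply: eq_ReIm; rewrite ?ReJ ?ImJ //= oppr0. Qed.

Lemma gfun0E a (p : {poly R[i]}) :
  gfun a 0 p = cintegral (fun t => p.[t%:C] * (expR (- a * t ^+ 2))%:C).
Proof.
congr cintegral; apply/funext => t.
by rewrite mulr0 mul0r expi0 mulr1.
Qed.

Lemma cint_horner_gauss a (p : {poly R[i]}) : 0 < a ->
  cint (fun t => p.[t%:C] * (expR (- a * t ^+ 2))%:C).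
Proof.
move=> a0; have := cint_gfun 0 p a0.
by under [in X in X -> _]eq_fun do rewrite mulr0 mul0r expi0 mulr1.
Qed.

Lemma chermite_mul m n t : chermite m t * chermite n t =
  (hnorm m * hnorm n)%:C *
    ((cq m * cq n).[t%:C] * (expR (- (2 * pi) * t ^+ 2))%:C).
Proof.
have -> : expR (- (2 * pi) * t ^+ 2) = expR (- pi * t ^+ 2) * expR (- pi * t ^+ 2) :> R.
  by rewrite -expRD; congr expR; ring.
by rewrite !chermiteE hornerM !(rmorphM (real_complex R)) /=; ring.
Qed.

Let pi20 : 0 < 2 * pi :> R. Proof. by rewrite mulr_gt0 // pi_gt0. Qed.

Lemma gfun_ibp2pi : ibp_functional ((4 * pi)%:C : R[i]) 0 (gfun (2 * pi) 0).
Proof.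
have [lin h] := gfun_ibp 0 pi20; split => // p.
have -> : 4 * pi = 2 * (2 * pi) :> R by ring.
by rewrite h mulr0.
Qed.

(** The factor [n! (4 pi)^n] is the squared length of the polynomial relative to the mass
    [1 / sqrt 2] of [e^{-2 pi t^2}], so the identity says that [hermite n] has norm 1. *)
Lemma hnorm_sqr n : hnorm n ^+ 2 * (n`!%:R * (4 * pi) ^+ n) = Num.sqrt 2.
Proof.
rewrite /hnorm; move: (pi_gt0 R); move: (@pi R) => p p0.
have pn0 := lt0r_neq0 p0; set u := 2 `^ _; set s := Num.sqrt _; set v := _ ^+ n.
have -> : (u / s * v) ^+ 2 = u ^+ 2 * (s ^+ 2)^-1 * v ^+ 2.
  by rewrite !exprMn exprVn.
rewrite {}/u {}/v {}/s sqr_sqrtr ?ler0n//.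
have -> : (2 `^ 4^-1) ^+ 2 = Num.sqrt 2 :> R.
  rewrite -powR_mulrn ?powR_ge0// -powRrM -powR12_sqrt//; congr (_ `^ _).
  by field.
have -> : ((- 1 / (2 * Num.sqrt p)) ^+ n) ^+ 2 = ((4 * p) ^+ n)^-1 :> R.
  rewrite -exprM mulnC exprM -exprVn; congr (_ ^+ n).
  rewrite expr_div_n exprMn sqr_sqrtr ?ltW//; field.
  exact: pn0.
field; rewrite pnatr_eq0 -lt0n fact_gt0 /= expf_neq0//.
exact: mulf_neq0.
Qed.

Lemma cmeas_chermite n : cmeas (fun t : R => chermite n t : R[i]).
Proof.
under eq_fun do rewrite chermiteE.
apply: cmeasM; first exact: cmeas_cst.
apply: cmeasM; first exact: cmeas_horner.
by apply: cmeas_real; exact: measurable_gauss.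
Qed.

Lemma cint_chermite n : cint (chermite n : R -> R[i]).
Proof.
rewrite (_ : chermite n = fun t => (hnorm n)%:C *
    ((cq n).[t%:C] * (expR (- pi * t ^+ 2))%:C)).
  by apply: cintZ; apply: cint_horner_gauss; exact: pi_gt0.
by apply/funext => t; exact: chermiteE.
Qed.

Lemma cint_chermite2 m n : cint (fun t : R => chermite m t * chermite n t : R[i]).
Proof.
under [in X in cint X]eq_fun do rewrite chermite_mul.
by apply: cintZ; exact: cint_horner_gauss.
Qed.

Lemma L2_chermite n : L2 (chermite n : R -> R[i]).
Proof.
apply/L2P; split; first exact: cmeas_chermite.
have [+ _] := cint_chermite2 n n.
rewrite (_ : (fun t => Re (chermite n t * chermite n t)) =
  (fun t => cmod (chermite n t : R[i]) ^+ 2))//.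
apply/funext => t; rewrite cmod_sqr ReM /=; ring.
Qed.

Lemma inner_chermite m n : inner (chermite m) (chermite n) = (m == n)%:R :> R[i].
Proof.
have pgt0 : 0 < pi :> R := pi_gt0 R.
rewrite /inner.
have -> : (fun t => chermite m t * (chermite n t)^*) =
    (fun t => (hnorm m * hnorm n)%:C *
    ((cq m * cq n).[t%:C] * (expR (- (2 * pi) * t ^+ 2))%:C)) :> (R -> R[i]).
  by apply/funext => t; rewrite chermiteJ chermite_mul.
rewrite cintegralZ; last exact: cint_horner_gauss.
rewrite -gfun0E (hermite_pairing gfun_ibp2pi) gfun1//.
have [->|_] := eqVneq m n; last by rewrite !mul0r mulr0.
rewrite mul1r expr0n mulr0 mul0r oppr0 expR0 mulr1.
have -> : n`!%:R * (4 * pi)%:C ^+ n = (n`!%:R * (4 * pi) ^+ n)%:C :> R[i].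
  by rewrite [RHS](rmorphM (real_complex R)) rmorph_nat [in RHS](rmorphXn (real_complex R)).
rewrite -!(rmorphM (real_complex R)) -expr2 mulrA hnorm_sqr.
have -> : pi / (2 * pi) = 2^-1 :> R by rewrite invfM mulrCA mulfV ?mulr1// lt0r_neq0.
by rewrite sqrtrV// mulfV// gt_eqF// sqrtr_gt0.
Qed.

End HermiteFunctions.

(** * Time-frequency transforms of Hermite functions *)

Section Translation.
Context {R : realType}.
Notation mu := (@lebesgue_measure R).
Notation Rint h := (mu.-integrable setT (EFin \o h)).

Lemma measurable_shift (c : R) :
  measurable_fun setT (fun t : R => t + c : measurableTypeR R).
Proof. by apply: measurable_funD; [exact: measurable_id | exact: measurable_cst]. Qed.

Lemma lebesgue_measure_shift (c : R) (A : set R) : measurable A ->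
  pushforward mu (fun t : R => t + c : measurableTypeR R) A = mu A.
Proof.
move=> mA; apply/esym/lebesgue_measure_unique => //=.
  exact: measurable_shift.
move=> _ ? [[a b]] _ <-.
rewrite /pushforward.
rewrite (_ : _ @^-1` _ = `]a - c, b - c]%classic); last first.
  by apply/seteqP; split => t /=; rewrite !in_itv /= ltrBlDr lerBrDr.
rewrite !lebesgue_measure_itv/= !lte_fin ltrD2r.
by case: ifP => // _; rewrite -!EFinD; congr EFin; ring.
Qed.

Lemma ge0_integral_shift (c : R) (f : R -> \bar R) :
  measurable_fun setT f -> (forall t, 0 <= f t)%E ->
  (\int[mu]_t f (t + c)%R = \int[mu]_t f t)%E.
Proof.
move=> mf f0; transitivity (\int[pushforward mu
    (fun t : R => (t + c)%R : measurableTypeR R)]_t f t)%E.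
  rewrite ge0_integral_pushforward//; exact: measurable_shift.
apply: eq_measure_integral => [|mf_ A mA _]; first exact: measurable_shift.
exact: (lebesgue_measure_shift c mA).
Qed.

Lemma Rint_shift (c : R) (u : R -> R) : Rint u -> Rint (fun t => u (t + c)).
Proof.
move=> /integrableP[mf fi]; apply/integrableP; split.
  by apply: (measurableT_comp mf); exact: measurable_shift.
rewrite (@ge0_integral_shift c (fun t => `|(u t)%:E|%E))//.
exact: measurableT_comp.
Qed.

Lemma Rintegral_shift (c : R) (u : R -> R) : Rint u ->
  \int[mu]_t u (t + c) = \int[mu]_t u t.
Proof.
move=> iu; have /integrableP[mf fi] := iu; congr fine.
transitivity (\int[pushforward mu
    (fun t : R => (t + c)%R : measurableTypeR R)]_t (u t)%:E)%E.
  rewrite integral_pushforward//; first exact: measurable_shift.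
  exact: (Rint_shift c iu).
apply: eq_measure_integral => [|mf_ A mA _]; first exact: measurable_shift.
exact: (lebesgue_measure_shift c mA).
Qed.

Lemma cintegral_shift (c : R) (f : R -> R[i]) : cint f ->
  cintegral (fun t => f (t + c)) = cintegral f.
Proof.
move=> [ir ii]; rewrite /cintegral; congr Complex.
  by rewrite (Rintegral_shift c ir).
by rewrite (Rintegral_shift c ii).
Qed.

Lemma cmeas_shift (c : R) (f : R -> R[i]) : cmeas f ->
  cmeas (fun t : R => f (t + c)).
Proof. by move=> mf; exact: (cmeas_comp (measurable_shift c) mf). Qed.

Lemma L2_shift (c : R) (f : R -> R[i]) : L2 f -> L2 (fun t => f (t + c)).
Proof.
move=> /L2P[mf fi]; apply/L2P; split; first exact: cmeas_shift.
exact: (Rint_shift c fi).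
Qed.

Lemma nrm2_shift (c : R) (f : R -> R[i]) : L2 f ->
  nrm2 (fun t => f (t + c)) = nrm2 f.
Proof. by move=> /L2_int fi; rewrite /nrm2 (Rintegral_shift c fi). Qed.

End Translation.

Section HermiteTransforms.
Context {R : realType}.
Notation mu := (@lebesgue_measure R).
Notation Rint h := (mu.-integrable setT (EFin \o h)).
Notation c4pi := ((4 * pi)%:C : R[i]).
Notation cq n := (hpoly c4pi n).
Notation ii := (Complex 0 1 : R[i]).

Let pi_simpl1 (x : R) : - (pi ^+ 2 * x ^+ 2 / pi) = - pi * x ^+ 2.
Proof. by move: (lt0r_neq0 (pi_gt0 R)); move: (@pi R) => p p0; field. Qed.

Let pi_simpl2 (x y : R) : - (pi * (x ^+ 2 + y ^+ 2) / 2) =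
  - (pi * x ^+ 2 / 2) + - (pi ^+ 2 * y ^+ 2 / (2 * pi)).
Proof. by move: (lt0r_neq0 (pi_gt0 R)); move: (@pi R) => p p0; field. Qed.

Let pi_simpl3 (x : R) : pi * x / (2 * pi) = x / 2.
Proof. by move: (lt0r_neq0 (pi_gt0 R)); move: (@pi R) => p p0; field. Qed.

(** Integration by parts turns the recursion of [hpoly] into the three-term recurrence in [xi], each
    step contributing [-i]. The recurrence has order two, so the induction carries two consecutive
    indices. *)
Lemma gfun_hpoly (xi : R) n : gfun pi xi (cq n) =
  (- ii) ^+ n * ((cq n).[xi%:C] * (expR (- pi * xi ^+ 2))%:C).
Proof.
have p0 := pi_gt0 R.
have pn0 : 2%:R * pi%:C != 0 :> R[i].
  by rewrite mulf_neq0 ?pnatr_eq0// fmorph_eq0 lt0r_neq0.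
have [lin ibp] := gfun_ibp xi p0.
have i2 : (ii : R[i]) * ii = -1 by apply: eq_ReIm; rewrite ?ReM ?ImM /=; ring.
have rec m : gfun pi xi (cq m.+1) =
    c4pi * m%:R * gfun pi xi (cq m.-1) + c4pi * xi%:C * ii * gfun pi xi (cq m).
  rewrite hpolyS plinearB// plinearZ//.
  have -> : c4pi * gfun pi xi ('X * cq m) =
      2%:R * ((2 * pi)%:C * gfun pi xi ('X * cq m)).
    rewrite mulrA; congr (_ * _).
    by rewrite -(rmorph_nat (real_complex R)) -rmorphM /=; congr (_%:C); ring.
  rewrite ibp deriv_hpoly plinearZ//.
  have -> : Complex 0 (2 * pi * xi) = (2 * pi)%:C * xi%:C * ii.
    by apply: eq_ReIm; rewrite ?ReM ?ImM /=; ring.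
  by ring.
suff H : forall m, (gfun pi xi (cq m) =
    (- ii) ^+ m * ((cq m).[xi%:C] * (expR (- pi * xi ^+ 2))%:C)) /\
    (gfun pi xi (cq m.+1) =
    (- ii) ^+ m.+1 * ((cq m.+1).[xi%:C] * (expR (- pi * xi ^+ 2))%:C)).
  by have [] := H n.
have H0 : gfun pi xi (cq 0) = (expR (- pi * xi ^+ 2))%:C.
  rewrite gfun1// divff ?lt0r_neq0// sqrtr1 mul1r; congr (expR _)%:C.
  exact: pi_simpl1.
elim=> [|m [IH1 IH2]]; split => //.
- by rewrite expr0 hornerC !mul1r.
- rewrite rec mulr0 mul0r add0r H0 hpolyS derivC sub0r mulr1 hornerN hornerZ hornerX.
  by ring.
- rewrite rec -[m.+1.-1]/m IH1 IH2 (hpoly_3term _ m.+1) -[m.+1.-1]/m.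
  move: (cq m) (cq m.+1) => A B; rewrite hornerD hornerN !hornerZ hornerM hornerX.
  have -> : (- ii) ^+ m.+2 = - (- ii) ^+ m.
    by rewrite !exprS mulrA mulrNN i2 mulN1r.
  have e : ii * (- ii) ^+ m.+1 = (- ii) ^+ m.
    by rewrite exprS mulrA mulrN i2 opprK mul1r.
  move: (expR _)%:C A.[_] B.[_] => E {}A {}B.
  have -> : c4pi * xi%:C * ii * ((- ii) ^+ m.+1 * (B * E)) =
      c4pi * xi%:C * (ii * (- ii) ^+ m.+1) * (B * E) by ring.
  by rewrite e; ring.
Qed.

Lemma fourier_chermite (xi : R) n :
  cintegral (fun t => chermite n t * expi (- 2 * pi * xi * t)) =
  (- ii) ^+ n * chermite n xi.
Proof.
have p0 := pi_gt0 R.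
rewrite chermiteE mulrCA -gfun_hpoly /gfun -cintegralZ; last exact: cint_gfun.
by congr cintegral; apply/funext => t; rewrite chermiteE -!mulrA.
Qed.

Definition hpair m n (z : R * R) : R[i] :=
  hpairing c4pi (gfun (2 * pi) 0) (Complex (z.1 / 2) (- z.2 / 2))
    (Complex (- z.1 / 2) (- z.2 / 2)) m n.

(* The function and the window are recentred at [- x / 2] and [x / 2], and the
   integral is then shifted by [i xi / 2]: the polynomials see [z] only through
   [x - i xi] and [x + i xi], on which a rotation acts by opposite phases. *)
Lemma stft_chermite m n (z : R * R) :
  stft (chermite n) (chermite m) z =
  (hnorm m * hnorm n * expR (- (pi * (z.1 ^+ 2 + z.2 ^+ 2) / 2)))%:C *
  expi (- pi * z.1 * z.2) * hpair m n z.
Proof.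
case: z => x xi /=.
have p0 := pi_gt0 R.
have p20 : 0 < 2 * pi :> R by rewrite mulr_gt0.
pose P := hshift c4pi (x / 2)%:C m * hshift c4pi (- x / 2)%:C n.
pose f t := chermite m t * (chermite n (t - x))^* * expi (- 2 * pi * xi * t).
have fE t : f (t + x / 2) =
    (hnorm m * hnorm n * expR (- (pi * x ^+ 2 / 2)))%:C * expi (- pi * x * xi) *
    (P.[t%:C] * ((expR (- (2 * pi) * t ^+ 2))%:C * expi (- 2 * pi * xi * t))).
  rewrite /f chermiteJ !chermiteE.
  have -> : t + x / 2 - x = t - x / 2 by field.
  rewrite /P hornerM /hshift !horner_comp !(hornerD, hornerX, hornerC).
  have -> : - 2 * pi * xi * (t + x / 2) = - 2 * pi * xi * t + - pi * x * xi by field.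
  rewrite expiD.
  have -> : (t - x / 2)%:C = t%:C + (- x / 2)%:C :> R[i].
    by rewrite -rmorphD mulNr.
  have -> : (t + x / 2)%:C = t%:C + (x / 2)%:C :> R[i] by rewrite rmorphD.
  set A := (hpoly _ m).[_]; set B := (hpoly _ n).[_].
  have e : expR (- pi * (t + x / 2) ^+ 2) * expR (- pi * (t - x / 2) ^+ 2) =
      expR (- (pi * x ^+ 2 / 2)) * expR (- (2 * pi) * t ^+ 2).
    by rewrite -!expRD; congr expR; field.
  have {}e : (expR (- pi * (t + x / 2) ^+ 2))%:C * (expR (- pi * (t - x / 2) ^+ 2))%:C =
      (expR (- (pi * x ^+ 2 / 2)))%:C * (expR (- (2 * pi) * t ^+ 2))%:C :> R[i].
    by rewrite -!rmorphM /= e.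
  rewrite !(rmorphM (real_complex R)) /=.
  by ring: e.
have cf : cint f.
  have -> : f = (fun t => f ((t - x / 2) + x / 2)).
    by apply/funext => t; rewrite subrK.
  pose f1 t := f (t + x / 2).
  suff cf1 : cint f1 by have [a b] := cf1; split;
    [exact: (Rint_shift (- (x / 2)) a)|exact: (Rint_shift (- (x / 2)) b)].
  by rewrite /f1; under eq_fun do rewrite fE; apply: cintZ; exact: cint_gfun.
rewrite /stft /= -[LHS](cintegral_shift (x / 2) cf).
under eq_fun do rewrite fE.
rewrite cintegralZ; last exact: cint_gfun.
rewrite -/(gfun (2 * pi) xi P) gfun_contour//.
have -> : P \Po ('X - (Complex 0 (pi * xi / (2 * pi)))%:P) =
   hshift c4pi (Complex (x / 2) (- xi / 2)) m * hshift c4pi (Complex (- x / 2) (- xi / 2)) n.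
  rewrite /P comp_polyM /hshift -!comp_polyA !comp_polyD !comp_polyX !comp_polyC.
  rewrite -!addrA -!polyCN -!polyCD; congr ((_ \Po ('X + _%:P)) * (_ \Po ('X + _%:P)));
  by apply: eq_ReIm; rewrite ?ReD ?ImD /= ?pi_simpl3; field.
rewrite /hpair /= -/(hpairing _ _ _ _ _ _).
have -> : expR (- (pi * (x ^+ 2 + xi ^+ 2) / 2)) = expR (- (pi * x ^+ 2 / 2)) *
    expR (- (pi ^+ 2 * xi ^+ 2 / (2 * pi))).
  by rewrite -expRD -pi_simpl2.
by rewrite !(rmorphM (real_complex R)) /= /hpairing; ring.
Qed.

End HermiteTransforms.

(** * Completeness of the Hermite functions *)

Section PolynomialLimits.
Context {R : realType}.
Notation mu := (@lebesgue_measure R).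
Notation Rint h := (mu.-integrable setT (EFin \o h)).

(* Functions that a measure with vanishing moments and exponential decay
   annihilates, by dominated convergence. *)
Definition poly_limit (phi : R -> R) :=
  exists (p : nat -> {poly R}) (C c : R), [/\ 0 <= C, 0 <= c,
    (forall N t, `|(p N).[t]| <= C * expR (c * `|t|)) &
    forall t, (p N).[t] @[N --> \oo] --> phi t].

Lemma poly_limit_affine (a b : R) phi : poly_limit phi ->
  poly_limit (fun t => a + b * phi t).
Proof.
move=> [p [C [c [C0 c0 pC cp]]]].
exists (fun N => a%:P + b *: p N), (`|a| + `|b| * C), c; split => //.
- by rewrite addr_ge0// mulr_ge0.
- move=> N t; rewrite hornerD hornerC hornerZ (le_trans (ler_normD _ _))//.
  rewrite mulrDl lerD//; last by rewrite normrM -mulrA ler_wpM2l.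
  by rewrite ler_peMr// -expR0 ler_expR mulr_ge0.
- move=> t; under eq_fun do rewrite hornerD hornerC hornerZ.
  by apply: cvgD; [exact: cvg_cst | exact: cvgMr].
Qed.

(** The growth rates add up, which is why the moment problem below assumes integrability against
    every exponential. *)
Lemma poly_limitM phi psi : poly_limit phi -> poly_limit psi ->
  poly_limit (fun t => phi t * psi t).
Proof.
move=> [p [C [c [C0 c0 pC cp]]]] [q [D [d [D0 d0 qD cq]]]].
exists (fun N => p N * q N), (C * D), (c + d); split.
- exact: mulr_ge0.
- exact: addr_ge0.
- move=> N t; rewrite hornerM normrM mulrDl expRD mulrACA.
  exact: ler_pM.
- by move=> t; under eq_fun do rewrite hornerM; exact: cvgM.
Qed.

Lemma poly_limit_cst (a : R) : poly_limit (fun=> a).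
Proof.
exists (fun=> a%:P), `|a|, 0; split => //.
- by move=> N t; rewrite hornerC mul0r expR0 mulr1.
- by move=> t; under eq_fun do rewrite hornerC; exact: cvg_cst.
Qed.

Lemma poly_limitX n phi : poly_limit phi -> poly_limit (fun t => phi t ^+ n).
Proof.
move=> lphi; elim: n => [|n IH]; first exact: poly_limit_cst.
by under eq_fun do rewrite exprS; exact: poly_limitM.
Qed.

(** The partial sums of the sine series are dominated by those of the exponential series, hence by
    [e^{|c|} e^{|b| |t|}]. *)
Lemma poly_limit_sin (b c : R) : poly_limit (fun t => sin (b * t + c)).
Proof.
pose s k : R := (odd k)%:R * (-1) ^+ k.-1./2 / k`!%:R.
pose p N := \sum_(0 <= k < N) s k *: (b *: 'X + c%:P) ^+ k.
have pE N t : (p N).[t] = series (sin_coeff (b * t + c)) N.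
  rewrite /p horner_sum /series /=; apply: eq_bigr => k _.
  rewrite hornerZ horner_exp hornerD hornerZ hornerX hornerC /s /sin_coeff /=.
  by rewrite mulrAC.
exists p, (expR `|c|), `|b|; split; rewrite ?expR_ge0 ?normr_ge0//.
- move=> N t; rewrite pE -expRD.
  apply: (@le_trans _ _ (series (exp_coeff `|b * t + c|) N)).
    rewrite /series /= (le_trans (ler_norm_sum _ _ _))// ler_sum// => k _.
    rewrite /sin_coeff /exp_coeff /= !normrM normrX normfV normrX normrN1 expr1n.
    rewrite mulr1 (ger0_norm (ler0n _ k`!)) -mulrA ler_piMl//.
    by case: odd; rewrite ?normr1 ?normr0.
  apply: (@le_trans _ _ (expR `|b * t + c|)).
    apply: nondecreasing_cvgn_le; last exact: is_cvg_series_exp_coeff.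
    apply/nondecreasing_seqP => n; rewrite seriesSr lerDl.
    by rewrite /exp_coeff divr_ge0// exprn_ge0.
  by rewrite ler_expR addrC (le_trans (ler_normD _ _))// normrM.
- move=> t; under eq_fun do rewrite pE.
  rewrite sin.unlock; exact: is_cvg_series_sin_coeff.
Qed.

Section Moments.
Variable v : R -> R.
Hypothesis iv : forall c, Rint (fun t => v t * expR (c * `|t|)).
Hypothesis v0 : forall n, \int[mu]_t (v t * t ^+ n) = 0.

Let mv : measurable_fun setT v.
Proof.
have := Rint_meas (iv 0); congr (measurable_fun _ _).
by apply/funext => t; rewrite mul0r expR0 mulr1.
Qed.

Let Rint_vp (p : {poly R}) C c :
  (forall t, `|p.[t]| <= C * expR (c * `|t|)) -> Rint (fun t => v t * p.[t]).
Proof.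
move=> pC; apply: (Rint_dom _ (RintZ C (Rint_norm (iv c)))).
  apply: measurable_funM => //.
  by apply: continuous_measurable_fun; exact: continuous_horner.
move=> t; rewrite !normrM mulrCA ler_wpM2l// (le_trans (pC t))//.
by rewrite (ger0_norm (expR_ge0 _)).
Qed.

Let Rint_vX n : Rint (fun t => v t * t ^+ n).
Proof.
have -> : (fun t => v t * t ^+ n) = (fun t => v t * ('X^n).[t]).
  by apply/funext => t; rewrite hornerXn.
by apply: (@Rint_vp _ n`!%:R 1) => t; rewrite hornerXn mul1r; exact: normX_le_exp.
Qed.

Let vp0 (p : {poly R}) : \int[mu]_t (v t * p.[t]) = 0.
Proof.
suff [] : Rint (fun t => v t * p.[t]) /\ \int[mu]_t (v t * p.[t]) = 0 by [].
rewrite -[p]coefK poly_def; elim/big_rec: _ => [|i q _ [iq q0]].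
  split; first by under [in X in Rint X]eq_fun do rewrite horner0 mulr0;
    exact: integrable0.
  under eq_Rintegral do rewrite horner0 mulr0.
  by rewrite (@Rintegral_cst _ _ _ lebesgue_measure setT)// mul0r.
have e : (fun t => v t * (p`_i *: 'X^i + q).[t]) =
    (fun t => p`_i * (v t * t ^+ i) + v t * q.[t]).
  by apply/funext => t; rewrite hornerD hornerZ hornerXn; ring.
rewrite e; split; first by apply: RintD => //; exact: RintZ.
by rewrite RintegralD// ?RintegralZl// ?v0 ?q0 ?mulr0 ?addr0//; exact: RintZ.
Qed.

Lemma poly_limit_orthogonal phi : poly_limit phi ->
  \int[mu]_t (v t * phi t) = 0.
Proof.
move=> [p [C [c [C0 c0 pC cp]]]].
have mp N : measurable_fun setT (horner (p N)).
  by apply: continuous_measurable_fun; exact: continuous_horner.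
have mphi : measurable_fun setT phi.
  by apply: (measurable_fun_cvg mp) => t _; exact: cp.
have [|||||_ cv] := @Rint_dominated_convergence _
  (fun N t => v t * (p N).[t]) (fun t => v t * phi t)
  (fun t => C * `|v t * expR (c * `|t|)|).
- by move=> N; exact: measurable_funM.
- exact: measurable_funM.
- by apply: aeW => t; exact: cvgMr.
- by apply: RintZ; exact: Rint_norm.
- move=> N t; rewrite !normrM mulrCA ler_wpM2l// (le_trans (pC N t))//.
  by rewrite (ger0_norm (expR_ge0 _)).
have e : (fun N => \int[mu]_t (v t * (p N).[t])) = (fun=> 0).
  by apply/funext => N; exact: vp0.
by rewrite e in cv; exact: (cvg_unique _ cv (cvg_cst 0)).
Qed.

End Moments.

(** Mean value theorem on an interval where the cosine exceeds 1/2. A linear lower bound is all that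
    separates the two sides of the threshold in [ramp]. *)
Lemma sin_ge_half : exists2 d : R, 0 < d &
  forall u, 0 <= u -> u < d -> u / 2 <= sin u.
Proof.
have h12 : 0 < 1 / 2 :> R by lra.
have c1 : \forall x \near (0 : R), `|1 - cos x| < 1 / 2.
  by have /cvgrPdist_lt /(_ _ h12) := @continuous_cos R 0; rewrite cos0.
move: c1 => [d d0 cosd].
exists d => // u; rewrite le_eqVlt => /predU1P[<- _|u0 ud].
  by rewrite mul0r sin0.
have dsin (x : R) : x \in `]0, u[ -> is_derive x 1 (@sin R) (cos x).
  by move=> _; exact: is_derive_sin.
have csin : {within `[0, u], continuous (@sin R)}.
  by apply: continuous_subspaceT => x; exact: continuous_sin.
have [c] := MVT u0 dsin csin.
rewrite in_itv /= => /andP[c0 cu]; rewrite sin0 !subr0 => ->.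
have : `|1 - cos c| < 1 / 2.
  by apply: cosd; rewrite /ball /= sub0r normrN gtr0_norm// (lt_trans cu).
rewrite ltr_norml => /andP[_ h]; rewrite mulrC ler_wpM2r ?ltW//; lra.
Qed.

(* Smooth approximation of the indicator function of [`]s, +oo[], built from
   the sine so as to be a limit of polynomials. *)
Definition ramp (s : R) (N : nat) (t : R) : R :=
  (1 - (1 / 2 + - (1 / 2) * sin (N.+1%:R^-1 * t + - (N.+1%:R^-1 * s)))
    ^+ (N.+1 ^ 2)) ^+ (2 ^ (N.+1 ^ 2)).

Lemma poly_limit_ramp s N : poly_limit (ramp s N).
Proof.
apply: poly_limitX.
pose psi t := (1 / 2 + - (1 / 2) * sin (N.+1%:R^-1 * t + - (N.+1%:R^-1 * s)))
  ^+ (N.+1 ^ 2).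
have lpsi : poly_limit psi.
  by apply: poly_limitX; apply: poly_limit_affine; exact: poly_limit_sin.
have := poly_limit_affine 1 (-1) lpsi.
by under eq_fun do rewrite mulN1r.
Qed.

(** With [K = (N+1)^2] this is [(1 - r^K / 2^K)^(2^K)], comparable to [exp (- r^K)]. Dividing by
    [2^K] keeps the base in [[0, 1]]. The frequency [1 / (N+1)] brings any [t] close to the zero of
    the sine, where [r] differs from 1 by about [|t - s| / (N+1)]; the exponent [K] then drives
    [r^K] to 0 when [t > s] and to infinity when [t < s]. *)
Lemma rampE (s : R) N t (r := 1 - sin ((t - s) / N.+1%:R)) :
  ramp s N t = (1 - r ^+ (N.+1 ^ 2) / 2 ^+ (N.+1 ^ 2)) ^+ (2 ^ (N.+1 ^ 2)).
Proof.
rewrite /ramp /r -expr_div_n; congr ((1 - _ ^+ _) ^+ _).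
have -> : N.+1%:R^-1 * t + - (N.+1%:R^-1 * s) = (t - s) / N.+1%:R.
  by rewrite -mulrN -mulrDr mulrC.
by field.
Qed.

Lemma ramp_base (s : R) N t (r := 1 - sin ((t - s) / N.+1%:R)) :
  0 <= r ^+ (N.+1 ^ 2) / 2 ^+ (N.+1 ^ 2) <= 1.
Proof.
have r0 : 0 <= r by rewrite subr_ge0 sin_le1.
have r2 : r <= 2.
  by rewrite /r; have := sin_geN1 ((t - s) / N.+1%:R); lra.
rewrite divr_ge0 ?exprn_ge0//= ler_pdivrMr ?exprn_gt0// mul1r.
by apply: lerXn2r; rewrite ?nnegrE.
Qed.

Lemma ramp_itv s N t : 0 <= ramp s N t <= 1.
Proof.
rewrite rampE; have /andP[a0 a1] := ramp_base s N t.
have h : 0 <= 1 - (1 - sin ((t - s) / N.+1%:R)) ^+ (N.+1 ^ 2) / 2 ^+ (N.+1 ^ 2) <= 1.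
  by apply/andP; split; lra.
by case/andP: h => h0 h1; rewrite exprn_ge0//= exprn_ile1.
Qed.

Lemma Bernoulli_ge (x : R) n : 0 <= x <= 1 -> 1 - n%:R * x <= (1 - x) ^+ n.
Proof.
move=> /andP[x0 x1]; elim: n => [|n IH]; first by rewrite mul0r subr0.
rewrite exprS; apply: le_trans (ler_wpM2l _ IH); last by rewrite subr_ge0.
rewrite -natr1; have : 0 <= n%:R * x * x by rewrite !mulr_ge0.
by move: (n%:R : R) => m; nra.
Qed.

Lemma Bernoulli_le (x : R) n : 0 <= x <= 1 -> (1 - x) ^+ n <= (1 + n%:R * x)^-1.
Proof.
move=> /andP[x0 x1]; apply: (@le_trans _ _ (expR (- x) ^+ n)).
  by apply: lerXn2r; rewrite ?nnegrE ?subr_ge0 ?expR_ge0// expR_ge1Dx.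
rewrite -expRM_natl mulrN expRN lef_pV2 ?posrE ?expR_gt0 ?expR_ge1Dx//.
by rewrite ltr_pwDl// mulr_ge0.
Qed.

Lemma ramp_scale (s : R) N t (r := 1 - sin ((t - s) / N.+1%:R)) :
  (2 ^ (N.+1 ^ 2))%:R * (r ^+ (N.+1 ^ 2) / 2 ^+ (N.+1 ^ 2)) = r ^+ (N.+1 ^ 2).
Proof. by rewrite natrX mulrCA mulfV ?mulr1// expf_neq0. Qed.

Lemma cvg_inv_affine (a b : R) : 0 < a -> 0 < b ->
  (a + b * N.+1%:R)^-1 @[N --> \oo] --> (0 : R).
Proof.
move=> a0 b0.
have h : (b^-1 * N.+1%:R^-1) @[N --> \oo] --> (0 : R).
  by rewrite -[X in _ --> X](mulr0 b^-1); apply: cvgMr; exact: cvg_harmonic.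
apply: (squeeze_cvgr _ (cvg_cst 0) h); apply: nearW => N.
have N0 : 0 < N.+1%:R :> R by rewrite ltr0n.
have bN : 0 < b * N.+1%:R by rewrite mulr_gt0.
rewrite invr_ge0 ltW ?addr_gt0//= -invfM lef_pV2 ?posrE ?addr_gt0//.
  by rewrite lerDr ltW.
Qed.

Lemma near_small (u d : R) : 0 < d -> \forall N \near \oo, u / N.+1%:R < d.
Proof.
move=> d0; have h : (u * N.+1%:R^-1) @[N --> \oo] --> (0 : R).
  by rewrite -[X in _ --> X](mulr0 u); apply: cvgMr; exact: cvg_harmonic.
have /cvgrPdist_lt /(_ _ d0) := h; apply: filterS => N; rewrite sub0r normrN.
by apply: le_lt_trans; exact: ler_norm.
Qed.

(** Bernoulli gives the lower bound [1 - r^K], and [r <= e^{-u/2}] with [u = (t - s) / (N+1)] yields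
    [r^K <= 1 / (1 + (N+1) (t - s) / 2)]. *)
Lemma cvg_ramp_gt (s t : R) : s < t -> ramp s N t @[N --> \oo] --> (1 : R).
Proof.
move=> st; have [d d0 sind] := sin_ge_half.
have u0 : 0 < t - s by rewrite subr_gt0.
have u2 : 0 < (t - s) / 2 by rewrite divr_gt0.
have h := @cvg_inv_affine 1 ((t - s) / 2) ltr01 u2.
have h1 : (1 - (1 + (t - s) / 2 * N.+1%:R)^-1) @[N --> \oo] --> (1 : R).
  by rewrite -[X in _ --> X]subr0; apply: cvgB => //; exact: cvg_cst.
apply: (squeeze_cvgr _ h1 (cvg_cst (1 : R))); near=> N.
have ud : (t - s) / N.+1%:R < d by near: N; exact: near_small.
have /andP[_ ->] := ramp_itv s N t; rewrite andbT rampE.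
apply: le_trans (Bernoulli_ge _ (ramp_base s N t)).
rewrite ramp_scale lerB//.
have N0 : 0 < N.+1%:R :> R by rewrite ltr0n.
set u := (t - s) / N.+1%:R.
have uu : u / 2 <= sin u.
  by apply: sind => //; rewrite divr_ge0// ltW.
have ru : 1 - sin u <= expR (- (u / 2)).
  by apply: le_trans (expR_ge1Dx _); rewrite lerB.
apply: (@le_trans _ _ (expR (- (u / 2)) ^+ (N.+1 ^ 2))).
  by apply: lerXn2r; rewrite ?nnegrE ?subr_ge0 ?sin_le1 ?expR_ge0.
rewrite -expRM_natl mulrN expRN lef_pV2 ?posrE ?expR_gt0//; last first.
  by rewrite ltr_pwDl// mulr_ge0// ltW.
have -> : (N.+1 ^ 2)%:R * (u / 2) = (t - s) / 2 * N.+1%:R.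
  by rewrite /u natrX; field; rewrite lt0r_neq0.
exact: expR_ge1Dx.
Unshelve. all: by end_near. Qed.

(** The ramp is at most [1 / (1 + r^K)], where now [r >= 1 + u/2] with [u = (s - t) / (N+1)], so
    [r^K] grows at least linearly in [N]. *)
Lemma cvg_ramp_lt (s t : R) : t < s -> ramp s N t @[N --> \oo] --> (0 : R).
Proof.
move=> ts; have [d d0 sind] := sin_ge_half.
have u0 : 0 < s - t by rewrite subr_gt0.
have u2 : 0 < (s - t) / 2 by rewrite divr_gt0.
(* The 2 is the 1 of [1 + r^K] plus the constant term of the lower bound for [r^K]. *)
have h := @cvg_inv_affine 2 ((s - t) / 2) ltac:(by []) u2.
apply: (squeeze_cvgr _ (cvg_cst 0) h); near=> N.
have ud : (s - t) / N.+1%:R < d by near: N; exact: near_small.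
have /andP[-> _] := ramp_itv s N t; rewrite rampE /=.
apply: (le_trans (Bernoulli_le _ (ramp_base s N t))).
rewrite ramp_scale.
have N0 : 0 < N.+1%:R :> R by rewrite ltr0n.
pose u := (s - t) / N.+1%:R.
have -> : (t - s) / N.+1%:R = - u by rewrite /u -mulNr opprB.
rewrite sinN opprK.
have uu : u / 2 <= sin u.
  by apply: sind => //; rewrite divr_ge0// ltW.
have ub : 0 <= u / 2 by rewrite !divr_ge0// ltW.
have B : 1 + (s - t) / 2 * N.+1%:R <= (1 + u / 2) ^+ (N.+1 ^ 2).
  have -> : (s - t) / 2 * N.+1%:R = (N.+1 ^ 2)%:R * (u / 2).
    by rewrite /u natrX; field; rewrite lt0r_neq0.
  elim: (N.+1 ^ 2)%N => [|n IH]; first by rewrite mul0r addr0.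
  rewrite exprS; apply: le_trans (ler_wpM2l _ IH); last exact: addr_ge0.
  move: (u / 2) ub => w w0.
  rewrite -natr1; have : 0 <= n%:R * w * w by rewrite !mulr_ge0.
  by move: (n%:R : R) => m; nra.
have B2 : (1 + u / 2) ^+ (N.+1 ^ 2) <= (1 + sin u) ^+ (N.+1 ^ 2).
  by apply: lerXn2r; rewrite ?nnegrE ?lerD2l//; lra.
have p0 : 0 < (s - t) / 2 * N.+1%:R by rewrite mulr_gt0.
rewrite lef_pV2 ?posrE; lra.
Unshelve. all: by end_near. Qed.

Section MomentUniqueness.
Variable v : R -> R.
Hypothesis iv : forall c, Rint (fun t => v t * expR (c * `|t|)).
Hypothesis v0 : forall n, \int[mu]_t (v t * t ^+ n) = 0.

Let Rint_v : Rint v.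
Proof.
have := iv 0; congr (_.-integrable _ _).
by apply/funext => t /=; rewrite mul0r expR0 mulr1.
Qed.

(** Each [1 - ramp s N] is a limit of polynomials, hence annihilated; these functions lie in
    [[0, 1]] and converge to the indicator of the half-line off the single point [s]. *)
Let tail0 (s : R) : \int[mu]_(t in `]-oo, s]) v t = 0.
Proof.
rewrite Rintegral_mkcond.
have mv := Rint_meas Rint_v.
have mramp N : measurable_fun setT (ramp s N).
  have [p [C [c [_ _ _ cp]]]] := poly_limit_ramp s N.
  apply: (@measurable_fun_cvg _ _ _ setT (fun N => horner (p N))).
    by move=> M; apply: continuous_measurable_fun; exact: continuous_horner.
  by move=> t _; exact: cp.
have [|||||_ cv] := @Rint_dominated_convergence _
  (fun N t => v t * (1 - ramp s N t)) (v \_ `]-oo, s]) (fun t => `|v t|).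
- by move=> N; apply: measurable_funM => //; exact: measurable_funB.
- apply/(measurable_restrictT _ _).1; first exact: measurable_itv.
  exact: measurable_funTS.
- have : {ae mu, forall t : R, t != s}.
    exists [set s]; split => //; first exact: lebesgue_measure_set1.
    by move=> t /= /negP; rewrite negbK => /eqP.
  move=> /ae_imp; apply => t; rewrite neq_lt => /orP[ts|st].
    rewrite patchE mem_set /=; last by rewrite in_itv /= ltW.
    rewrite -[X in _ --> X]mulr1; apply: cvgMr.
    by rewrite -[X in _ --> X]subr0; apply: cvgB;
      [exact: cvg_cst|exact: cvg_ramp_lt].
  rewrite patchE memNset /=; last by rewrite in_itv /= leNgt st.
  rewrite -[X in _ --> X](mulr0 (v t)); apply: cvgMr.
  by rewrite -[X in _ --> X](subrr 1); apply: cvgB;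
    [exact: cvg_cst|exact: cvg_ramp_gt].
- exact: Rint_norm.
- move=> N t; have /andP[r0 r1] := ramp_itv s N t.
  by rewrite normrM ler_piMr// ger0_norm ?subr_ge0//; lra.
have e : (fun N => \int[mu]_t (v t * (1 - ramp s N t))) = (fun=> 0).
  apply/funext => N; apply: poly_limit_orthogonal => //.
  have := poly_limit_affine 1 (-1) (poly_limit_ramp s N).
  by under eq_fun do rewrite mulN1r.
by rewrite e in cv; exact: (cvg_unique _ cv (cvg_cst 0)).
Qed.

(** By Lebesgue differentiation [v] is almost everywhere the derivative of its integral over
    half-lines, which is identically zero. *)
Theorem moments_unique : {ae mu, forall t, v t = 0}.
Proof.
have iy y : mu.-integrable `]-oo, y] (EFin \o v).
  by apply: integrableS Rint_v.
have lv : locally_integrable [set: R] v.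
  by have := integrable_locally measurableT Rint_v; rewrite patch_setT.
have := FTC1Ny iy lv.
move=> /ae_imp; apply => t [_]; rewrite derive1E => <-.
rewrite (_ : (fun x => _) = cst 0) ?derive_cst//.
by apply/funext => x; exact: tail0.
Qed.

End MomentUniqueness.

End PolynomialLimits.

(** * Completeness of the space of square-integrable functions *)

Section RieszFischer.
Context {R : realType}.
Notation mu := (@lebesgue_measure R).
Implicit Types (g : (R -> R)^nat).

(* [4^k (g_(k+1) - g_k)^2] is summable a.e., hence [|g_(k+1) - g_k| = O(2^-k)]. *)
Lemma rapidly_L2_Cauchy_ae_cvg g : (forall k, measurable_fun setT (g k)) ->
  (forall k, \int[mu]_t ((g k.+1 t - g k t) ^+ 2)%:E <= (8^-1 ^+ k)%:E)%E ->
  {ae mu, forall t, cvgn (g ^~ t)}.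
Proof.
move=> mg dg.
pose d k t : R := 4 ^+ k * (g k.+1 t - g k t) ^+ 2.
have d0 k t : 0 <= d k t by rewrite mulr_ge0 ?sqr_ge0 ?exprn_ge0.
have md k : measurable_fun setT (d k).
  by apply: measurable_funM => //; apply: measurable_funX; exact: measurable_funB.
pose W t := (\sum_(k <oo) (d k t)%:E)%E.
have intd k : (\int[mu]_t (d k t)%:E <= (2^-1 ^+ k)%:E)%E.
  rewrite (_ : (fun t => (d k t)%:E) =
      (fun t => ((4 ^+ k)%:E * ((g k.+1 t - g k t) ^+ 2)%:E)%E)); last first.
    by apply/funext => t; rewrite -EFinM.
  have h1 : measurable_fun setT (fun t => ((g k.+1 t - g k t) ^+ 2)%:E).
    apply/measurable_EFinP; apply: measurable_funX.
    exact: (measurable_funB (mg k.+1) (mg k)).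
  have h2 t : setT t -> (0 <= ((g k.+1 t - g k t) ^+ 2)%:E)%E.
    by move=> _; rewrite lee_fin sqr_ge0.
  have h3 : (0 <= (4 ^+ k : R)%:E)%E by rewrite lee_fin exprn_ge0.
  rewrite (ge0_integralZl mu measurableT h1 h2 h3).
  rewrite (_ : 2^-1 ^+ k = 4 ^+ k * 8^-1 ^+ k :> R); last first.
    by rewrite -exprMn; congr (_ ^+ _); field.
  by rewrite EFinM lee_wpmul2l.
have mW : measurable_fun setT W.
  by apply: ge0_emeasurable_sum => [k t _ _|k _];
    [rewrite lee_fin | apply/measurable_EFinP; exact: md].
have W0 t : (0 <= W t)%E by apply: nneseries_ge0 => k _ _; rewrite lee_fin.
have iW : mu.-integrable setT W.
  apply/integrableP; split => //.
  under eq_integral do rewrite gee0_abs//.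
  have h1 k : measurable_fun setT (fun t => (d k t)%:E).
    by apply/measurable_EFinP; exact: md.
  have h2 k t : setT t -> (0 <= (d k t)%:E)%E by move=> _; rewrite lee_fin.
  rewrite (integral_nneseries mu measurableT h1 h2).
  apply: (@le_lt_trans _ _ (\sum_(k <oo) (2^-1 ^+ k)%:E)%E).
    apply: lee_nneseries => [k _ _|k _]; last exact: intd.
    by apply: integral_ge0 => t _; rewrite lee_fin.
  have : series (geometric 1 2^-1) @ \oo --> (1 * (1 - 2^-1)^-1 : R).
    by apply: cvg_geometric_series; rewrite ger0_norm ?invr_ge0//; lra.
  move=> h.
  rewrite (_ : (\sum_(k <oo) _)%E = (1 * (1 - 2^-1)^-1)%:E) ?ltry//.
  apply/cvg_lim => //.
  rewrite (_ : (fun n => _) = EFin \o series (geometric 1 2^-1)).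
    by apply: cvg_EFin; [exact: nearW | exact: h].
  apply/funext => n; rewrite /series /= sumEFin; congr EFin.
  by apply: eq_bigr => k _; rewrite mul1r.
have := integrable_ae measurableT iW.
move=> /ae_imp; apply => t /(_ I) Wt.
pose w := fine (W t).
have dw k : d k t <= w.
  rewrite -lee_fin /w fineK// /W.
  apply: (le_trans _ (nneseries_lim_ge k.+1 _)); last by move=> i _; rewrite lee_fin.
  rewrite big_mkord big_ord_recr /= leeDr// sume_ge0// => i _.
  by rewrite lee_fin.
have gk k : `|g k.+1 t - g k t| <= geometric (Num.sqrt w) 2^-1 k.
  rewrite /geometric /= -sqrtr_sqr.
  have -> : 2^-1 ^+ k = Num.sqrt (4^-1 ^+ k) :> R.
    rewrite (_ : 4^-1 = 2^-1 ^+ 2 :> R); last by field.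
    by rewrite exprAC sqrtr_sqr ger0_norm// exprn_ge0// invr_ge0.
  have w0 : 0 <= w by rewrite fine_ge0.
  rewrite -sqrtrM// ler_sqrt; last by rewrite mulr_ge0// exprn_ge0// invr_ge0.
  by rewrite exprVn ler_pdivlMr ?exprn_gt0// mulrC; exact: dw.
have cs : cvgn (series (fun k => g k.+1 t - g k t)).
  apply: normed_cvg; apply: (@series_le_cvg _ _ (geometric (Num.sqrt w) 2^-1)).
  - by move=> k /=.
  - by move=> k; rewrite geometric_ge0 ?sqrtr_ge0 ?invr_ge0.
  - exact: gk.
  - by apply: is_cvg_geometric_series; rewrite ger0_norm ?invr_ge0//; lra.
rewrite (_ : g ^~ t = (fun n => g 0 t + series (fun k => g k.+1 t - g k t) n)).
  by apply: is_cvgD => //; exact: is_cvg_cst.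
by apply/funext => n; rewrite [LHS](eq_sum_telescope (g ^~ t) n).
Qed.

(** A rapidly Cauchy subsequence converges almost everywhere, and Fatou's lemma upgrades this to
    convergence in norm of the whole sequence. *)
Lemma Riesz_Fischer g : (forall k, measurable_fun setT (g k)) ->
  (forall e : R, 0 < e -> exists N, forall m n, (N <= m)%N -> (N <= n)%N ->
    (\int[mu]_t ((g m t - g n t) ^+ 2)%:E <= e%:E)%E) ->
  exists2 G : R -> R, measurable_fun setT G &
  forall e : R, 0 < e -> exists N, forall n, (N <= n)%N ->
    (\int[mu]_t ((G t - g n t) ^+ 2)%:E <= e%:E)%E.
Proof.
move=> mg cg.
have [phi hphi] : {phi : nat -> nat & forall k m n,
    (phi k <= m)%N -> (phi k <= n)%N ->
    (\int[mu]_t ((g m t - g n t) ^+ 2)%:E <= (8^-1 ^+ k)%:E)%E}.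
  apply: (@choice _ _ (fun k N => forall m n, (N <= m)%N -> (N <= n)%N ->
    (\int[mu]_t ((g m t - g n t) ^+ 2)%:E <= (8^-1 ^+ k)%:E)%E)) => k.
  by apply: cg; rewrite exprn_gt0// invr_gt0.
(* A monotone choice of indices that dominates both [phi] and the identity. *)
pose M k := (\sum_(i < k.+1) (phi i).+1)%N.
have phiM k : (phi k <= M k)%N.
  by rewrite /M big_ord_recr /= (leq_trans (leqnSn _))// leq_addl.
have kM k : (k <= M k)%N.
  elim: k => // k IH; rewrite /M big_ord_recr /= addnS ltnS.
  by rewrite (leq_trans IH)// leq_addr.
have MS k : (M k <= M k.+1)%N by rewrite /M [leqRHS]big_ord_recr /= leq_addr.
have ae_cvg : {ae mu, forall t, cvgn (fun k => g (M k) t)}.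
  apply: (@rapidly_L2_Cauchy_ae_cvg (fun k => g (M k))) => // k.
  by apply: hphi; rewrite ?phiM// (leq_trans (phiM k)).
(* The upper limit is measurable everywhere and agrees with the limit wherever the latter exists. *)
pose G t := fine (limn_esup (fun k => (g (M k) t)%:E)).
have mG : measurable_fun setT G.
  apply: (@measurableT_comp _ _ _ _ _ _ fine) => //.
  apply: measurable_fun_limn_esup => k.
  by apply/measurable_EFinP; exact: mg.
exists G => // e e0; have [N hN] := cg _ e0; exists N => n Nn.
apply: (@le_trans _ _ (\int[mu]_t
    limn_einf (fun k => ((g (M k) t - g n t) ^+ 2)%:E))%E).
  rewrite le_eqVlt; apply/orP; left; apply/eqP.
  apply: ae_eq_integral => //.
  - apply/measurable_EFinP; apply: measurable_funX.
    exact: (measurable_funB mG (mg n)).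
  - rewrite /limn_einf; apply: measurableT_comp => //.
    apply: measurable_fun_limn_esup => k; apply: measurableT_comp => //.
    apply/measurable_EFinP; apply: measurable_funX.
    exact: (measurable_funB (mg (M k)) (mg n)).
  - apply: (ae_imp ae_cvg) => t /cvg_ex[l gl] _.
    have el : (g (M k) t)%:E @[k --> \oo] --> l%:E.
      by apply: cvg_EFin; [exact: nearW | exact: gl].
    have -> : G t = l by rewrite /G (cvg_limn_einf_sup el).2.
    apply/esym; have el2 : ((g (M k) t - g n t) ^+ 2)%:E @[k --> \oo] -->
        ((l - g n t) ^+ 2)%:E.
      apply: cvg_EFin; first exact: nearW.
      by rewrite /comp /=; apply: cvgM; apply: cvgB => //; exact: cvg_cst.
    by rewrite (cvg_limn_einf_sup el2).1.
apply: (le_trans (fatou _ _ _ _)) => //.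
- move=> k; apply/measurable_EFinP; apply: measurable_funX.
  exact: (measurable_funB (mg (M k)) (mg n)).
- by move=> k t _; rewrite lee_fin sqr_ge0.
rewrite limn_einf_lim; apply: lime_le; first exact: is_cvg_einfs.
apply: nearW => k; apply: (@le_trans _ _
    (\int[mu]_t ((g (M (maxn k N)) t - g n t) ^+ 2)%:E)%E).
  by apply: ereal_inf_lbound; exists (maxn k N) => //=; exact: leq_maxl.
by apply: hN => //; rewrite (leq_trans _ (kM _))// leq_maxr.
Qed.

End RieszFischer.

(** * Expansion in Hermite functions *)

Section HermiteBasis.
Context {R : realType}.
Notation mu := (@lebesgue_measure R).
Notation Rint h := (mu.-integrable setT (EFin \o h)).
Notation e_ := (chermite : nat -> R -> R[i]).
Implicit Types (f : R -> R[i]) (c : nat -> R[i]).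

Lemma cint_L2_gauss f (a c : R) : 0 < a -> L2 f ->
  cint (fun t => f t * (expR (c * `|t|) * expR (- a * t ^+ 2))%:C).
Proof.
move=> a0 fi; apply: cint_L2M => //; apply/L2P.
have mg : measurable_fun setT (fun t : R => expR (c * `|t|) * expR (- a * t ^+ 2)).
  exact: Rint_meas (Rint_exp_gauss c a0).
split; first exact: cmeas_real.
rewrite (_ : (fun t => _) = (fun t => expR ((2 * c) * `|t|) * expR (- (2 * a) * t ^+ 2))).
  by apply: Rint_exp_gauss; rewrite mulr_gt0.
apply/funext => t; rewrite cmod_real ger0_norm ?mulr_ge0 ?expR_ge0//.
by rewrite expr2 -!expRD; congr expR; ring.
Qed.

(** Makes completeness applicable to Fourier transforms of integrable functions, bounded but not yet
    known to be in [L2]. *)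
Lemma cint_bounded_gauss f (C a c : R) : 0 < a -> cmeas f ->
  (forall t, cmod (f t) <= C) ->
  cint (fun t => f t * (expR (c * `|t|) * expR (- a * t ^+ 2))%:C).
Proof.
move=> a0 mf fC; apply: (cint_dom _ (RintZ C (Rint_exp_gauss c a0))).
  apply: cmeasM => //; apply: cmeas_real.
  exact: Rint_meas (Rint_exp_gauss c a0).
move=> t; rewrite cmodM cmod_real ger0_norm ?mulr_ge0 ?expR_ge0//.
by rewrite ler_wpM2r ?mulr_ge0 ?expR_ge0.
Qed.

(** The three-term recurrence trades a factor [t] for the two neighbouring Hermite indices.
    Induction on the power, for all indices at once, starts from orthogonality to the Hermite
    functions and reaches the plain moments at index 0. *)
Lemma hermite_moments f :
  (forall c : R, cint (fun t => f t * (expR (c * `|t|) * expR (- pi * t ^+ 2))%:C)) ->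
  cmeas f -> (forall n, cintegral (fun t => f t * e_ n t) = 0) ->
  forall k, cintegral (fun t => f t * (t ^+ k * expR (- pi * t ^+ 2))%:C) = 0.
Proof.
move=> fi mf f0.
pose H n k t : R[i] := (hpoly ((4 * pi)%:C : R[i]) n).[t%:C] *
  (t ^+ k * expR (- pi * t ^+ 2))%:C.
have iX k : cint (fun t => f t * (t ^+ k * expR (- pi * t ^+ 2))%:C).
  apply: (cint_dom _ (RintZ k`!%:R (cint_cmod (fi 1)))).
    apply: cmeasM => //; apply: cmeas_real; apply: Rint_meas.
    by apply: Rint_mono_gauss; exact: pi_gt0.
  move=> t; rewrite !cmodM !cmod_real [leRHS]mulrCA ler_wpM2l ?cmod_ge0//.
  rewrite !normrM !(ger0_norm (expR_ge0 _)) [leRHS]mulrA ler_wpM2r ?expR_ge0//.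
  by rewrite mul1r normX_le_exp.
have iH n k : cint (fun t => f t * H n k t).
  rewrite /H; elim/poly_ind: (hpoly _ n) k => [|p d IH] k.
    by under [in X in cint X]eq_fun do rewrite horner0 mul0r mulr0; exact: cint0.
  rewrite (_ : (fun t => _) = (fun t =>
    f t * (p.[t%:C] * (t ^+ k.+1 * expR (- pi * t ^+ 2))%:C) +
    d * (f t * (t ^+ k * expR (- pi * t ^+ 2))%:C))); last first.
    apply/funext => t; rewrite hornerMXaddC (exprS t k).
    by rewrite !(rmorphM (real_complex R)) /=; ring.
  by apply: cintD => //; exact: cintZ.
suff H0 k n : cintegral (fun t => f t * H n k t) = 0.
  move=> k; rewrite -[RHS](H0 k 0%N); congr cintegral; apply/funext => t.
  by rewrite /H hornerC mul1r.
elim: k n => [|k IH] n.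
  have hn0 : (hnorm n)%:C != 0 :> R[i].
    rewrite fmorph_eq0; apply/eqP => h; have := @hnorm_sqr R n.
    by rewrite h expr0n mul0r => /eqP; rewrite lt_eqF// sqrtr_gt0.
  apply: (mulfI hn0); rewrite mulr0 -cintegralZ//.
  rewrite -[RHS](f0 n); congr cintegral; apply/funext => t.
  by rewrite chermiteE /H expr0 mul1r; ring.
have c0 : (4 * pi)%:C != 0 :> R[i].
  by rewrite fmorph_eq0 mulf_neq0// gt_eqF// pi_gt0.
apply: (mulfI c0); rewrite mulr0 -cintegralZ//.
rewrite (_ : (fun t => _) = (fun t => -1 * (f t * H n.+1 k t) +
    (- ((4 * pi)%:C * n%:R)) * (f t * H n.-1 k t))).
  by rewrite cintegralD ?cintegralZ// ?IH ?mulr0 ?addr0//; exact: cintZ.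
apply/funext => t; rewrite /H (exprS t k) (hpoly_3term _ n).
move: (hpoly _ n) (hpoly _ n.-1) => p q.
rewrite hornerD hornerN !hornerZ hornerM hornerX.
by rewrite !(rmorphM (real_complex R)) /=; ring.
Qed.

(** Multiplied by the Gaussian, the real and imaginary parts of [f] have vanishing moments and are
    integrable against every exponential, so [moments_unique] applies to each. *)
Theorem hermite_complete f :
  (forall c : R, cint (fun t => f t * (expR (c * `|t|) * expR (- pi * t ^+ 2))%:C)) ->
  cmeas f -> (forall n, cintegral (fun t => f t * e_ n t) = 0) ->
  {ae mu, forall t, f t = 0}.
Proof.
move=> fi mf f0; have h := hermite_moments fi mf f0.
have re0 : {ae mu, forall t, Re (f t) * expR (- pi * t ^+ 2) = 0}.
  apply: moments_unique => [c|k].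
    have [+ _] := fi c; congr (_.-integrable _ (_ \o _)).
    by apply/funext => t; rewrite ReM /= mulr0 subr0; ring.
  have /(congr1 (@complex.Re R)) := h k; rewrite /= => <-.
  by apply: eq_Rintegral => t _; rewrite ReM /= mulr0 subr0; ring.
have im0 : {ae mu, forall t, Im (f t) * expR (- pi * t ^+ 2) = 0}.
  apply: moments_unique => [c|k].
    have [_ +] := fi c; congr (_.-integrable _ (_ \o _)).
    by apply/funext => t; rewrite ImM /= mulr0 add0r; ring.
  have /(congr1 (@complex.Im R)) := h k; rewrite /= => <-.
  by apply: eq_Rintegral => t _; rewrite ImM /= mulr0 add0r; ring.
apply: (@filterS2 _ _ (ae_filter_ringOfSetsType mu) _ _ _ _ re0 im0) => t.
have e0 : expR (- pi * t ^+ 2) != 0 :> R by rewrite gt_eqF// expR_gt0.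
move=> /eqP; rewrite mulf_eq0 (negbTE e0) orbF => /eqP hr.
move=> /eqP; rewrite mulf_eq0 (negbTE e0) orbF => /eqP hi.
exact: eq_ReIm.
Qed.

Definition hcoef f n := inner f (e_ n).

Definition hsum c N (t : R) := \sum_(n < N) c n * e_ n t.

Lemma L2_hsum c N : L2 (hsum c N).
Proof. by apply: L2_sum => n; apply: L2Z; exact: L2_chermite. Qed.

Lemma inner_hsum c N f : L2 f ->
  inner (hsum c N) f = \sum_(n < N) c n * inner (e_ n) f.
Proof.
move=> fi; rewrite inner_suml//; last by move=> n; exact/L2Z/L2_chermite.
by apply: eq_bigr => n _; rewrite innerZl//; exact: L2_chermite.
Qed.

Lemma hcoef_hsum c N n : hcoef (hsum c N) n = if (n < N)%N then c n else 0.
Proof.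
rewrite /hcoef inner_hsum; last exact: L2_chermite.
case: ifPn => nN.
  rewrite (bigD1 (Ordinal nN))//= inner_chermite eqxx mulr1 big1 ?addr0// => i.
  by rewrite -val_eqE /= inner_chermite => /negbTE ->; rewrite mulr0.
apply: big1 => i _; rewrite inner_chermite.
by rewrite (negbTE (_ : val i != n)) ?mulr0//; apply: contraNneq nN => <-; exact: ltn_ord.
Qed.

Lemma nrm2_hsum c N : nrm2 (hsum c N) = \sum_(n < N) cmod (c n) ^+ 2.
Proof.
apply: (@complexI R); rewrite -inner_nrm2; last exact: L2_hsum.
rewrite inner_hsum; last exact: L2_hsum.
rewrite rmorph_sum; apply: eq_bigr => n _.
rewrite innerC; [|exact: L2_hsum|exact: L2_chermite].
by rewrite -/(hcoef _ _) hcoef_hsum ltn_ord mulJ_cmod.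
Qed.

Lemma nrm2_hsumB c M N : (M <= N)%N ->
  nrm2 (fun t => hsum c N t - hsum c M t) =
  \sum_(n < N) cmod (c n) ^+ 2 - \sum_(n < M) cmod (c n) ^+ 2.
Proof.
move=> MN; pose c' n := if (n < M)%N then 0 else c n.
have -> : (fun t => hsum c N t - hsum c M t) = hsum c' N.
  apply/funext => t; rewrite /hsum.
  rewrite (big_ord_widen N (fun n => c n * chermite n t) MN) [X in _ - X]big_mkcond.
  rewrite -sumrB; apply: eq_bigr => n _; rewrite /c'.
  by case: ifP => _; rewrite ?subrr ?subr0 ?mul0r.
rewrite nrm2_hsum (big_ord_widen N (fun n => cmod (c n) ^+ 2) MN) [X in _ = _ - X]big_mkcond.
rewrite -sumrB; apply: eq_bigr => n _; rewrite /c'.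
by case: ifP => _; rewrite ?subrr ?subr0 ?cmod0 ?expr0n.
Qed.

Lemma nrm2_sub_hsum f N : L2 f ->
  nrm2 (fun t => f t - hsum (hcoef f) N t) =
  nrm2 f - \sum_(n < N) cmod (hcoef f n) ^+ 2.
Proof.
move=> fi; have si := L2_hsum (hcoef f) N.
apply: (@complexI R); rewrite -inner_nrm2; last exact: L2B.
rewrite innerBl//; last exact: L2B.
rewrite !innerBr// !inner_nrm2// nrm2_hsum.
have e : inner (hsum (hcoef f) N) f = (\sum_(n < N) cmod (hcoef f n) ^+ 2)%:C.
  rewrite inner_hsum// rmorph_sum; apply: eq_bigr => n _.
  by rewrite innerC//; [rewrite mulJ_cmod | exact: L2_chermite].
rewrite innerC// e rmorphB; set S := \sum_(n < N) _.
have -> : (S%:C)^* = S%:C by apply: eq_ReIm; rewrite ?ReJ ?ImJ //= oppr0.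
by rewrite subrr subr0.
Qed.

Lemma Bessel f N : L2 f -> \sum_(n < N) cmod (hcoef f n) ^+ 2 <= nrm2 f.
Proof. by move=> fi; rewrite -subr_ge0 -nrm2_sub_hsum// nrm2_ge0. Qed.

Lemma cvg_sqrt0 (u : nat -> R) : u @ \oo --> (0 : R) ->
  Num.sqrt (u n) @[n --> \oo] --> (0 : R).
Proof.
move=> cu; rewrite -[X in _ --> X]sqrtr0.
by apply: (@cvg_comp _ _ _ u Num.sqrt _ _ _ cu); exact: sqrt_continuous.
Qed.

Lemma cvg_inner_dist (u : nat -> R -> R[i]) f h :
  (forall n, L2 (u n)) -> L2 f -> L2 h ->
  nrm2 (fun t => f t - u n t) @[n --> \oo] --> (0 : R) ->
  cmod (inner f h - inner (u n) h) @[n --> \oo] --> (0 : R).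
Proof.
move=> ui fi hi cu.
have cb : (2 * Num.sqrt (nrm2 h)) * Num.sqrt (nrm2 (fun t => f t - u n t))
    @[n --> \oo] --> (0 : R).
  rewrite -[X in _ --> X](mulr0 (2 * Num.sqrt (nrm2 h))).
  by apply: cvgMr; exact: cvg_sqrt0.
apply: (squeeze_cvgr _ (cvg_cst 0) cb); apply: nearW => n.
rewrite cmod_ge0 /=.
have -> : inner f h - inner (u n) h = inner (fun t => f t - u n t) h.
  by rewrite innerBl.
apply: (le_trans (cmod_inner_le (L2B fi (ui n)) hi)).
by rewrite le_eqVlt; apply/orP; left; apply/eqP; ring.
Qed.

Lemma cvg_cst_eq0 (x : R) (u : nat -> R) : u @ \oo --> (0 : R) ->
  (\forall n \near \oo, x = u n) -> x = 0.
Proof.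
move=> cu xu; apply: (cvg_unique _ _ cu) => //.
apply: cvg_near_cst; move: xu; apply: filterS => n ->//.
Qed.

(** The inner product is continuous, and the [n]-th coefficient of the partial sums is stationary
    from order [n.+1] on. *)
Lemma hcoef_lim c f : L2 f ->
  nrm2 (fun t => f t - hsum c n t) @[n --> \oo] --> (0 : R) ->
  forall n, hcoef f n = c n.
Proof.
move=> fi cf n; apply/eqP; rewrite -subr_eq0; apply/eqP/cmod_eq0.
have h := cvg_inner_dist (L2_hsum c) fi (L2_chermite n) cf.
apply: (cvg_cst_eq0 h); exists n.+1 => // m /= nm.
by rewrite -/(hcoef _ _) -/(hcoef (hsum c m) n) hcoef_hsum nm.
Qed.

(** By orthonormality, distances between partial sums are differences of a bounded monotone
    sequence, so the partial sums are Cauchy. The real form of Riesz-Fischer is applied to both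
    parts. *)
Lemma hermite_series_cvg c (M : R) :
  (forall N, \sum_(n < N) cmod (c n) ^+ 2 <= M) ->
  exists2 F, L2 F &
    nrm2 (fun t => F t - hsum c n t) @[n --> \oo] --> (0 : R).
Proof.
move=> cM; pose S N := \sum_(n < N) cmod (c n) ^+ 2.
have SS : nondecreasing_seq S.
  by apply/nondecreasing_seqP => n; rewrite /S big_ord_recr /= lerDl sqr_ge0.
have cS : cvgn S.
  by apply: nondecreasing_is_cvgn => //; exists M => _ [N _ <-]; exact: cM.
have Cauchy (e : R) : 0 < e -> exists N, forall m n, (N <= m)%N -> (N <= n)%N ->
    nrm2 (fun t => hsum c m t - hsum c n t) <= e.
  move=> e0; have /cvgrPdist_le /(_ _ e0) [N _ hN] := cS.
  exists N => m n Nm Nn.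
  have key k l : (N <= k)%N -> (k <= l)%N ->
      nrm2 (fun t => hsum c l t - hsum c k t) <= e.
    move=> Nk kl; rewrite nrm2_hsumB// -!/(S _).
    have h1 := hN k Nk; rewrite /= in h1.
    have h2 := nondecreasing_cvgn_le SS cS l.
    have h3 := nondecreasing_cvgn_le SS cS k.
    by move: h1; rewrite ger0_norm ?subr_ge0//; lra.
  have [mn|nm] := leqP m n; last by apply: key => //; exact: ltnW.
  rewrite (_ : nrm2 _ = nrm2 (fun t => hsum c n t - hsum c m t)); first exact: key.
  by apply: eq_Rintegral => t _; rewrite -cmodN opprB.
have si := L2_hsum c.
have msi n : cmeas (hsum c n) := L2_meas (si n).
(* Treats [Re] and [Im] together: an additive part dominated by the modulus inherits the Cauchy
   property. *)
have le_part (p : R[i] -> R) : (forall z w, p (z - w) = p z - p w) ->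
    (forall z, `|p z| <= cmod z) -> (forall n, measurable_fun setT (p \o hsum c n)) ->
    forall e : R, 0 < e -> exists N, forall m n, (N <= m)%N -> (N <= n)%N ->
    (\int[mu]_t (((p \o hsum c m) t - (p \o hsum c n) t) ^+ 2)%:E <= e%:E)%E.
  move=> pB pc mp e e0; have [N hN] := Cauchy e e0; exists N => m n Nm Nn.
  have := hN m n Nm Nn; rewrite -lee_fin -nrm2E; last exact: L2B.
  rewrite L2norm_sqr; apply: le_trans; apply: ge0_le_integral => //.
  - by move=> t _; rewrite lee_fin sqr_ge0.
  - apply/measurable_EFinP; apply: measurable_funX.
    exact: (measurable_funB (mp m) (mp n)).
  - apply/measurable_EFinP/measurable_funX/measurable_cmod.
    exact: L2_meas (L2B (si m) (si n)).
  - move=> t _; rewrite lee_fin /= -pB -[leLHS]real_normK ?num_real//.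
    by apply: lerXn2r; rewrite ?nnegrE ?cmod_ge0.
have [F mF hF] := Riesz_Fischer (fun n => (msi n).1)
  (le_part (@complex.Re R) (fun z w => etrans (ReD _ _) (congr1 _ (ReN _)))
    Re_le_cmod (fun n => (msi n).1)).
have [G mG hG] := Riesz_Fischer (fun n => (msi n).2)
  (le_part (@complex.Im R) (fun z w => etrans (ImD _ _) (congr1 _ (ImN _)))
    Im_le_cmod (fun n => (msi n).2)).
pose H t : R[i] := Complex (F t) (G t).
have mH : cmeas H by [].
have mHs n : cmeas (fun t => H t - hsum c n t).
  have [a b] := msi n; split.
    by under eq_fun do rewrite ReD ReN; exact: measurable_funB.
  by under eq_fun do rewrite ImD ImN; exact: measurable_funB.
have hH (e : R) : 0 < e -> exists N, forall n, (N <= n)%N ->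
    (\int[mu]_t (cmod (H t - hsum c n t) ^+ 2)%:E <= e%:E)%E.
  move=> e0; have e20 : 0 < e / 2 by rewrite divr_gt0.
  have [N1 h1] := hF _ e20; have [N2 h2] := hG _ e20.
  exists (maxn N1 N2) => n; rewrite geq_max => /andP[n1 n2].
  rewrite (_ : (fun t => _) = (fun t => ((F t - Re (hsum c n t)) ^+ 2)%:E +
      ((G t - Im (hsum c n t)) ^+ 2)%:E)%E); last first.
    by apply/funext => t; rewrite cmod_sqr ReD ImD ReN ImN.
  have [a b] := msi n.
  rewrite ge0_integralD//; first last.
  - apply/measurable_EFinP; apply: measurable_funX.
    exact: (measurable_funB mG b).
  - by move=> t _; rewrite lee_fin sqr_ge0.
  - apply/measurable_EFinP; apply: measurable_funX.
    exact: (measurable_funB mF a).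
  - by move=> t _; rewrite lee_fin sqr_ge0.
  rewrite (_ : e = e / 2 + e / 2); last by field.
  by rewrite EFinD leeD ?h1 ?h2.
have LHs n : (\int[mu]_t (cmod (H t - hsum c n t) ^+ 2)%:E < +oo)%E ->
    L2 (fun t => H t - hsum c n t).
  move=> fin; apply/L2P; split => //; apply/integrableP; split.
    apply/measurable_EFinP; apply: measurable_funX.
    exact: (measurable_cmod (mHs n)).
  by under eq_integral do rewrite gee0_abs ?lee_fin ?sqr_ge0//.
have LH : L2 H.
  have [N hN] := hH 1 ltr01.
  have L := LHs N (le_lt_trans (hN N (leqnn N)) (ltry _)).
  have := L2D L (si N); congr L2; apply/funext => t; exact: subrK.
exists H => //; apply/cvgrPdist_le => e e0; have [N hN] := hH e e0.
exists N => // n /= Nn; rewrite sub0r normrN ger0_norm ?nrm2_ge0//.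
by rewrite -lee_fin -nrm2E ?L2norm_sqr ?hN//; exact: L2B.
Qed.

(** The series converges to some [F] by Bessel; [F] has the coefficients of [f], so completeness
    identifies the two almost everywhere. *)
Lemma hermite_expansion f : L2 f ->
  nrm2 (fun t => f t - hsum (hcoef f) n t) @[n --> \oo] --> (0 : R).
Proof.
move=> fi; have [F Fi cF] := @hermite_series_cvg (hcoef f) (nrm2 f)
  (fun N => Bessel N fi).
have eqc := hcoef_lim Fi cF.
have ae0 : {ae mu, forall t, f t - F t = 0}.
  apply: hermite_complete; first by move=> c; apply: cint_L2_gauss (pi_gt0 R) (L2B fi Fi).
    exact: L2_meas (L2B fi Fi).
  move=> n; have := innerBl fi Fi (L2_chermite n).
  rewrite -/(hcoef f n) -/(hcoef F n) eqc subrr => <-.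
  by congr cintegral; apply/funext => t; rewrite chermiteJ.
rewrite (_ : (fun n => _) = (fun n => nrm2 (fun t => F t - hsum (hcoef f) n t)))//.
apply/funext => n; congr fine; apply: ae_eq_integral => //.
- apply/measurable_EFinP/measurable_funX/measurable_cmod.
  exact: L2_meas (L2B fi (L2_hsum _ _)).
- apply/measurable_EFinP/measurable_funX/measurable_cmod.
  exact: L2_meas (L2B Fi (L2_hsum _ _)).
- by apply: (ae_imp ae0) => t /eqP; rewrite subr_eq0 => /eqP -> _.
Qed.

Lemma Parseval f : L2 f ->
  (\sum_(n < N) cmod (hcoef f n) ^+ 2) @[N --> \oo] --> nrm2 f.
Proof.
move=> fi; have h := hermite_expansion fi.
have h2 : (nrm2 f - nrm2 (fun t => f t - hsum (hcoef f) n t)) @[n --> \oo] --> nrm2 f.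
  by rewrite -[X in _ --> X]subr0; apply: cvgB => //; exact: cvg_cst.
move: h2; under eq_fun do rewrite nrm2_sub_hsum// opprB addrC subrK.
exact.
Qed.

Lemma nrm2_hcoef f F : L2 f -> L2 F ->
  (forall n, cmod (hcoef f n) = cmod (hcoef F n)) -> nrm2 f = nrm2 F.
Proof.
move=> fi Fi e.
have eS : (fun N => \sum_(n < N) cmod (hcoef F n) ^+ 2) =
    (fun N => \sum_(n < N) cmod (hcoef f n) ^+ 2).
  by apply/funext => N; apply: eq_bigr => n _; rewrite e.
have := Parseval Fi; rewrite eS => h.
exact: (cvg_unique _ (Parseval fi) h).
Qed.

End HermiteBasis.

(** * Metaplectic covariance of the short-time Fourier transform *)

Section Metaplectic.
Context {R : realType}.
Notation mu := (@lebesgue_measure R).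
Notation e_ := (chermite : nat -> R -> R[i]).
Implicit Types (f g F G : R -> R[i]) (theta : R) (z : R * R).

(** The metaplectic rotation seen through coefficients. These determine a function up to a null set,
    so the relation is independent of the representative chosen in [metaplectic]. *)
Definition rotates_hcoef theta f F :=
  forall n, hcoef F n = expi (- 2 * pi * n%:R * theta) * hcoef f n.

Lemma is_metaplecticP theta f G : L2 f ->
  is_metaplectic theta f G <-> L2 G /\ rotates_hcoef theta f G.
Proof.
move=> fi; pose c n := expi (- 2 * pi * n%:R * theta) * hcoef f n.
have eqL N : L2 G -> L2norm (fun t => G t - \sum_(n < N)
     expi (- 2 * pi * n%:R * theta) * inner f (chermite n) * chermite n t) =
     (Num.sqrt (nrm2 (fun t => G t - hsum c N t)))%:E.
  by move=> Gi; rewrite -L2norm_nrm2//; exact: L2B (L2_hsum c N).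
rewrite /is_metaplectic; split=> [[Gi cG]|[Gi cG]]; split => //.
- apply: hcoef_lim => //.
  have h : Num.sqrt (nrm2 (fun t => G t - hsum c n t)) @[n --> \oo] --> (0 : R).
    move: cG; rewrite (_ : (fun N => _) =
        (fun N => (Num.sqrt (nrm2 (fun t => G t - hsum c N t)))%:E)).
      by move=> /fine_cvgP[].
    by apply/funext => N; exact: eqL.
  rewrite (_ : (fun n => nrm2 _) =
    (fun n => Num.sqrt (nrm2 (fun t => G t - hsum c n t)) *
              Num.sqrt (nrm2 (fun t => G t - hsum c n t)))); last first.
    by apply/funext => n; rewrite -expr2 sqr_sqrtr ?nrm2_ge0.
  by rewrite -[X in _ --> X](mulr0 0); exact: cvgM.
- rewrite (_ : (fun N => _) =
      (fun N => (Num.sqrt (nrm2 (fun t => G t - hsum c N t)))%:E)); last first.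
    by apply/funext => N; exact: eqL.
  apply: cvg_EFin; first exact: nearW.
  apply: cvg_sqrt0; have := hermite_expansion Gi.
  by rewrite (_ : hcoef G = c)//; apply/funext => n; exact: cG.
Qed.

Lemma metaplectic_exists theta f : L2 f -> exists G, is_metaplectic theta f G.
Proof.
move=> fi; pose c n := expi (- 2 * pi * n%:R * theta) * hcoef f n.
have [|G Gi cG] := @hermite_series_cvg _ c (nrm2 f).
  move=> N; apply: le_trans (Bessel N fi).
  by apply: ler_sum => n _; rewrite cmodM cmod_expi mul1r.
by exists G; apply/is_metaplecticP => //; split => //; exact: hcoef_lim.
Qed.

Lemma metaplecticP theta f : L2 f ->
  L2 (metaplectic theta f) /\ rotates_hcoef theta f (metaplectic theta f).
Proof.
move=> fi; apply/is_metaplecticP => //.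
exact: (xgetPex (fun=> 0) (metaplectic_exists theta fi)).
Qed.

Lemma rotates_nrm2 theta f F : L2 f -> L2 F -> rotates_hcoef theta f F ->
  nrm2 f = nrm2 F.
Proof.
move=> fi Fi e; apply: nrm2_hcoef => // n.
by rewrite e cmodM cmod_expi mul1r.
Qed.

(** Surjectivity of the rotation: test functions may be prescribed on the rotated side. *)
Lemma rotates_inverse theta F : L2 F ->
  exists2 f, L2 f & rotates_hcoef theta f F.
Proof.
move=> Fi; have [fi e] := metaplecticP (- theta) Fi.
exists (metaplectic (- theta) F) => // n.
by rewrite e mulrA -expiD mulrN subrr expi0 mul1r.
Qed.

Definition tfshift z g (t : R) : R[i] := g (t - z.1) * expi (2 * pi * z.2 * t).

Lemma L2_tfshift z g : L2 g -> L2 (tfshift z g).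
Proof.
move=> gi; have /L2P[mg ig] := L2_shift (- z.1) gi; apply/L2P; split.
  by apply: cmeasM => //; apply: cmeas_expi; exact: measurable_funM.
move: ig; congr (_.-integrable _ (_ \o _)); apply/funext => t.
by rewrite /tfshift cmodM cmod_expi mulr1.
Qed.

Lemma nrm2_tfshift z g : L2 g -> nrm2 (tfshift z g) = nrm2 g.
Proof.
move=> gi; rewrite -(nrm2_shift (- z.1) gi); apply: eq_Rintegral => t _.
by rewrite /tfshift cmodM cmod_expi mulr1.
Qed.

Lemma stft_inner g f z : stft g f z = inner f (tfshift z g).
Proof.
congr cintegral; apply/funext => t; rewrite /tfshift cjM expiJ mulrA.
by congr (_ * expi _); ring.
Qed.

Lemma tfshiftB z g h : tfshift z (fun t => g t - h t) =
  (fun t => tfshift z g t - tfshift z h t).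
Proof. by apply/funext => t; rewrite /tfshift mulrBl. Qed.

(** Joint continuity in function and window. The error splits into one term with [f - f_n] and one
    pairing [f_n] with the time-frequency shift of [g - g_n]; Bessel keeps the norms of [f_n]
    bounded. *)
Lemma stft_hsum_cvg g f z : L2 f -> L2 g ->
  cmod (stft g f z - stft (hsum (hcoef g) n) (hsum (hcoef f) n) z)
    @[n --> \oo] --> (0 : R).
Proof.
move=> fi gi; set fN := hsum (hcoef f); set gN := hsum (hcoef g).
have fNi n : L2 (fN n) := L2_hsum _ n.
have gNi n : L2 (gN n) := L2_hsum _ n.
have cf := cvg_sqrt0 (hermite_expansion fi).
have cg := cvg_sqrt0 (hermite_expansion gi).
pose u n := 2 * Num.sqrt (nrm2 g) * Num.sqrt (nrm2 (fun t => f t - fN n t)) +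
  2 * Num.sqrt (nrm2 f) * Num.sqrt (nrm2 (fun t => g t - gN n t)).
have cu : u @ \oo --> (0 : R).
  have A : 2 * Num.sqrt (nrm2 g) * Num.sqrt (nrm2 (fun t => f t - fN n t))
    @[n --> \oo] --> 2 * Num.sqrt (nrm2 g) * 0.
    by apply: cvgMr; exact: cf.
  have B : 2 * Num.sqrt (nrm2 f) * Num.sqrt (nrm2 (fun t => g t - gN n t))
    @[n --> \oo] --> 2 * Num.sqrt (nrm2 f) * 0.
    by apply: cvgMr; exact: cg.
  by have AB := cvgD A B; rewrite !mulr0 addr0 in AB; exact: AB.
apply: (squeeze_cvgr _ (cvg_cst 0) cu); apply: nearW => n.
rewrite cmod_ge0 andTb !stft_inner.
have -> : inner f (tfshift z g) - inner (fN n) (tfshift z (gN n)) =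
    inner (fun t => f t - fN n t) (tfshift z g) +
    inner (fN n) (tfshift z (fun t => g t - gN n t)).
  rewrite innerBl//; last exact: L2_tfshift.
  rewrite tfshiftB innerBr//; try exact: L2_tfshift.
  by ring.
apply: (le_trans (cmodD _ _)); apply: lerD.
  apply: (le_trans (cmod_inner_le (L2B fi (fNi n)) (L2_tfshift z gi))).
  by rewrite nrm2_tfshift// le_eqVlt; apply/orP; left; apply/eqP; ring.
apply: (le_trans (cmod_inner_le (fNi n) (L2_tfshift z (L2B gi (gNi n))))).
rewrite nrm2_tfshift; last exact: L2B.
rewrite mulrA ler_wpM2r ?sqrtr_ge0// ler_wpM2l// ler_sqrt ?nrm2_ge0//.
by rewrite nrm2_hsum Bessel.
Qed.

Lemma stft_hsum (c d : nat -> R[i]) N z : stft (hsum d N) (hsum c N) z =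
  \sum_(m < N) \sum_(n < N) c m * (d n)^* * stft (e_ n) (e_ m) z.
Proof.
rewrite stft_inner inner_hsum; last exact/L2_tfshift/L2_hsum.
apply: eq_bigr => m _.
have -> : tfshift z (hsum d N) = (fun t => \sum_(n < N) d n * tfshift z (e_ n) t).
  apply/funext => t; rewrite /tfshift /hsum mulr_suml.
  by apply: eq_bigr => n _; rewrite mulrA.
rewrite inner_sumr; last exact: L2_chermite.
  rewrite mulr_sumr; apply: eq_bigr => n _.
  rewrite innerZr ?stft_inner ?mulrA//; last exact: L2_chermite.
  exact/L2_tfshift/L2_chermite.
by move=> n; exact/L2Z/L2_tfshift/L2_chermite.
Qed.

(** The factor [e^{pi i x xi}] removes the non-radial phase of the transform. What remains is a
    radial Gaussian times [hpair], whose two displacements the rotation multiplies by [w] and by its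
    inverse, as in [hpairing_rotation]. *)
Lemma stft_chermite_rotation theta m n z
    (w := expi (- 2 * pi * theta)) (z' := rotation theta z) :
  expi (pi * z'.1 * z'.2) * w ^+ n * stft (e_ n) (e_ m) z' =
  expi (pi * z.1 * z.2) * w ^+ m * stft (e_ n) (e_ m) z.
Proof.
have w0 : w != 0.
  by apply/eqP => h; have := cmod_expi (- 2 * pi * theta); rewrite -/w h cmod0 => /eqP;
    rewrite eq_sym oner_eq0.
have wV : w^-1 = expi (2 * pi * theta).
  by apply: (mulfI w0); rewrite mulfV// /w -expiD -expi0; congr expi; ring.
rewrite !stft_chermite /hpair.
have rw v : expi (pi * v.1 * v.2) * expi (- pi * v.1 * v.2) = 1 :> R[i].
  by rewrite -expiD -expi0; congr expi; ring.
have norm_rot : z'.1 ^+ 2 + z'.2 ^+ 2 = z.1 ^+ 2 + z.2 ^+ 2.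
  have := cos2Dsin2 (2 * pi * theta); rewrite /z' /rotation /=.
  set C := cos _; set S := sin _ => e.
  transitivity ((C ^+ 2 + S ^+ 2) * (z.1 ^+ 2 + z.2 ^+ 2)); first by ring.
  by rewrite e mul1r.
have ha : Complex (z'.1 / 2) (- z'.2 / 2) = w * Complex (z.1 / 2) (- z.2 / 2).
  rewrite /w !mulNr /z' /rotation /expi cosN sinN /=.
  by apply: eq_ReIm; rewrite ?ReM ?ImM /=; field.
have hb : Complex (- z'.1 / 2) (- z'.2 / 2) = w^-1 * Complex (- z.1 / 2) (- z.2 / 2).
  rewrite wV /z' /rotation /expi /=.
  by apply: eq_ReIm; rewrite ?ReM ?ImM /=; field.
rewrite norm_rot ha hb; set K := (_ * _ * expR _)%:C.
have rot := hpairing_rotation (gfun_ibp2pi (R := R)) (Complex (z.1 / 2) (- z.2 / 2))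
  (Complex (- z.1 / 2) (- z.2 / 2)) m n w0.
set H' := hpairing _ _ (w * _) _ _ _ in rot *.
set H := hpairing _ _ _ _ _ _ in rot *.
transitivity (K * (expi (pi * z'.1 * z'.2) * expi (- pi * z'.1 * z'.2)) * (w ^+ n * H')).
  by ring.
rewrite rot rw.
transitivity (K * (expi (pi * z.1 * z.2) * expi (- pi * z.1 * z.2)) * (w ^+ m * H)).
  by rewrite rw.
by ring.
Qed.

Lemma stft_hsum_rotation theta (c d : nat -> R[i]) N z
    (z' := rotation theta z)
    (tw := fun (a : nat -> R[i]) n => expi (- 2 * pi * n%:R * theta) * a n) :
  expi (pi * z'.1 * z'.2) * stft (hsum d N) (hsum c N) z' =
  expi (pi * z.1 * z.2) * stft (hsum (tw d) N) (hsum (tw c) N) z.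
Proof.
rewrite !stft_hsum !mulr_sumr; apply: eq_bigr => m _.
rewrite !mulr_sumr; apply: eq_bigr => n _.
pose w : R[i] := expi (- 2 * pi * theta).
have wk k : expi (- 2 * pi * k%:R * theta) = w ^+ k.
  by rewrite /w -expiMn; congr expi; ring.
have wJ : w ^+ n * (w ^+ n)^* = 1.
  by rewrite -wk expiJ expiVM.
have key := stft_chermite_rotation theta m n z; rewrite -/z' -/w in key.
rewrite /tw !wk cjM.
transitivity (c m * (d n)^* * (w ^+ n)^* * (expi (pi * z.1 * z.2) * w ^+ m *
  stft (e_ n) (e_ m) z)); last by ring.
rewrite -key.
transitivity ((w ^+ n * (w ^+ n)^*) * (c m * (d n)^* * expi (pi * z'.1 * z'.2) *
  stft (e_ n) (e_ m) z')); last by ring.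
by rewrite wJ; ring.
Qed.

(** For partial sums of equal length the identity is exact, with unimodular prefactors. It passes to
    the limit as an equality of complex numbers, and the prefactors disappear under the modulus. *)
Theorem stft_rotation theta f g F G z : L2 f -> L2 g -> L2 F -> L2 G ->
  rotates_hcoef theta f F -> rotates_hcoef theta g G ->
  cmod (stft g f (rotation theta z)) = cmod (stft G F z).
Proof.
move=> fi gi Fi Gi fF gG; pose z' := rotation theta z.
have h1 := stft_hsum_cvg z' fi gi.
have h2 := stft_hsum_cvg z Fi Gi.
have e : expi (pi * z'.1 * z'.2) * stft g f z' - expi (pi * z.1 * z.2) * stft G F z = 0.
  apply: cmod_eq0; apply/eqP; rewrite eq_le cmod_ge0 andbT.
  have h3 : (cmod (stft g f z' - stft (hsum (hcoef g) n) (hsum (hcoef f) n) z') +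
      cmod (stft G F z - stft (hsum (hcoef G) n) (hsum (hcoef F) n) z))
      @[n --> \oo] --> (0 : R).
    by have h12 := cvgD h1 h2; rewrite addr0 in h12; exact: h12.
  rewrite -(cvg_lim (@Rhausdorff R) h3); apply: limr_ge; first exact: cvgP h3.
  apply: nearW => n.
  have eF : (fun n => expi (- 2 * pi * n%:R * theta) * hcoef f n) = hcoef F.
    by apply/funext => j; rewrite fF.
  have eG : (fun n => expi (- 2 * pi * n%:R * theta) * hcoef g n) = hcoef G.
    by apply/funext => j; rewrite gG.
  have k : expi (pi * z'.1 * z'.2) * stft (hsum (hcoef g) n) (hsum (hcoef f) n) z' =
      expi (pi * z.1 * z.2) * stft (hsum (hcoef G) n) (hsum (hcoef F) n) z.
    by rewrite -eF -eG; exact: stft_hsum_rotation.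
  set A := stft (hsum (hcoef g) n) (hsum (hcoef f) n) z' in k *.
  set B := stft (hsum (hcoef G) n) (hsum (hcoef F) n) z in k *.
  have -> : expi (pi * z'.1 * z'.2) * stft g f z' - expi (pi * z.1 * z.2) * stft G F z =
    expi (pi * z'.1 * z'.2) * (stft g f z' - A) +
    - (expi (pi * z.1 * z.2) * (stft G F z - B)).
    have alg (E E' S S' a b : R[i]) : E * a = E' * b ->
        E * S - E' * S' = E * (S - a) + - (E' * (S' - b)).
      by move=> h; rewrite !mulrBr h; ring.
    exact: alg.
  rewrite (le_trans (cmodD _ _))// cmodN !cmodM !cmod_expi !mul1r.
  exact: lexx.
have e2 := subr0_eq e.
have := congr1 (@cmod R) e2.
by rewrite !cmodM !cmod_expi !mul1r.
Qed.

Lemma cmeas_hpairing d (T : measurableType d) (a b : T -> R[i]) (c : R[i])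
    (L : {poly R[i]} -> R[i]) m n :
  ibp_functional c 0 L -> cmeas a -> cmeas b ->
  cmeas (fun x => hpairing c L (a x) (b x) m n).
Proof.
move=> hL ma mb; elim: m n => [|m IH] n.
  elim: n => [|n IH].
    by under eq_fun do rewrite hpairing00; exact: cmeas_cst.
  under eq_fun do rewrite hpairingC (hpairingS hL) mulr0 mul0r sub0r hpairingC.
  by apply: cmeasN; do 2 apply: cmeasM => //; exact: cmeas_cst.
under eq_fun do rewrite (hpairingS hL).
apply: cmeasD; first by apply: cmeasM => //; exact: cmeas_cst.
by apply: cmeasN; do 2 apply: cmeasM => //; exact: cmeas_cst.
Qed.

(** Joint measurability in [z] is inherited, by pointwise limits, from finite combinations of the
    explicit transforms of Hermite functions. *)
Lemma cmeas_stft f g : L2 f -> L2 g -> cmeas (fun z : R * R => stft g f z).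
Proof.
move=> fi gi.
have m1 : measurable_fun setT (fun z : R * R => z.1) := measurable_fst.
have m2 : measurable_fun setT (fun z : R * R => z.2) := measurable_snd.
have mcplx (u v : R * R -> R) : measurable_fun setT u -> measurable_fun setT v ->
    cmeas (fun z => Complex (u z) (v z)) by [].
have mpair m n : cmeas (hpair m n : R * R -> R[i]).
  apply: cmeas_hpairing; first exact: gfun_ibp2pi.
    by apply: mcplx; apply: measurable_funM => //; exact: measurableT_comp.
  by apply: mcplx; apply: measurable_funM => //; exact: measurableT_comp.
have mstft m n : cmeas (fun z : R * R => stft (e_ n) (e_ m) z).
  under eq_fun do rewrite stft_chermite.
  apply: cmeasM => //; apply: cmeasM.
    apply: cmeas_real; apply: measurable_funM => //.
    apply: measurableT_comp => //; apply: measurableT_comp => //.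
    apply: measurable_funM => //; apply: measurable_funM => //.
    by apply: measurable_funD; exact: measurable_funX.
  apply: cmeas_expi; apply: measurable_funM => //; exact: measurable_funM.
pose S n z := stft (hsum (hcoef g) n) (hsum (hcoef f) n) z.
have mS n : cmeas (S n).
  rewrite /S; under eq_fun do rewrite stft_hsum.
  apply: cmeas_sum => i; apply: cmeas_sum => j.
  by apply: cmeasM => //; exact: cmeas_cst.
have cS z := stft_hsum_cvg z fi gi.
split.
- apply: (measurable_fun_cvg (fun n => (mS n).1)) => z _.
  apply/subr_cvg0; apply: norm_cvg0.
  apply: (squeeze_cvgr _ (cvg_cst 0) (cS z)); apply: nearW => n.
  by rewrite normr_ge0 -normrN opprB -ReN -ReD Re_le_cmod.
- apply: (measurable_fun_cvg (fun n => (mS n).2)) => z _.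
  apply/subr_cvg0; apply: norm_cvg0.
  apply: (squeeze_cvgr _ (cvg_cst 0) (cS z)); apply: nearW => n.
  by rewrite normr_ge0 -normrN opprB -ImN -ImD Im_le_cmod.
Qed.

End Metaplectic.

(** * Plancherel theorem *)

Section ComplexFubini.
Context {R : realType}.
Notation mu := (@lebesgue_measure R).
Notation Rint h := (mu.-integrable setT (EFin \o h)).

Section Real.
Variables (k : R * R -> R) (a b : R -> R).
Hypothesis mk : measurable_fun setT k.
Hypotheses (ia : Rint a) (ib : Rint b).
Hypotheses (a0 : forall x, 0 <= a x) (b0 : forall y, 0 <= b y).
Hypothesis kab : forall x y, `|k (x, y)| <= a x * b y.

Let prod_integrable : (mu \x mu)%E.-integrable setT (EFin \o k).
Proof.
apply/integrable12ltyP; first exact/measurable_EFinP.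
have ma : measurable_fun setT (EFin \o a) by apply/measurable_EFinP; exact: Rint_meas.
have mb : measurable_fun setT (EFin \o b) by apply/measurable_EFinP; exact: Rint_meas.
have ae0 x : setT x -> (0 <= (EFin \o a) x)%E by move=> _; rewrite lee_fin.
have be0 y : setT y -> (0 <= (EFin \o b) y)%E by move=> _; rewrite lee_fin.
have Ib0 : (0 <= \int[mu]_y (b y)%:E)%E by exact: integral_ge0.
have mak : measurable_fun setT (fun z => `|(k z)%:E|%E).
  apply: (measurableT_comp (@abse_measurable R setT)) => //.
  by apply/measurable_EFinP; exact: mk.
apply: (@le_lt_trans _ _ (\int[mu]_x ((a x)%:E * \int[mu]_y (b y)%:E)))%E.
  apply: ge0_le_integral => //.
  - by move=> x _; apply: integral_ge0.
  - exact: (measurable_fun_fubini_tonelli_F (m2 := mu) _ mak (fun z => abse_ge0 _)).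
  - by apply: emeasurable_funM => //; exact: measurable_cst.
  move=> x _; rewrite -(ge0_integralZl mu measurableT mb be0 (ae0 x I)).
  apply: ge0_le_integral => //.
  - exact: (measurable_fun_pair2 x mak).
  - by apply: emeasurable_funM => //; exact: measurable_cst.
  - by move=> y _ /=; rewrite lee_fin kab.
rewrite (ge0_integralZr mu measurableT ma ae0 Ib0).
have fa := integrable_fin_num measurableT ia.
have fb := integrable_fin_num measurableT ib.
by rewrite ltey_eq fin_numM.
Qed.

Let slice1 x : Rint (fun y => k (x, y)).
Proof.
apply: (Rint_dom _ (RintZ (a x) ib)); first exact: (measurable_fun_pair2 x mk).
by move=> y; exact: kab.
Qed.

Let slice2 y : Rint (fun x => k (x, y)).
Proof.
apply: (Rint_dom _ (RintZ (b y) ia)); first exact: (measurable_fun_pair1 y mk).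
by move=> x; rewrite mulrC; exact: kab.
Qed.

Lemma Rintegral_Fubini : \int[mu]_x (\int[mu]_y k (x, y)) =
  \int[mu]_y (\int[mu]_x k (x, y)).
Proof.
have := Fubini prod_integrable; rewrite {1 3}/Rintegral => e.
congr fine; transitivity (\int[mu]_x \int[mu]_y (EFin \o k) (x, y))%E.
  apply: eq_integral => x _; rewrite /Rintegral fineK//.
  exact: integrable_fin_num (slice1 x).
rewrite e; apply: eq_integral => y _; rewrite /Rintegral fineK//.
exact: integrable_fin_num (slice2 y).
Qed.

Lemma measurable_Rintegral : measurable_fun setT (fun x => \int[mu]_y k (x, y)).
Proof.
have h := measurable_fubini_F prod_integrable.
by apply: (@measurableT_comp _ _ _ _ _ _ fine).
Qed.

End Real.

Section Complex.
Variables (K : R * R -> R[i]) (a b : R -> R).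
Hypothesis mK : cmeas K.
Hypotheses (ia : Rint a) (ib : Rint b).
Hypotheses (a0 : forall x, 0 <= a x) (b0 : forall y, 0 <= b y).
Hypothesis Kab : forall x y, cmod (K (x, y)) <= a x * b y.

Lemma cintegral_Fubini : cintegral (fun x => cintegral (fun y => K (x, y))) =
  cintegral (fun y => cintegral (fun x => K (x, y))).
Proof.
rewrite /cintegral /=; congr Complex.
  apply: (@Rintegral_Fubini (fun z => Re (K z)) a b) => // [|x y]; first exact: mK.1.
  exact: le_trans (Re_le_cmod _) (Kab x y).
apply: (@Rintegral_Fubini (fun z => Im (K z)) a b) => // [|x y]; first exact: mK.2.
exact: le_trans (Im_le_cmod _) (Kab x y).
Qed.

Lemma cmeas_cintegral : cmeas (fun x => cintegral (fun y => K (x, y))).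
Proof.
split => /=.
  apply: (@measurable_Rintegral (fun z => Re (K z)) a b) => // [|x y]; first exact: mK.1.
  exact: le_trans (Re_le_cmod _) (Kab x y).
apply: (@measurable_Rintegral (fun z => Im (K z)) a b) => // [|x y]; first exact: mK.2.
exact: le_trans (Im_le_cmod _) (Kab x y).
Qed.

End Complex.

End ComplexFubini.

Section Plancherel.
Context {R : realType}.
Notation mu := (@lebesgue_measure R).
Notation Rint h := (mu.-integrable setT (EFin \o h)).
Notation e_ := (chermite : nat -> R -> R[i]).
Implicit Types (u : R -> R[i]).

Definition fourier u (xi : R) : R[i] :=
  cintegral (fun t => u t * expi (- 2 * pi * xi * t)).

Lemma cint_fourier u xi : cint u -> cint (fun t => u t * expi (- 2 * pi * xi * t)).
Proof.
move=> iu; apply: (cint_dom _ (cint_cmod iu)).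
  by apply: cmeasM; [exact: cint_meas | apply: cmeas_expi; exact: measurable_funM].
by move=> t; rewrite cmodM cmod_expi mulr1.
Qed.

Let weight (h : R -> R[i]) u z : R[i] :=
  h z.1 * (u z.2 * expi (- 2 * pi * z.1 * z.2)).

Let cmeas_weight h u : cmeas h -> cmeas u -> cmeas (weight h u).
Proof.
move=> mh mu_; apply: cmeasM; first exact: (cmeas_comp measurable_fst mh).
apply: cmeasM; first exact: (cmeas_comp measurable_snd mu_).
apply: cmeas_expi; apply: measurable_funM; last exact: measurable_snd.
by apply: measurable_funM; [exact: measurable_cst | exact: measurable_fst].
Qed.

Let weight_le h u x y : cmod (weight h u (x, y)) <= cmod (h x) * cmod (u y).
Proof. by rewrite !cmodM cmod_expi mulr1. Qed.

(** The multiplication formula, by Fubini. With [h] a Hermite function it yields the Hermite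
    coefficients of a Fourier transform. *)
Lemma cintegral_fourier h u : cint h -> cint u ->
  cintegral (fun xi => h xi * fourier u xi) = cintegral (fun t => u t * fourier h t).
Proof.
move=> ih iu.
have F := cintegral_Fubini (cmeas_weight (cint_meas ih) (cint_meas iu))
  (cint_cmod ih) (cint_cmod iu) (fun x => cmod_ge0 _) (fun x => cmod_ge0 _)
  (@weight_le h u).
transitivity (cintegral (fun x => cintegral (fun y => weight h u (x, y)))).
  congr cintegral; apply/funext => x.
  by rewrite -(cintegralZ (h x) (cint_fourier x iu)).
rewrite F; congr cintegral; apply/funext => y.
rewrite -(cintegralZ (u y) (cint_fourier y ih)).
congr cintegral; apply/funext => x.
rewrite /weight [(_, _).1]/= [(_, _).2]/= mulrCA.
by rewrite -!mulrA (mulrC x y).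
Qed.

Lemma cmod_fourier_le u xi : cint u ->
  cmod (fourier u xi) <= 2 * \int[mu]_t cmod (u t).
Proof.
move=> iu; apply: (le_trans (cmod_cintegral_le (cint_fourier xi iu))).
rewrite le_eqVlt; apply/orP; left; apply/eqP; congr (_ * _).
by apply: eq_Rintegral => t _; rewrite cmodM cmod_expi mulr1.
Qed.

(** The kernel [u t e^{-2 pi i xi t}] is not integrable in the plane. A Gaussian factor in [xi]
    makes it so, and is divided out afterwards. *)
Lemma cmeas_fourier u : cint u -> cmeas (fourier u).
Proof.
move=> iu; pose h (x : R) : R[i] := (expR (- pi * x ^+ 2))%:C.
have ih : cint h.
  have := cint_gmoment 0 0 (pi_gt0 R); congr (cint _); apply/funext => t.
  by rewrite mulr0 mul0r expi0 mulr1 expr0 mul1r.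
have M := cmeas_cintegral (cmeas_weight (cint_meas ih) (cint_meas iu))
  (cint_cmod ih) (cint_cmod iu) (fun x => cmod_ge0 _) (fun x => cmod_ge0 _)
  (@weight_le h u).
have mi : cmeas (fun x : R => (expR (pi * x ^+ 2))%:C : R[i]).
  apply: cmeas_real; apply: measurableT_comp => //.
  by apply: measurable_funM => //; exact: measurable_funX.
have := cmeasM mi M; congr cmeas; apply/funext => x.
rewrite (_ : cintegral _ = h x * fourier u x); last first.
  by rewrite -(cintegralZ (h x) (cint_fourier x iu)).
rewrite mulrA -(rmorphM (real_complex R)) /= -expRD mulNr subrr expR0.
by rewrite mul1r.
Qed.

(** The series with coefficients [(-i)^n <u, h_n>] has a sum [w] of the same norm as [u]. By the
    multiplication formula and the eigenvalues of Hermite functions, [fourier u - w] is orthogonal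
    to all of them, so completeness makes it vanish almost everywhere. *)
Theorem Plancherel u : cint u -> L2 u ->
  L2 (fourier u) /\ nrm2 (fourier u) = nrm2 u.
Proof.
move=> iu ui; have mF := cmeas_fourier iu.
pose ii : R[i] := Complex 0 1.
pose c n := (- ii) ^+ n * hcoef u n.
have cmod_ii n : cmod ((- ii) ^+ n) = 1.
  elim: n => [|n IH]; first by rewrite expr0 cmodE /= expr0n expr1n addr0 sqrtr1.
  by rewrite exprS cmodM IH cmodN cmodE /= expr0n expr1n add0r sqrtr1 mulr1.
have cmod_c n : cmod (c n) = cmod (hcoef u n) by rewrite cmodM cmod_ii mul1r.
have [|w wi cw] := @hermite_series_cvg _ c (nrm2 u).
  move=> N; apply: le_trans (Bessel N ui).
  by apply: ler_sum => n _; rewrite cmod_c.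
have wc := hcoef_lim wi cw.
have ae0 : {ae mu, forall t, fourier u t - w t = 0}.
  apply: hermite_complete.
  - move=> b.
    have h1 := cint_bounded_gauss b (pi_gt0 R) mF (fun xi => cmod_fourier_le xi iu).
    have h2 := cint_L2_gauss b (pi_gt0 R) wi.
    have := cintD h1 (cintZ (-1) h2); congr cint; apply/funext => t.
    by ring.
  - by apply: cmeasD => //; apply: cmeasN; exact: L2_meas.
  - move=> n.
    have h1 : cint (fun t => e_ n t * fourier u t).
      apply: (cint_dom _ (RintZ (2 * \int[mu]_t cmod (u t)) (cint_cmod (cint_chermite n)))).
        by apply: cmeasM => //; exact: cmeas_chermite.
      move=> t; rewrite cmodM mulrC ler_wpM2r ?cmod_ge0//.
      exact: cmod_fourier_le.
    have h2 : cint (fun t => w t * e_ n t).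
      by apply: cint_L2M => //; exact: L2_chermite.
    have -> : (fun t => (fourier u t - w t) * e_ n t) =
        (fun t => e_ n t * fourier u t + (-1) * (w t * e_ n t)).
      by apply/funext => t; ring.
    rewrite cintegralD ?cintegralZ//; last exact: cintZ.
    rewrite cintegral_fourier//; last exact: cint_chermite.
    have -> : cintegral (fun t => w t * e_ n t) = c n.
      rewrite -(wc n); congr cintegral; apply/funext => t.
      by rewrite chermiteJ.
    have -> : (fun t => u t * fourier (e_ n) t) =
        (fun t => (- ii) ^+ n * (u t * (e_ n t)^*)).
      apply/funext => t; rewrite /fourier fourier_chermite chermiteJ.
      by rewrite mulrCA.
    rewrite cintegralZ; last by apply: cint_inner => //; exact: L2_chermite.
    by rewrite mulN1r -/(inner _ _) -/(hcoef _ _) subrr.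
have aeq : {ae mu, forall t, setT t -> (cmod (fourier u t) ^+ 2)%:E = (cmod (w t) ^+ 2)%:E}.
  by apply: (ae_imp ae0) => t /eqP; rewrite subr_eq0 => /eqP ->.
have m1 : measurable_fun setT (fun t => (cmod (fourier u t) ^+ 2)%:E).
  by apply/measurable_EFinP; apply: measurable_funX; exact: measurable_cmod.
have m2 : measurable_fun setT (fun t => (cmod (w t) ^+ 2)%:E).
  by apply/measurable_EFinP; apply: measurable_funX; exact/measurable_cmod/L2_meas.
have eI := @ae_eq_integral _ _ _ mu _ _ _ measurableT m1 m2 aeq.
split; last first.
  have -> : nrm2 (fourier u) = nrm2 w by congr fine.
  by apply: nrm2_hcoef => // n; rewrite wc cmod_c.
apply/L2P; split => //; apply/integrableP; split => //.
have -> : (\int[mu]_t `|(cmod (fourier u t) ^+ 2)%:E| =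
    \int[mu]_t (cmod (fourier u t) ^+ 2)%:E)%E.
  by apply: eq_integral => t _; rewrite gee0_abs// lee_fin sqr_ge0.
by rewrite eI -L2norm_sqr nrm2E// ltry.
Qed.

End Plancherel.

(** * Hausdorff measure on lines *)

Section HausdorffMetric.
Context {R : realType}.
Local Open Scope ereal_scope.
Local Notation edist := Defs.edist.
Notation H1 := (@hausdorff1_outer R).
Implicit Types (E F U X : set (R * R)) (delta : R) (z w : R * R).

Lemma edist_ge_fst z w : (z.1 - w.1 <= edist z w)%R.
Proof.
apply: (le_trans (ler_norm _)); rewrite -sqrtr_sqr ler_wsqrtr// lerDl.
exact: sqr_ge0.
Qed.

Lemma edist_ge_snd z w : (z.2 - w.2 <= edist z w)%R.
Proof.
apply: (le_trans (ler_norm _)); rewrite -sqrtr_sqr ler_wsqrtr// lerDr.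
exact: sqr_ge0.
Qed.

Lemma le_diam : {homo @diam R : E F / E `<=` F >-> E <= F}.
Proof.
move=> E F EF; apply: ereal_sup_le => x [->|[p [p1 p2] <-]]; first by left.
by right; exists p => //; split; exact: EF.
Qed.

Lemma edist_le_diam U z w : U z -> U w -> (edist z w)%:E <= diam U.
Proof. by move=> Uz Uw; apply: ereal_sup_ubound; right; exists (z, w). Qed.

Lemma diam_le U (D : R) : (0 <= D)%R ->
  (forall z w, U z -> U w -> (edist z w <= D)%R) -> diam U <= D%:E.
Proof.
move=> D0 UD; apply: ge_ereal_sup => _ [->|[p [p1 p2] <-]]; rewrite lee_fin//.
exact: UD.
Qed.

Lemma hausdorff1_delta_antitone delta1 delta2 E : (delta1 <= delta2)%R ->
  hausdorff1_delta delta2 E <= hausdorff1_delta delta1 E.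
Proof.
move=> d12; apply: le_ereal_inf_tmp => _ [U [dU EU] <-].
apply: ereal_inf_lbound; exists U => //; split => // k.
by rewrite (le_trans (dU k))// lee_fin.
Qed.

(** A set of diameter at most [delta] cannot meet both [E] and [F], so intersecting a cover with
    each of them splits its sum without loss. *)
Lemma hausdorff1_delta_separated delta (e : R) E F : (delta < e)%R ->
  (forall z w, E z -> F w -> (e <= edist z w)%R) ->
  hausdorff1_delta delta E + hausdorff1_delta delta F <=
  hausdorff1_delta delta (E `|` F).
Proof.
move=> de EF; apply: le_ereal_inf_tmp => _ [U [dU EFU] <-].
have step k : diam (U k `&` E) + diam (U k `&` F) <= diam (U k).
  have [E0|/set0P[z [Uz Ez]]] := eqVneq (U k `&` E) set0.
    by rewrite E0 diam0 add0e; apply: le_diam; exact: subIsetl.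
  have [F0|/set0P[w [Uw Fw]]] := eqVneq (U k `&` F) set0.
    by rewrite F0 diam0 adde0; apply: le_diam; exact: subIsetl.
  have := le_trans (edist_le_diam Uz Uw) (dU k).
  by rewrite lee_fin => /(le_lt_trans)/(_ de); rewrite ltNge EF.
apply: (@le_trans _ _ (\sum_(k <oo) (diam (U k `&` E) + diam (U k `&` F)))); last first.
  by apply: lee_nneseries => [k _ _|k _]; [rewrite adde_ge0 ?diam_ge0 | exact: step].
rewrite nneseriesD; [|by move=> *; exact: diam_ge0..].
apply: leeD; apply: ereal_inf_lbound.
  exists (fun k => U k `&` E) => //; split => [k|z Ez].
    by apply: le_trans (dU k); apply: le_diam; exact: subIsetl.
  by have [k _ Uz] := EFU z (or_introl Ez); exists k.
exists (fun k => U k `&` F) => //; split => [k|z Fz].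
  by apply: le_trans (dU k); apply: le_diam; exact: subIsetl.
by have [k _ Uz] := EFU z (or_intror Fz); exists k.
Qed.

Lemma hausdorff1_separated (e : R) E F : (0 < e)%R ->
  (forall z w, E z -> F w -> (e <= edist z w)%R) ->
  H1 E + H1 F <= H1 (E `|` F).
Proof.
move=> e0 EF; have [->|M] := eqVneq (H1 (E `|` F)) +oo; first exact: leey.
have fM : H1 (E `|` F) \is a fin_num by rewrite ge0_fin_numE ?hausdorff1_ge0 ?ltey.
have fF : H1 F \is a fin_num.
  rewrite ge0_fin_numE ?hausdorff1_ge0//.
  by apply: (@le_lt_trans _ _ (H1 (E `|` F))); [exact: le_hausdorff1|rewrite ltey].
rewrite -leeBrDr//; apply: ge_ereal_sup => _ [d1 /= d10 <-].
have fE : hausdorff1_delta d1 E \is a fin_num.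
  rewrite ge0_fin_numE ?hausdorff1_delta_ge0//.
  apply: (@le_lt_trans _ _ (H1 (E `|` F))); last by rewrite ltey.
  apply: (@le_trans _ _ (H1 E)); last exact: le_hausdorff1.
  by apply: ereal_sup_ubound; exists d1.
rewrite leeBrDr// -leeBrDl//; apply: ge_ereal_sup => _ [d2 /= d20 <-].
(* A common scale finer than both and strictly below the separation [e]. *)
rewrite leeBrDl//; pose d := Num.min (Num.min d1 d2) (e / 2)%R.
have d0 : (0 < d)%R by rewrite !lt_min d10 d20 divr_gt0.
have dd1 : (d <= d1)%R by rewrite !ge_min lexx.
have dd2 : (d <= d2)%R by rewrite !ge_min lexx orbT.
have de : (d < e)%R.
  by apply: (@le_lt_trans _ _ (e / 2)%R); [rewrite ge_min lexx orbT | lra].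
apply: (@le_trans _ _ (hausdorff1_delta d E + hausdorff1_delta d F)).
  by apply: leeD; exact: hausdorff1_delta_antitone.
apply: (le_trans (hausdorff1_delta_separated de EF)).
by apply: ereal_sup_ubound; exists d.
Qed.

(* Caratheodory's argument: the layers at consecutive distances from the
   boundary of the half-plane have summable measure, so that their tails, by
   which [X `&` [set z | a < l z]] differs from a set at positive distance from
   the complement, are negligible. *)
Lemma caratheodory_hausdorff1_gt (l : R * R -> R) (a : R) :
  (forall z w, (l z - l w <= edist z w)%R) ->
  H1.-caratheodory [set z | (a < l z)%R].
Proof.
move=> lip; apply: le_caratheodory_measurable => X.
have [->|XM] := eqVneq (H1 X) +oo; first exact: leey.
pose r n : R := (n.+1%:R^-1)%R.
have r0 n : (0 < r n)%R by rewrite invr_gt0.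
have rS n : (r n.+1 < r n)%R by rewrite ltf_pV2 ?posrE// ltr_nat.
pose S n := X `&` [set z | (a + r n <= l z)%R].
pose D n := X `&` [set z | (a + r n.+2 <= l z < a + r n.+1)%R].
(* Between [S n] and the layer [D n] lies a gap of width [r n - r n.+1], so the measures add up. *)
have SD n : H1 (S n) + H1 (D n) <= H1 (S n.+2).
  have e0 : (0 < r n - r n.+1)%R by rewrite subr_gt0.
  apply: (le_trans (@hausdorff1_separated _ (S n) (D n) e0 _)).
    move=> z w [_ /= z1] [_ /andP[w1 w2]]; apply: le_trans (lip z w).
    by lra.
  apply: le_outer_measure => z [[Xz /= z1]|[Xz /andP[z1 z2]]]; split => //=.
  apply: le_trans z1; rewrite lerD2l ltW// (lt_trans (rS _)) ?rS//.
have sumD n : \sum_(k < n) H1 (D k) <= H1 (S n) + H1 (S n.+1).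
  elim: n => [|n IH]; first by rewrite big_ord0 adde_ge0 ?outer_measure_ge0.
  rewrite big_ord_recr /= (le_trans (leeD2r _ IH))//.
  by rewrite addeAC addeC leeD2l.
have SX n : H1 (S n) <= H1 X by apply: le_outer_measure; exact: subIsetl.
have sumD_fin : \sum_(k <oo) H1 (D k) < +oo.
  apply: (@le_lt_trans _ _ (H1 X + H1 X)); last by rewrite lte_add_pinfty ?ltey.
  apply: lime_le; first by apply: is_cvg_nneseries => *; exact: outer_measure_ge0.
  apply: nearW => n; rewrite big_mkord; apply: (le_trans (sumD n)).
  by rewrite leeD.
have tail := nneseries_tail_cvg sumD_fin (fun k _ => outer_measure_ge0 H1 (D k)).
have key n : H1 (X `&` [set z | a < l z]%R) + H1 (X `&` ~` [set z | a < l z]%R) <=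
    H1 X + \sum_(n <= k <oo) H1 (D k).
  have h1 : H1 (X `&` [set z | a < l z]%R) <= H1 (S n.+1) + \sum_(n <= k <oo) H1 (D k).
    apply: (@le_trans _ _ (H1 (S n.+1 `|` \bigcup_(k in ~` `I_n) D k))).
      apply: le_outer_measure => z [Xz /= az].
      have [Sz|zS] := leP (a + r n.+1)%R (l z); first by left; split.
      right.
      have ex : exists m, (a + r m <= l z)%R.
        exists (Num.truncn (l z - a)^-1); rewrite -lerBrDl -[leRHS]invrK.
        rewrite lef_pV2 ?posrE ?invr_gt0 ?subr_gt0//.
        by rewrite ltW// truncnS_gt.
      (* The first level [a + r m] at or below [l z] tells which layer contains [z], namely the one
         of index [m - 2]. *)
      case: (ex_minnP ex) => m mz mmin.
      have nm : (n.+1 < m)%N.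
        rewrite ltnNge; apply/negP => mn; move: zS; apply/negP; rewrite -leNgt.
        by apply: le_trans mz; rewrite lerD2l lef_pV2 ?posrE// ler_nat.
      case: m nm mz mmin => [//|[//|m]] nm mz mmin.
      exists m => /=; first by apply/negP; rewrite -leqNgt.
      split => //=; rewrite mz /= ltNge; apply/negP => /mmin.
      by rewrite ltnn.
    apply: (le_trans (outer_measureU2 _ _ _)); rewrite leeD2l//.
    exact: outer_measure_sigma_subadditive_tail.
  apply: (@le_trans _ _ (H1 (S n.+1) + H1 (X `&` ~` [set z | a < l z]%R)
    + \sum_(n <= k <oo) H1 (D k))).
    by rewrite addeAC leeD2r.
  rewrite leeD2r//; apply: (le_trans (@hausdorff1_separated _ (S n.+1) _ (r0 n.+1) _)).
    move=> z w [_ /= z1] [_ /negP]; rewrite -leNgt => w1; apply: le_trans (lip z w).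
    by lra.
  by apply: le_outer_measure => z [[]|[]].
have lim : H1 X + \sum_(n <= k <oo) H1 (D k) @[n --> \oo] --> H1 X.
  rewrite -[X in _ --> X]adde0; apply: cvgeD tail; last exact: cvg_cst.
  exact: fin_num_adde_defl.
rewrite -(cvg_lim _ lim)//; apply: lime_ge; first exact: cvgP lim.
exact: nearW.
Qed.

End HausdorffMetric.

Section HausdorffBorel.
Context {R : realType}.
Local Notation edist := Defs.edist.
Notation T1 := (caratheodory_type (@hausdorff1_outer R)).
Notation mu := (@lebesgue_measure R).

Lemma measurable_caratheodory_lipschitz (l : R * R -> R) :
  (forall z w, l z - l w <= edist z w) ->
  measurable_fun setT (l : T1 -> R).
Proof.
move=> lip; apply: (measurability _ (RGenOInfty.measurableE R)) => //.
move=> _ [_ [a ->] <-]; rewrite setTI.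
rewrite (_ : _ @^-1` _ = [set z | a < l z]); last first.
  by apply/seteqP; split => z /=; rewrite in_itv/= andbT.
exact: caratheodory_hausdorff1_gt.
Qed.

(** The coordinates are 1-Lipschitz and generate the product sigma-algebra, so every Borel set is
    Caratheodory measurable. *)
Lemma measurable_caratheodory_id :
  measurable_fun setT (id : T1 -> R * R).
Proof.
apply/measurable_fun_pairP; split.
  exact: (measurable_caratheodory_lipschitz edist_ge_fst).
exact: (measurable_caratheodory_lipschitz edist_ge_snd).
Qed.

(** The same set function on the Borel sets of the plane, that is, the image of [hausdorff1_measure]
    under the identity. Restriction to a line and change of variables then take place between Borel
    spaces. *)
Definition hausdorff1_borel (A : set (R * R)) : \bar R := hausdorff1 A.

Let hausdorff1_borel_sigma_additive : semi_sigma_additive hausdorff1_borel.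
Proof.
have mT (A : set (R * R)) : measurable A -> measurable (A : set T1).
  by move=> mA; rewrite -[A]setTI; exact: measurable_caratheodory_id.
move=> F mF tF mUF.
apply: (@measure_semi_sigma_additive _ _ _ (@hausdorff1_measure R)) => //.
  by move=> n; exact: mT.
exact: mT.
Qed.

HB.instance Definition _ := isMeasure.Build _ (R * R)%type R hausdorff1_borel
  (@hausdorff1_0 R) (@hausdorff1_ge0 R) hausdorff1_borel_sigma_additive.

Lemma ge0_integral_hausdorff1 (D : set (R * R)) (F : R * R -> \bar R) :
  measurable D -> measurable_fun D F -> (forall z, 0 <= F z)%E ->
  (\int[hausdorff1_measure]_(z in D) F z = \int[hausdorff1_borel]_(z in D) F z)%E.
Proof.
move=> mD mF F0.
by rewrite -(ge0_integral_pushforward measurable_caratheodory_id hausdorff1_measure mD mF).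
Qed.

End HausdorffBorel.

Section HausdorffLine.
Context {R : realType}.
Local Notation edist := Defs.edist.
Notation mu := (@lebesgue_measure R).
Variable phi : R -> R * R.
Hypothesis iso : forall s t, edist (phi s) (phi t) = `|s - t|.

Let image_diam_le (a b : R) : a <= b -> (diam (phi @` `]a, b]) <= (b - a)%:E)%E.
Proof.
move=> ab; apply: diam_le; first by rewrite subr_ge0.
move=> _ _ [s + <-] [t + <-]; rewrite /= !in_itv/= iso => /andP[s1 s2] /andP[t1 t2].
by rewrite ler_norml; apply/andP; split; lra.
Qed.

Let delta_le1 (delta a b : R) : 0 < delta -> a <= b -> b - a <= delta ->
  (hausdorff1_delta delta (phi @` `]a, b]) <= (b - a)%:E)%E.
Proof.
move=> d0 ab small; pose U (k : nat) := if k == 0%N then phi @` `]a, b] else set0.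
apply: (@le_trans _ _ (\sum_(k <oo) diam (U k))%E).
  apply: ereal_inf_lbound; exists U => //; split => [k|z zU]; last by exists 0%N.
  rewrite /U; case: ifP => _; last by rewrite diam0 lee_fin ltW.
  by apply: le_trans (image_diam_le ab) _; rewrite lee_fin.
rewrite (nneseries_split 0 1) => [|k _]; last exact: diam_ge0.
rewrite add0n big_nat1 eseries0 ?adde0; first exact: image_diam_le.
by move=> [|k] //= _ _; rewrite /U /= diam0.
Qed.

(** Pieces of length [delta] are cut off until the remainder is short enough to be covered by
    itself; subadditivity adds the lengths. *)
Let delta_le (delta : R) (n : nat) (a b : R) : 0 < delta -> a <= b ->
  b - a <= n.+1%:R * delta -> (hausdorff1_delta delta (phi @` `]a, b]) <= (b - a)%:E)%E.
Proof.
move=> d0; elim: n a => [|n IH] a ab h; first by apply: delta_le1; rewrite // -[delta]mul1r.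
have [small|big] := leP (b - a) delta; first exact: delta_le1.
have -> : phi @` `]a, b] = phi @` `]a, a + delta] `|` phi @` `]a + delta, b].
  rewrite -image_setU; congr (_ @` _); apply/seteqP; split => t /=.
    rewrite !in_itv/= => /andP[-> ->]; rewrite andbT/=.
    by case: (leP t (a + delta)); [left|right].
  by rewrite !in_itv/= => -[/andP[]|/andP[]] h1 h2; apply/andP; split; lra.
have sub (E F : set (R * R)) : (hausdorff1_delta delta (E `|` F) <=
    hausdorff1_delta delta E + hausdorff1_delta delta F)%E.
  have := hausdorff1_delta_sigma_subadditive delta (bigcup2 E F).
  rewrite bigcup2E => /le_trans; apply.
  rewrite (nneseries_split 0 2) => [|k _]; last exact: hausdorff1_delta_ge0.
  rewrite add0n !big_nat_recl// big_geq//= adde0 eseries0 ?adde0//.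
  by move=> [|[|k]] //= _ _; rewrite hausdorff1_delta0.
apply: (le_trans (sub _ _)).
have -> : (b - a)%:E = ((a + delta - a)%R%:E + (b - (a + delta))%R%:E)%E.
  by rewrite -EFinD; congr EFin; ring.
apply: leeD.
  by apply: delta_le1 => //; lra.
apply: IH; first by move: big; lra.
by move: h; rewrite -(natr1 n.+1) mulrDl mul1r; lra.
Qed.

(** The upper bound comes from fine subdivisions. For the lower bound, the trace of a covering set
    lies in an interval as long as its diameter, and Lebesgue measure is countably subadditive;
    covers at scale 1 suffice and have finite diameters. *)
Lemma hausdorff1_isometry_itv (a b : R) : a <= b ->
  hausdorff1 (phi @` `]a, b]) = (b - a)%:E.
Proof.
move=> ab; apply/eqP; rewrite eq_le; apply/andP; split.
  apply: ge_ereal_sup => _ [delta /= d0 <-].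
  apply: (@delta_le delta (Num.truncn ((b - a) / delta))) => //.
  by rewrite -ler_pdivrMr// ltW// truncnS_gt.
apply: (@le_trans _ _ (hausdorff1_delta 1 (phi @` `]a, b]))); last first.
  by apply: ereal_sup_ubound; exists 1 => /=.
apply: le_ereal_inf_tmp => _ [U [dU cU] <-].
have fU k : diam (U k) \is a fin_num.
  by rewrite ge0_fin_numE ?diam_ge0//; apply: le_lt_trans (dU k) _; rewrite ltry.
pose D k := fine (diam (U k)).
have DE k : diam (U k) = (D k)%:E by rewrite /D fineK.
have D0 k : 0 <= D k by rewrite /D fine_ge0 ?diam_ge0.
(* Left end of the smallest closed interval around the trace of [U k]; its right end is at most
   [c k + D k]. *)
pose c k := inf (phi @^-1` U k).
pose J k : set (measurableTypeR R) := `[c k, c k + D k]%classic.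
have sub : `]a, b]%classic `<=` \bigcup_k J k.
  move=> t abt; have [k _ Ut] := cU (phi t) (ex_intro2 _ _ t abt erefl).
  have close s : U k (phi s) -> `|t - s| <= D k.
    by move=> Us; rewrite -iso -lee_fin -DE; exact: edist_le_diam.
  have lb : lbound (phi @^-1` U k) (t - D k).
    by move=> s /close; rewrite ler_norml => /andP[_]; lra.
  exists k => //; rewrite /J /= in_itv/=; apply/andP; split.
    by apply: ge_inf => //; exists (t - D k).
  rewrite -lerBlDr; apply: lb_le_inf => //; by exists t.
have -> : (b - a)%:E = mu `]a, b]%classic.
  rewrite lebesgue_measure_itv/= lte_fin; case: ltgtP ab => // -> _.
  by rewrite subrr.
apply: (le_trans (@measure_sigma_subadditive _ _ _ mu _ J _ _ sub)) => //.
  by move=> k; exact: measurable_itv.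
apply: lee_nneseries => [k _ _//|k _].
rewrite [leLHS](lebesgue_measure_itv `[c k, c k + D k]) /= lte_fin.
by case: ifP => _; rewrite DE -?EFinD lee_fin ?D0//; lra.
Qed.

End HausdorffLine.

(** * Integration along a line *)

Section LineIntegral.
Context {R : realType}.
Local Notation edist := Defs.edist.
Notation mu := (@lebesgue_measure R).
Variable d : R * R.
Hypothesis d1 : d.1 ^+ 2 + d.2 ^+ 2 = 1.

Definition line_point (l t : R) : R * R := t *: d + l *: perp d.

Definition line (l : R) : set (R * R) := range (line_point l).

Definition dotd (z : R * R) : R := z.1 * d.1 + z.2 * d.2.
Definition dotperp (z : R * R) : R := z.1 * d.2 - z.2 * d.1.

Lemma dotd_line_point l t : dotd (line_point l t) = t.
Proof.
rewrite /dotd /line_point /perp /= /GRing.scale /=.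
transitivity (t * (d.1 ^+ 2 + d.2 ^+ 2)); first ring.
by rewrite d1 mulr1.
Qed.

Lemma dotperp_line_point l t : dotperp (line_point l t) = l.
Proof.
rewrite /dotperp /line_point /perp /= /GRing.scale /=.
transitivity (l * (d.1 ^+ 2 + d.2 ^+ 2)); first ring.
by rewrite d1 mulr1.
Qed.

Lemma line_pointK z : line_point (dotperp z) (dotd z) = z.
Proof.
case: z => x y; rewrite /line_point /dotperp /dotd /perp /= /GRing.scale /=.
by congr pair; rewrite -[RHS]mulr1 -d1 /scale_pair /= /GRing.scale /=; ring.
Qed.

Lemma lineE l : line l = [set z | dotperp z = l].
Proof.
apply/seteqP; split => z /=; first by move=> [t _ <-]; rewrite dotperp_line_point.
by move=> <-; exists (dotd z); rewrite ?line_pointK.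
Qed.

Lemma measurable_dotd : measurable_fun setT dotd.
Proof. by apply: measurable_funD; apply: measurable_funM => //; exact: measurable_cst. Qed.

Lemma measurable_dotperp : measurable_fun setT dotperp.
Proof.
by apply: measurable_funB; apply: measurable_funM => //; exact: measurable_cst.
Qed.

Lemma measurable_line l : measurable (line l).
Proof.
rewrite lineE (_ : [set _ | _] = dotperp @^-1` [set l])// -[X in measurable X]setTI.
by apply: measurable_dotperp.
Qed.

Lemma measurable_line_point l : measurable_fun setT (line_point l).
Proof.
apply/measurable_fun_pairP; split; rewrite /comp /line_point /perp /= /GRing.scale /=.
  by apply: measurable_funD; apply: measurable_funM => //; exact: measurable_cst.
by apply: measurable_funD; apply: measurable_funM => //; exact: measurable_cst.
Qed.

Lemma edist_line_point l s t : edist (line_point l s) (line_point l t) = `|s - t|.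
Proof.
rewrite /Defs.edist /line_point /perp /= /GRing.scale /= -sqrtr_sqr; congr Num.sqrt.
by rewrite -[RHS]mulr1 -d1; ring.
Qed.

(** Transported by the coordinate [dotd], the Hausdorff measure on the line is a Borel measure that
    gives half-open intervals their length, hence Lebesgue measure. *)
Lemma hausdorff1_line (l : R) (E : set R) : measurable E ->
  hausdorff1_borel (line_point l @` E) = mu E.
Proof.
have im (A : set R) : line_point l @` A = line l `&` dotd @^-1` A.
  apply/seteqP; split => [_ [t At <-]|_ [[t _ <-]] /=].
    by split => /=; [exists t | rewrite dotd_line_point].
  by rewrite dotd_line_point => At; exists t.
move=> mE; rewrite im; apply/esym.
transitivity (pushforward (mrestr (@hausdorff1_borel R) (measurable_line l))
      (dotd : R * R -> measurableTypeR R) E).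
  apply: lebesgue_measure_unique => //; first exact: measurable_dotd.
  move=> md _ [[a b] _ <-]; transitivity (hausdorff1 (line_point l @` `]a, b])); last first.
    by rewrite im setIC.
  rewrite /=.
  have [ab|ba] := leP a b.
    rewrite hausdorff1_isometry_itv//; last exact: edist_line_point.
    rewrite lebesgue_measure_itv/= lte_fin; case: ltgtP ab => // -> _.
    by rewrite subrr.
  rewrite set_itv_ge -?leNgt ?bnd_simp ?ltW// image_set0 measure0.
  by rewrite /hausdorff1_borel hausdorff1_0.
by rewrite /pushforward /mrestr setIC.
Qed.

Lemma ge0_integral_line (l : R) (F : R * R -> \bar R) :
  measurable_fun setT F -> (forall z, 0 <= F z)%E ->
  (\int[hausdorff1_borel]_(z in line l) F z = \int[mu]_t F (line_point l t))%E.
Proof.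
move=> mF F0.
have ml := measurable_line_point l.
transitivity (\int[pushforward mu (line_point l)]_(z in line l) F z)%E; last first.
  rewrite ge0_integral_pushforward//; last by apply: measurable_funTS.
    rewrite (_ : _ @^-1` _ = setT)//.
    by apply/seteqP; split => // t _; exists t.
  exact: measurable_line.
apply: eq_measure_integral => A mA Al.
rewrite -[in LHS](_ : line_point l @` (line_point l @^-1` A) = A); last first.
  apply/seteqP; split => [_ [t At <-]//|z Az].
  by have [t _ tz] := Al z Az; exists t; rewrite //= tz.
apply: hausdorff1_line; rewrite -[X in measurable X]setTI; exact: ml.
Qed.

End LineIntegral.

(** * Countable families of parallel lines *)

Section CountableSums.
Context {R : realType}.

(** The set may be finite or empty, so it is indexed by a subset of the naturals; outside that
    subset [b] takes the default value 0. *)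
Lemma countable_enumeration (Lambda : set R) : countable Lambda ->
  exists (N : pred nat) (b : nat -> R), set_bij [set n | N n] Lambda b.
Proof.
move=> /countable_injP[idx idx_inj].
pose b n := xget 0 [set l | Lambda l /\ idx l = n].
pose N n := `[< exists2 l, Lambda l & idx l = n >].
have bP n : N n -> Lambda (b n) /\ idx (b n) = n.
  rewrite /N => /asboolP[l Ll ln].
  by apply: (@xgetPex _ 0 [set l | Lambda l /\ idx l = n]); exists l.
exists N, b; split.
- by move=> n /bP[].
- move=> m n; rewrite !inE => /bP[_ bm] /bP[_ bn] e.
  by rewrite -bm -bn e.
- move=> l Ll; have Nl : N (idx l) by apply/asboolP; exists l.
  exists (idx l) => //; have [Lb eb] := bP _ Nl.
  by apply: idx_inj; rewrite ?inE.
Qed.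

Lemma esum_enumeration (Lambda : set R) (N : pred nat) (b : nat -> R)
    (c : R -> \bar R) : set_bij [set n | N n] Lambda b -> (forall l, 0 <= c l)%E ->
  (\esum_(l in Lambda) c l = \sum_(n <oo | N n) c (b n))%E.
Proof. by move=> bb c0; rewrite nneseries_esum// (reindex_esum _ _ _ _ bb). Qed.

End CountableSums.

Section ParallelLines.
Context {R : realType}.
Notation mu := (@lebesgue_measure R).
Variables (d : R * R) (Lambda : set R).
Hypothesis d1 : d.1 ^+ 2 + d.2 ^+ 2 = 1.
Hypothesis cLambda : countable Lambda.

(** Lines with distinct offsets are disjoint, since [dotperp] recovers the offset, so the integral
    over their union is the sum of the line integrals. *)
Lemma ge0_integral_parallel_lines (F : R * R -> \bar R) :
  measurable_fun setT F -> (forall z, 0 <= F z)%E ->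
  (\int[hausdorff1_measure]_(z in parallel_lines d Lambda) F z =
   \esum_(l in Lambda) \int[mu]_t F (t *: d + l *: perp d)%R)%E.
Proof.
move=> mF F0; have [N [b bb]] := countable_enumeration cLambda.
rewrite (esum_enumeration bb); last by move=> l; exact: integral_ge0.
have [bL bi bs] := bb.
pose L n := if N n then line d (b n) else set0.
have mL n : measurable (L n).
  by rewrite /L; case: ifP => // _; exact: measurable_line.
have PL : parallel_lines d Lambda = \bigcup_n L n.
  apply/seteqP; split => z.
    move=> [t [l /bs[n Nn <-] ->]]; exists n => //.
    by rewrite /L (_ : N n = true)//; exists t.
  move=> [n _]; rewrite /L; case: ifP => // Nn [t _ <-].
  by exists t; exists (b n) => //; exact: bL.
have tL : trivIset setT L.
  apply/trivIsetP => i j _ _ /eqP ij; apply/seteqP; split => // z [].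
  rewrite /L; case: ifP => // Ni; case: ifP => // Nj; rewrite !lineE//= => zi zj.
  by apply: ij; apply: bi; rewrite ?inE// -zi -zj.
rewrite PL ge0_integral_hausdorff1//; last 2 first.
- exact: bigcup_measurable.
- exact: measurable_funTS.
rewrite ge0_integral_bigcup//; last exact: measurable_funTS.
rewrite [RHS]eseries_mkcond; apply: eq_eseriesr => n _.
by rewrite /L; case: ifP => _; [exact: ge0_integral_line | exact: integral_set0].
Qed.

End ParallelLines.

(** * Sampling on parallel lines *)

Section EssentialBounds.
Context {R : realType}.
Notation mu := (@lebesgue_measure R).
Local Open Scope ereal_scope.
Implicit Types (S : R -> \bar R) (E : set R) (k : nat).

Let box k : set R := `[(- k%:R)%R, (k%:R)%R]%classic.

Let measurable_box k : measurable (box k). Proof. exact: measurable_itv. Qed.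

Definition bounded_by k E := E `<=` `[(- k%:R)%R, (k%:R)%R]%classic.

Lemma lebesgue_measure_bounded k E : measurable E -> bounded_by k E ->
  mu E \is a fin_num.
Proof.
move=> mE Ek; rewrite ge0_fin_numE//; apply: le_lt_trans (le_measure mu _ _ Ek) _.
- by rewrite inE.
- by rewrite inE; exact: measurable_box.
rewrite [ltLHS](lebesgue_measure_itv `[(- k%:R)%R, k%:R%R])/=.
by case: ifP => _; rewrite -?EFinD ltry.
Qed.

Lemma ae_locally_null (D : nat -> set R) : (forall n, measurable (D n)) ->
  (forall n k, mu (D n `&` box k) = 0) ->
  {ae mu, forall t, forall n, ~ D n t}.
Proof.
move=> mD D0; apply: ae_foralln => n.
have : {ae mu, forall t, forall k, ~ (D n `&` box k) t}.
  apply: ae_foralln => k; exists (D n `&` box k); split.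
  - by apply: measurableI; [exact: mD | exact: measurable_box].
  - exact: D0.
  - by move=> t /contrapT.
move=> h0; apply: (ae_imp h0) => t h Dt; apply: (h (Num.truncn `|t|%R).+1).
split => //=.
have := ltW (truncnS_gt `|t|%R).
by rewrite /box /= in_itv/= -ler_norml.
Qed.

Let eps n : R := (n.+1%:R^-1)%R.
Let eps0 n : (0 < eps n)%R. Proof. by rewrite invr_gt0. Qed.

Let small_eps (x : R) : (0 < x)%R -> exists n, (eps n <= x)%R.
Proof.
move=> x0; exists (Num.truncn x^-1); rewrite -[leRHS]invrK.
by rewrite lef_pV2 ?posrE ?invr_gt0// ltW// truncnS_gt.
Qed.

(** For finite [m] the inequality reduces to [eps n * m <= 0]. This cancellation is the reason to
    work inside bounded boxes. *)
Let null (m : \bar R) (n : nat) (c : R) : 0 <= m -> m \is a fin_num ->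
  c%:E * m <= (c - eps n)%R%:E * m -> m = 0.
Proof.
move=> m0 fm; move: m0; rewrite -(fineK fm) -!EFinM !lee_fin => m0 h.
congr EFin; apply/eqP; rewrite eq_le m0 andbT.
by rewrite -(pmulr_rle0 _ (eps0 n)); move: h; rewrite mulrBl; lra.
Qed.

(** Tested on the part of [S <= c - eps n] inside a box, the hypothesis contradicts itself unless
    that part is null; countably many such parts exhaust the set where the bound fails. *)
Lemma ae_ge_integral S (c : R) : measurable_fun setT S -> (forall t, 0 <= S t) ->
  (forall k E, measurable E -> bounded_by k E ->
     c%:E * mu E <= \int[mu]_(t in E) S t) ->
  {ae mu, forall t, c%:E <= S t}.
Proof.
move=> mS S0 h; pose D n := [set t | S t <= (c - eps n)%R%:E].
have mD n : measurable (D n).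
  by rewrite -[D n]setTI; exact: emeasurable_fun_infty_c.
have h0 : {ae mu, forall t, forall n, ~ D n t}.
  apply: ae_locally_null => // n k; set E := _ `&` _.
  have mE : measurable E by apply: measurableI; [exact: mD | exact: measurable_box].
  have Ek : bounded_by k E by exact: subIsetr.
  apply: (@null _ n c) => //; first exact: (lebesgue_measure_bounded mE Ek).
  apply: (le_trans (h k E mE Ek)); rewrite -integral_cst//.
  apply: ge0_le_integral => //; first exact: measurable_funTS.
  by move=> t [].
apply: (ae_imp h0) => t hD; rewrite leNgt; apply/negP => Sc.
have fS : S t \is a fin_num.
  by rewrite ge0_fin_numE//; apply: lt_trans Sc _; rewrite ltry.
have [|n ne] := @small_eps (c - fine (S t)).
  by rewrite subr_gt0 -lte_fin fineK.
by apply: (hD n); rewrite /D /= -(fineK fS) lee_fin; lra.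
Qed.

Lemma ae_le_integral S (c : R) : measurable_fun setT S -> (forall t, 0 <= S t) ->
  (0 <= c)%R ->
  (forall k E, measurable E -> bounded_by k E ->
     \int[mu]_(t in E) S t <= c%:E * mu E) ->
  {ae mu, forall t, S t <= c%:E}.
Proof.
move=> mS S0 c0 h; pose D n := [set t | (c + eps n)%R%:E <= S t].
have mD n : measurable (D n).
  by rewrite -[D n]setTI; exact: emeasurable_fun_c_infty.
have h0 : {ae mu, forall t, forall n, ~ D n t}.
  apply: ae_locally_null => // n k; set E := _ `&` _.
  have mE : measurable E by apply: measurableI; [exact: mD | exact: measurable_box].
  have Ek : bounded_by k E by exact: subIsetr.
  apply: (@null _ n (c + eps n)%R) => //; first exact: (lebesgue_measure_bounded mE Ek).
  rewrite addrK; apply: le_trans (h k E mE Ek); rewrite -integral_cst//.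
  apply: ge0_le_integral => //.
  - by move=> t _; rewrite /= lee_fin addr_ge0// ltW.
  - exact: measurable_funTS.
  by move=> t [].
apply: (ae_imp h0) => t hD; rewrite leNgt; apply/negP => Sc.
(* A real number above [c] stands in for [S t], which may be infinite. *)
have [y yS cy] : exists2 y : R, y%:E <= S t & (c < y)%R.
  case: (S t) Sc => [s| |]; rewrite ?lte_fin.
  - by exists s.
  - by exists (c + 1)%R; rewrite ?leey// ltrDl.
  - by [].
have [|n ne] := @small_eps (y - c); first by rewrite subr_gt0.
by apply: (hD n); rewrite /D /=; apply: le_trans yS; rewrite lee_fin; lra.
Qed.

End EssentialBounds.

(** * Sampling inequalities as bounds on the sum of squared translates *)

Section GaborLines.
Context {R : realType}.
Notation mu := (@lebesgue_measure R).
Notation Rint h := (mu.-integrable setT (EFin \o h)).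
Variables (g : R -> R[i]) (Lambda : set R) (theta : R).
Hypotheses (gi : L2 g) (cLambda : countable Lambda).

Let d := rotation theta (@e2 R).
Let G := metaplectic theta g.
Let Gi : L2 G. Proof. exact: (metaplecticP theta gi).1. Qed.
Let gG : rotates_hcoef theta g G. Proof. exact: (metaplecticP theta gi).2. Qed.

Let S t : \bar R := (\esum_(l in Lambda) (cmod (G (t - l)%R) ^+ 2)%:E)%E.
Let u (F : R -> R[i]) (l t : R) : R[i] := F t * (G (t - l))^*.

Let d1 : d.1 ^+ 2 + d.2 ^+ 2 = 1.
Proof.
rewrite /d /rotation /= !mulr0 !mulr1 sub0r add0r sqrrN addrC.
exact: cos2Dsin2.
Qed.

Let line_rotation l t : t *: d + l *: perp d = rotation theta (l, t).
Proof.
rewrite perp_rotation /d /rotation /= !mulr0 !mulr1 sub0r subr0 add0r addr0.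
by congr pair; rewrite /= /scale_pair /= /GRing.scale /=; ring.
Qed.

Let cmod_u F l t : cmod (u F l t) ^+ 2 = cmod (F t) ^+ 2 * cmod (G (t - l)) ^+ 2.
Proof. by rewrite /u cmodM cmodJ exprMn. Qed.

Let measurable_cmod_sqr (f : R -> R[i]) : cmeas f ->
  measurable_fun setT (fun t => (cmod (f t) ^+ 2)%:E).
Proof.
by move=> mf; apply/measurable_EFinP; apply: measurable_funX; exact: measurable_cmod.
Qed.

Let measurable_Gl l : measurable_fun setT (fun t : R => (cmod (G (t - l)%R) ^+ 2)%:E).
Proof.
exact: measurable_cmod_sqr (L2_meas (L2_shift (- l) Gi)).
Qed.

Let measurable_S : measurable_fun setT S.
Proof.
have [N [b bb]] := countable_enumeration cLambda.
have -> : S = (fun t => \sum_(n <oo | n \in N) (cmod (G (t - b n)%R) ^+ 2)%:E)%E.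
  apply/funext => t; rewrite /S (esum_enumeration bb)// => l.
  by rewrite lee_fin sqr_ge0.
apply: ge0_emeasurable_sum => [n t _ _|n _]; first by rewrite lee_fin sqr_ge0.
exact: measurable_Gl.
Qed.

Let S_ge0 t : (0 <= S t)%E.
Proof. by apply: esum_ge0 => l _; rewrite lee_fin sqr_ge0. Qed.

Let Gl_le_S (l t : R) : Lambda l -> ((cmod (G (t - l)%R) ^+ 2)%:E <= S t)%E.
Proof.
move=> Ll; apply: esum_ge; exists [set l]; last by rewrite fsbig_set1.
by split => // _ ->.
Qed.

Let L2norm_rotates f F : L2 f -> L2 F -> rotates_hcoef theta f F ->
  (L2norm f ^+ 2 = \int[mu]_t (cmod (F t) ^+ 2)%:E)%E.
Proof.
by move=> fi Fi fF; rewrite nrm2E// (rotates_nrm2 fi Fi fF) -nrm2E// L2norm_sqr.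
Qed.

(** Each [u F l] is integrable by Cauchy-Schwarz; its square integrability, the other requirement of
    Plancherel, is left to the two applications. Nonnegative terms allow sum and integral to be
    exchanged even where [S] is infinite. *)
Let integral_stft f F : L2 f -> L2 F -> rotates_hcoef theta f F ->
  (forall l, Lambda l -> L2 (u F l)) ->
  (\int[hausdorff1_measure]_(z in parallel_lines d Lambda) (cmod (stft g f z) ^+ 2)%:E =
   \int[mu]_t ((cmod (F t) ^+ 2)%:E * S t))%E.
Proof.
move=> fi Fi fF ui.
have F0 z : (0 <= (cmod (stft g f z) ^+ 2)%:E)%E by rewrite lee_fin sqr_ge0.
rewrite (ge0_integral_parallel_lines d1 cLambda)//; last first.
  apply/measurable_EFinP; apply: measurable_funX; apply: measurable_cmod.
  exact: cmeas_stft.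
transitivity (\esum_(l in Lambda) \int[mu]_t (cmod (u F l t) ^+ 2)%:E)%E.
  apply: eq_esum => l Ll; have uil := ui l Ll.
  have [Fu nFu] := Plancherel (cint_inner Fi (L2_shift (- l) Gi)) uil.
  transitivity (\int[mu]_t (cmod (fourier (u F l) t) ^+ 2)%:E)%E.
    apply: eq_integral => t _; rewrite line_rotation.
    by rewrite (stft_rotation _ fi gi Fi Gi fF gG).
  by rewrite -!L2norm_sqr !nrm2E// nFu.
have [N [b bb]] := countable_enumeration cLambda.
rewrite (esum_enumeration bb); last first.
  by move=> l; apply: integral_ge0 => t _; rewrite lee_fin sqr_ge0.
pose v n t : \bar R := if N n then (cmod (u F (b n) t) ^+ 2)%:E else 0%E.
transitivity (\sum_(n <oo) \int[mu]_t v n t)%E.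
  rewrite eseries_mkcond; apply: eq_eseriesr => n _; rewrite /v.
  by case: ifP => // _; rewrite integral0.
rewrite -integral_nneseries//; last 2 first.
- move=> n; rewrite /v; case Nn: (N n); last exact: measurable_cst.
  apply: measurable_cmod_sqr.
  by apply: L2_meas; apply: ui; case: bb => bL _ _; exact: bL.
- by move=> n t _; rewrite /v; case: ifP => // _; rewrite lee_fin sqr_ge0.
apply: eq_integral => t _; rewrite /S (esum_enumeration bb); last first.
  by move=> l; rewrite lee_fin sqr_ge0.
rewrite -nneseriesZl; last by move=> n _; rewrite lee_fin sqr_ge0.
rewrite [RHS]eseries_mkcond; apply: eq_eseriesr => n _; rewrite /v.
by case: ifP => // _; rewrite cmod_u EFinM.
Qed.

Let bounds_of_sampling (A B : R) : 0 <= B ->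
  gabor_sampling_trajectory g (parallel_lines d Lambda) A B ->
  {ae mu, forall t, (A%:E <= S t <= B%:E)%E}.
Proof.
move=> B0 samp.
have test k E : measurable E -> bounded_by k E ->
    (A%:E * mu E <= \int[mu]_(t in E) S t <= B%:E * mu E)%E.
  (* With the rotated function an indicator, the sampling inequality compares the integral of [S]
     over [E] with multiples of the measure of [E]. *)
  move=> mE Ek; pose F t : R[i] := (\1_E t : R)%:C.
  have F2 t : cmod (F t) ^+ 2 = \1_E t.
    rewrite cmod_sqr /= expr0n addr0 indicE.
    by case: (t \in E); rewrite ?expr1n ?expr0n.
  have F2E : (\int[mu]_t (cmod (F t) ^+ 2)%:E = mu E)%E.
    transitivity (\int[mu]_t (\1_E t)%:E)%E; first by apply: eq_integral => t _; rewrite F2.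
    by rewrite integral_indic// setIT.
  have mF : cmeas F by apply: cmeas_real; exact: measurable_indic.
  have Fi : L2 F.
    apply/L2P; split => //; apply/integrableP; split.
      exact: measurable_cmod_sqr.
    rewrite (_ : integral _ _ _ = mu E); last first.
      by rewrite -F2E; apply: eq_integral => t _; rewrite /= ger0_norm ?sqr_ge0.
    by rewrite ltey_eq (lebesgue_measure_bounded mE Ek).
  have [f fi fF] := rotates_inverse theta Fi.
  (* An indicator is bounded by 1, so [u F l] is dominated by a translate of [G]. *)
  have ui l : Lambda l -> L2 (u F l).
    move=> _; apply/L2P; have mG := L2_meas (L2_shift (- l) Gi).
    have mu_ : cmeas (u F l) by apply: cmeasM => //; exact: cmeasJ.
    split => //; apply: (Rint_dom _ (L2_int (L2_shift (- l) Gi))).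
      by apply: measurable_funX; exact: measurable_cmod.
    move=> t; rewrite ger0_norm ?sqr_ge0// cmod_u F2 indicE.
    by case: (t \in E); rewrite ?mul1r ?mul0r ?sqr_ge0.
  have := samp f fi; rewrite (integral_stft fi Fi fF ui) (L2norm_rotates fi Fi fF).
  rewrite F2E (_ : (\int[mu]_t ((cmod (F t) ^+ 2)%:E * S t))%E = (\int[mu]_(t in E) S t)%E)//.
  rewrite [RHS]integral_mkcond; apply: eq_integral => t _; rewrite F2 /patch indicE.
  by case: (t \in E); rewrite ?mul1e ?mul0e.
have h1 : {ae mu, forall t, (A%:E <= S t)%E}.
  by apply: ae_ge_integral => // k E mE Ek; have /andP[] := test k E mE Ek.
have h2 : {ae mu, forall t, (S t <= B%:E)%E}.
  by apply: ae_le_integral => // k E mE Ek; have /andP[] := test k E mE Ek.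
apply: (@filterS2 _ _ (ae_filter_ringOfSetsType mu) _ _ _ _ h1 h2).
by move=> t -> ->.
Qed.

Let sampling_of_bounds (A B : R) : 0 <= A -> 0 <= B ->
  {ae mu, forall t, (A%:E <= S t <= B%:E)%E} ->
  gabor_sampling_trajectory g (parallel_lines d Lambda) A B.
Proof.
move=> A0 B0 AB f fi; have [Fi fF] := metaplecticP theta fi.
set F := metaplectic theta f in Fi fF.
have mF2 : measurable_fun setT (fun t => (cmod (F t) ^+ 2)%:E).
  exact: measurable_cmod_sqr (L2_meas Fi).
have F20 t : (0 <= (cmod (F t) ^+ 2)%:E)%E by rewrite lee_fin sqr_ge0.
(* A single squared translate is at most [S], hence at most [B] almost everywhere, so multiplication
   by it keeps [F] in [L2]. *)
have ui l : Lambda l -> L2 (u F l).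
  move=> Ll; have mG := L2_meas (L2_shift (- l) Gi).
  have mu_ : cmeas (u F l) by apply: cmeasM; [exact: L2_meas | exact: cmeasJ].
  have mu2 : measurable_fun setT (fun t => (cmod (u F l t) ^+ 2)%:E).
    exact: measurable_cmod_sqr.
  apply/L2P; split => //; apply/integrableP; split => //.
  rewrite (_ : integral _ _ _ = (\int[mu]_t (cmod (u F l t) ^+ 2)%:E)%E); last first.
    by apply: eq_integral => t _; rewrite /= ger0_norm ?sqr_ge0.
  apply: (@le_lt_trans _ _ (\int[mu]_t (B%:E * (cmod (F t) ^+ 2)%:E))%E).
    apply: ae_ge0_le_integral => //.
    - by move=> t _; rewrite lee_fin sqr_ge0.
    - by move=> t _; rewrite mule_ge0// lee_fin.
    - by apply: emeasurable_funM => //; exact: measurable_cst.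
    apply: (ae_imp AB) => t /andP[_ SB] _; rewrite cmod_u mulrC EFinM.
    by apply: lee_wpmul2r => //; apply: le_trans SB; exact: Gl_le_S.
  rewrite ge0_integralZl//.
  by rewrite -L2norm_sqr nrm2E// -EFinM ltry.
rewrite (integral_stft fi Fi fF ui) (L2norm_rotates fi Fi fF).
have mFS : measurable_fun setT (fun t => (cmod (F t) ^+ 2)%:E * S t)%E.
  exact: emeasurable_funM.
rewrite -!ge0_integralZl ?lee_fin//; apply/andP; split.
  apply: ae_ge0_le_integral => //.
  - by move=> t _; rewrite mule_ge0// lee_fin.
  - by apply: emeasurable_funM => //; exact: measurable_cst.
  - by move=> t _; rewrite mule_ge0.
  by apply: (ae_imp AB) => t /andP[AS _] _; rewrite muleC; exact: lee_wpmul2l.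
apply: ae_ge0_le_integral => //.
- by move=> t _; rewrite mule_ge0.
- by move=> t _; rewrite mule_ge0// lee_fin.
- by apply: emeasurable_funM => //; exact: measurable_cst.
by apply: (ae_imp AB) => t /andP[_ SB] _; rewrite [leRHS]muleC; exact: lee_wpmul2l.
Qed.

Lemma gabor_sampling_parallel_lines (A B : R) : 0 <= A -> 0 <= B ->
  gabor_sampling_trajectory g (parallel_lines d Lambda) A B <->
  {ae mu, forall t, (A%:E <= S t <= B%:E)%E}.
Proof. by move=> A0 B0; split; [exact: bounds_of_sampling | exact: sampling_of_bounds]. Qed.

End GaborLines.

Theorem proposition7 (R : realType) (g : R -> R[i]) (Lambda : set R)
    (theta : R) (d : R * R) (A B : R)
    (hg : L2 g) (hLambda : countable Lambda)
    (htheta : 0 <= theta < 1) (hd : d = rotation theta e2)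
    (hA : 0 < A) (hB : 0 < B) :
  gabor_sampling_trajectory g (parallel_lines d Lambda) A B <->
  {ae lebesgue_measure, forall t : R,
     (A%:E <= \esum_(l in Lambda) (cmod (metaplectic theta g (t - l)%R) ^+ 2)%:E
      <= B%:E)%E}.
Proof. by rewrite hd; apply: gabor_sampling_parallel_lines => //; exact: ltW. Qed.
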